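(* Let $G$ be an infinite connected simple graph with bounded degrees that is uniformly weakly recurrent. Let $\{Y_n\}_n$ be the simple random walk on the lamplighter graph (wreath product) $\{0,1\}\wr G$, let $P^{\mathbf{x}}$ denote its law started at $\mathbf{x}$, and let $d$ be the graph distance on $\{0,1\}\wr G$. Then for every vertex $\mathbf{x}$ of $\{0,1\}\wr G$ and every $\epsilon>0$: (i) $$\limsup_{n\to\infty}\frac{d(Y_0,Y_n)}{n/\log n}\le\left(2\max_{z\in V(G)}\deg(z)+1\right)r_{\sup},\quad P^{\mathbf{x}}\text{-a.s.},$$ and $$\lim_{n\to\infty}P^{\mathbf{x}}\left(\frac{d(Y_0,Y_n)}{n/\log n}\le\frac{r_{\inf}}{4}-\epsilon\right)=0.$$ (ii) If furthermore $G$ is Ahlfors $\alpha$-regular for some $\alpha>0$, then $$\liminf_{n\to\infty}\frac{d(Y_0,Y_n)}{n/\log n}\ge\frac{r_{\inf}}{4},\quad P^{\mathbf{x}}\text{-a.s.}$$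
   Context: The simple random walk on a graph is the Markov chain that at each step moves from its current vertex $z$ to each neighbour of $z$ with probability $1/\deg(z)$. Let $(S_n)_{n\ge 0}$ be the simple random walk on $G$, started at $x\in V(G)$ under $P^x$; write $p_n(x,y)=P^x(S_n=y)$ and $T_x=\inf\{k\ge1:S_k=x\}$. $G$ is uniformly weakly recurrent if there exist positive constants $c,C$ such that $c\le n\,(p_n(x,x)+p_{n+1}(x,x))\le C$ for every $n\ge 1$ and every $x\in V(G)$. Define $$r_{\inf}=\liminf_{n\to\infty}(\log n)\inf_{x\in V(G)}P^x(T_x>n),\qquad r_{\sup}=\limsup_{n\to\infty}(\log n)\sup_{x\in V(G)}P^x(T_x>n).$$ $G$ is Ahlfors $\alpha$-regular if there exist positive constants $c_1,c_2$ such that $c_1n^\alpha\le|B(x,n)|\le c_2n^\alpha$ for every $n\ge1$ and $x\in V(G)$, where $B(x,n)$ is the closed ball of radius $n$ around $x$ in the graph distance of $G$. The lamplighter graph (wreath product) $\{0,1\}\wr G$ has as vertices the pairs $(\eta,x)$ with $x\in V(G)$ and $\eta:V(G)\to\{0,1\}$ of finite support. Vertices $(\eta,x)$ and $(\xi,y)$ are adjacent if either $\eta=\xi$ and $\{x,y\}\in E(G)$, or $x=y$ and $\eta,\xi$ differ exactly at $x$. *)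

(* Defs.v *)
From HB Require Import structures.
From mathcomp Require Export all_boot all_order all_algebra.
From mathcomp Require Export finmap.
From mathcomp Require Export all_classical all_reals all_analysis.

Set Implicit Arguments.
Unset Strict Implicit.
Unset Printing Implicit Defensive.

Import Order.TTheory GRing.Theory Num.Theory.
Import numFieldNormedType.Exports.

Local Open Scope classical_set_scope.
Local Open Scope ring_scope.

Record sgraph := SGraph {
  vertex :> choiceType;
  adj : rel vertex;
  adj_sym : symmetric adj;
  adj_irrefl : irreflexive adj }.

Section Graph.
Variable G : sgraph.

Definition neighbors (x : G) : set G := [set y | adj x y].

(* [fset_set] is the empty set on infinite sets, so [deg], like [ball_card]
   below, is meaningful only for locally finite graphs. *)
Definition deg (x : G) : nat := #|` fset_set (neighbors x)|.

Definition bounded_degree : Prop :=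
  exists D : nat, forall x : G, finite_set (neighbors x) /\ (deg x <= D)%N.

(* With bounded degrees the set of degrees is finite, so this supremum is a
   maximum. *)
Definition max_deg (R : realType) : R := sup [set (deg z)%:R | z in [set: G]].

Definition walk_of_length (x y : G) (n : nat) : Prop :=
  exists p : seq G, [/\ path (@adj G) x p, last x p = y & size p = n].

Definition connected_graph : Prop :=
  forall x y : G, exists n, walk_of_length x y n.

Lemma walk_length_ex (x y : G) :
  (exists n, walk_of_length x y n) -> exists n, `[< walk_of_length x y n >].
Proof. by move=> [n xyn]; exists n; apply/asboolP. Qed.

(* The value 0 for vertices in different components is a junk value. *)
Definition gdist (x y : G) : nat :=
  match pselect (exists n, walk_of_length x y n) with
  | left h => ex_minn (walk_length_ex h)
  | right _ => 0%N
  end.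

Definition ball_card (x : G) (n : nat) : nat :=
  #|` fset_set [set y : G | (gdist x y <= n)%N]|.

Definition ahlfors_regular (R : realType) (alpha : R) : Prop :=
  exists c1 c2 : R, [/\ 0 < c1, 0 < c2 &
    forall (n : nat) (x : G), (1 <= n)%N ->
      c1 * n%:R `^ alpha <= (ball_card x n)%:R <= c2 * n%:R `^ alpha].

Definition srw_step (R : realType) (x y : G) : R :=
  if adj x y then (deg x)%:R^-1 else 0.

(* Vertex sets carry the discrete sigma-algebra; as the graphs considered are
   countable, it is enough to have measurability on singletons. *)
Record is_srw (R : realType) (d : measure_display) (T : measurableType d)
    (P : probability T R) (x : G) (S : nat -> T -> G) : Prop := IsSRW {
  srw_measurable : forall (n : nat) (v : G), measurable (S n @^-1` [set v]);
  srw_start : P [set w | S 0%N w = x] = 1%E;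
  srw_markov : forall (n : nat) (v : nat -> G),
    P [set w | forall i, (i <= n.+1)%N -> S i w = v i] =
    (P [set w | forall i, (i <= n)%N -> S i w = v i] *
     (srw_step R (v n) (v n.+1))%:E)%E }.

Section WalkQuantities.
Context (R : realType) (d : measure_display) (T : measurableType d).
Variables (P : G -> probability T R) (S : nat -> T -> G).

Definition trans_prob (n : nat) (x y : G) : \bar R :=
  P x [set w | S n w = y].

(* Equal to [+oo] when the walk never visits x at a positive time. *)
Definition return_time (x : G) (w : T) : \bar R :=
  ereal_inf [set k%:R%:E | k in [set k : nat | (1 <= k)%N /\ S k w = x]].

Definition no_return_prob (n : nat) (x : G) : \bar R :=
  P x [set w | (n%:R%:E < return_time x w)%E].

Definition uniformly_weakly_recurrent : Prop :=
  exists c C : R, [/\ 0 < c, 0 < C &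
    forall (n : nat) (x : G), (1 <= n)%N ->
      (c%:E <= n%:R%:E * (trans_prob n x x + trans_prob n.+1 x x) <= C%:E)%E].

Definition r_inf : \bar R :=
  limn_einf (fun n : nat =>
    ((ln n%:R)%:E * ereal_inf [set no_return_prob n x | x in [set: G]])%E).

Definition r_sup : \bar R :=
  limn_esup (fun n : nat =>
    ((ln n%:R)%:E * ereal_sup [set no_return_prob n x | x in [set: G]])%E).

End WalkQuantities.

(* d(Y_0, Y_n) / (n / log n); the values at n = 0, 1 are irrelevant. *)
Definition rescaled_dist (R : realType) (T : Type) (Y : nat -> T -> G)
    (n : nat) (w : T) : R :=
  (gdist (Y 0%N w) (Y n w))%:R / (n%:R / ln n%:R).

End Graph.

Section Lamplighter.
Variable G : sgraph.

Definition lamp_vertex : choiceType := ({fsfun G -> bool with false} * G)%type.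

Definition lamp_adj : rel lamp_vertex := fun u v =>
  ((u.1 == v.1) && adj u.2 v.2) ||
  ((u.2 == v.2) && `[< forall z : G, (u.1 z != v.1 z) = (z == u.2) >]).

Lemma lamp_adj_sym : symmetric lamp_adj.
Proof.
move=> u v; rewrite /lamp_adj [v.1 == _]eq_sym [v.2 == _]eq_sym adj_sym.
congr (_ || _); case: eqP => //= ->.
by congr asbool; apply/propext; split=> h z; rewrite eq_sym h.
Qed.

Lemma lamp_adj_irrefl : irreflexive lamp_adj.
Proof.
move=> u; rewrite /lamp_adj adj_irrefl andbF /= eqxx /=.
by apply/asboolPn => /(_ u.2); rewrite !eqxx.
Qed.

Definition lamplighter : sgraph := SGraph lamp_adj_sym lamp_adj_irrefl.

End Lamplighter.

(* Main.v *)
(** The base position of Y performs a lazy simple random walk on G, and the lamp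
    of a vertex that has been visited many times is nearly uniform. If L is the
    number of lamps that changed and V the number of visited vertices, then
    2 L - 1 <= d(Y_0, Y_n) <= 4 V: each changed lamp costs a switch and
    all but one cost a jump, while a closed tour of the visited vertices has
    length at most 2 (V - 1), the final path at most V - 1, and at most V lamps
    are switched. Moreover L is about half of the number of vertices that are
    visited more than K times, for K large.

    On G, the expected number of vertices visited more than K times during m
    steps is about m P(T > m), because P(T > t) varies slowly: from a renewal
    identity and the logarithmic growth of the Green function,
    P(T > k) - P(T > n) = O(log (n / k) / (log k)^2). Cutting the walk into many
    blocks, the block counts concentrate by an exponential moment bound, and the
    loss due to vertices shared between blocks is small in expectation by the
    same estimate. This gives failure probabilities of order
    sqrt (sqrt i) / i at the times n_i ~ i^6 exp (i / 1000); they become summable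
    after squaring, that is, by asking only one of two independent halves of the
    walk to succeed. Borel-Cantelli along n_i and monotonicity in between
    conclude.

    The constant 1/4 = 1/2 * 1/2 consists of the lazy walk moving at least half of
    the time and of one half of the walk being used (the factor 2 in 2 L - 1
    cancels the half of the lamps that are changed). As adjacent vertices cannot
    both have degree 1, the walk in fact moves with frequency at least
    13/24 > 50/96 > 1/2; this margin absorbs the errors, so the lower bound holds
    eventually and not only in the limit. Likewise, the upper bound with the
    constant 4 leaves room below 2 max deg + 1 >= 5. *)

Require Import Defs.
From mathcomp Require Import zify ring lra.

Set Implicit Arguments.
Unset Strict Implicit.
Unset Printing Implicit Defensive.

Import Order.TTheory GRing.Theory Num.Theory.
Import numFieldNormedType.Exports.

Local Open Scope classical_set_scope.
Local Open Scope ring_scope.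

(** The degree is required to be positive so that dividing by it turns sums over neighbours into
    averages. *)
Definition locally_finite (G : sgraph) :=
  forall x : G, finite_set (neighbors x) /\ (0 < deg x)%N.

(** * Expectations along the simple random walk *)

Section WalkExpectation.
Context (R : realType) (G : sgraph) (Glf : locally_finite G).
Implicit Types (x y z : G) (p q : seq G) (f g : seq G -> R) (n m : nat).

(* The list passed to [f] holds the positions at times 1 to n; the starting point
   is left out. *)
Fixpoint walkE n x f : R :=
  if n is n'.+1 then
    (deg x)%:R^-1 *
      \sum_(y <- fset_set (neighbors x)) walkE n' y (fun p => f (y :: p))
  else f [::].

Lemma mem_nbr x y : (y \in fset_set (neighbors x)) = adj x y.
Proof. by rewrite in_fset_set; [apply/idP/idP; rewrite inE|have [] := Glf x]. Qed.

Lemma degR_gt0 x : 0 < (deg x)%:R :> R.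
Proof. by rewrite ltr0n; have [] := Glf x. Qed.

Lemma nbr_avg_const x (c : R) :
  (deg x)%:R^-1 * \sum_(y <- fset_set (neighbors x)) c = c.
Proof.
rewrite big_const_seq iter_addr_0 count_predT -/(deg x) -[c *+ _]mulr_natl mulrA.
by rewrite mulVf ?mul1r// gt_eqF ?degR_gt0.
Qed.

Lemma ler_nbr_avg x (F1 F2 : G -> R) :
  (forall y, adj x y -> F1 y <= F2 y) ->
  (deg x)%:R^-1 * \sum_(y <- fset_set (neighbors x)) F1 y <=
  (deg x)%:R^-1 * \sum_(y <- fset_set (neighbors x)) F2 y.
Proof.
move=> h; rewrite ler_pM2l ?invr_gt0 ?degR_gt0//.
by rewrite !big_seq ler_sum// => y; rewrite mem_nbr; apply: h.
Qed.

Lemma nbr_avg_le x (F : G -> R) (c : R) :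
  (forall y, adj x y -> F y <= c) ->
  (deg x)%:R^-1 * \sum_(y <- fset_set (neighbors x)) F y <= c.
Proof. by move=> h; rewrite -[leRHS](nbr_avg_const x) ler_nbr_avg. Qed.

Lemma nbr_avg_ge x (F : G -> R) (c : R) :
  (forall y, adj x y -> c <= F y) ->
  c <= (deg x)%:R^-1 * \sum_(y <- fset_set (neighbors x)) F y.
Proof. by move=> h; rewrite -[leLHS](nbr_avg_const x) ler_nbr_avg. Qed.

Lemma ler_walkE n x f g :
  (forall p, path (@adj G) x p -> size p = n -> f p <= g p) ->
  walkE n x f <= walkE n x g.
Proof.
elim: n x f g => [|n IH] x f g h /=; first exact: h.
by apply: ler_nbr_avg => y xy; apply: IH => p yp sp; apply: h; rewrite /= ?xy ?sp.
Qed.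

Lemma eq_walkE n x f g :
  (forall p, path (@adj G) x p -> size p = n -> f p = g p) ->
  walkE n x f = walkE n x g.
Proof. by move=> h; apply/le_anti/andP; split; apply: ler_walkE => p *; rewrite h. Qed.

Lemma walkE_cst n x (c : R) : walkE n x (fun=> c) = c.
Proof.
elim: n x => //= n IH x.
by under eq_bigr do rewrite IH; exact: nbr_avg_const.
Qed.

Lemma walkE_le n x f (c : R) :
  (forall p, path (@adj G) x p -> size p = n -> f p <= c) -> walkE n x f <= c.
Proof. by move=> h; rewrite -[leRHS](walkE_cst n x) ler_walkE. Qed.

Lemma walkE_ge n x f (c : R) :
  (forall p, path (@adj G) x p -> size p = n -> c <= f p) -> c <= walkE n x f.
Proof. by move=> h; rewrite -[leLHS](walkE_cst n x) ler_walkE. Qed.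

Lemma walkE_ge0 n x f : (forall p, 0 <= f p) -> 0 <= walkE n x f.
Proof. by move=> h; apply: walkE_ge. Qed.

Lemma walkED n x f g :
  walkE n x (fun p => f p + g p) = walkE n x f + walkE n x g.
Proof.
elim: n x f g => //= n IH x f g.
under eq_bigr do rewrite IH.
by rewrite big_split/= mulrDr.
Qed.

Lemma walkEZ n x (c : R) f : walkE n x (fun p => c * f p) = c * walkE n x f.
Proof.
elim: n x f => //= n IH x f.
under eq_bigr do rewrite IH.
by rewrite -big_distrr/= mulrCA.
Qed.

Lemma walkEN n x f : walkE n x (fun p => - f p) = - walkE n x f.
Proof.
rewrite -mulN1r -walkEZ; apply: eq_walkE => p _ _.
by rewrite mulN1r.
Qed.

Lemma walkEB n x f g :
  walkE n x (fun p => f p - g p) = walkE n x f - walkE n x g.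
Proof. by rewrite walkED walkEN. Qed.

Lemma walkE_sum n x (I : Type) (r : seq I) (F : I -> seq G -> R) :
  walkE n x (fun p => \sum_(i <- r) F i p) = \sum_(i <- r) walkE n x (F i).
Proof.
elim: r => [|i r IH].
  rewrite big_nil -[RHS](walkE_cst n x).
  by apply: eq_walkE => p _ _; rewrite big_nil.
by rewrite big_cons -IH -walkED; apply: eq_walkE => p _ _; rewrite big_cons.
Qed.

(** The Markov property at time [m]: after [p], the walk restarts from [last x p]. *)
Lemma walkE_cat m n x f :
  walkE (m + n) x f =
  walkE m x (fun p => walkE n (last x p) (fun q => f (p ++ q))).
Proof.
elim: m x f => //= m IH x f.
by congr (_ * _); apply: eq_bigr => y _; rewrite IH.
Qed.

Lemma walkE_prefix m n x f :
  walkE (m + n) x (fun p => f (take m p)) = walkE m x f.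
Proof.
rewrite walkE_cat; apply: eq_walkE => p _ sp.
rewrite -[RHS](walkE_cst n (last x p)); apply: eq_walkE => q _ _.
by rewrite take_size_cat.
Qed.

(** Markov's inequality. Nonnegativity is asked only for lists of length [n], because it is applied
    to [excess], whose sign is known only at the right length. *)
Lemma walkE_markov n x (A : pred (seq G)) f (c : R) : 0 < c ->
  (forall p, size p = n -> 0 <= f p) ->
  (forall p, size p = n -> A p -> c <= f p) ->
  walkE n x (fun p => (A p)%:R) <= c^-1 * walkE n x f.
Proof.
move=> c0 f0 h; rewrite -walkEZ; apply: ler_walkE => p _ sp.
case: (boolP (A p)) => [Ap|_]; last by rewrite mulr_ge0 ?f0// ltW// invr_gt0.
by rewrite ler_pdivlMl// mulr1; apply: h.
Qed.

End WalkExpectation.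

(** * Escape probabilities and the Green function *)

(** Concavity: [ln] lies below its tangent at [a]. Both orders of [a] and [b] occur below. *)
Lemma lnB_le (R : realType) (a b : R) :
  0 < a -> 0 < b -> ln b - ln a <= (b - a) / a.
Proof.
move=> a0 b0; rewrite -ln_div ?posrE//.
have -> : b / a = 1 + (b - a) / a by field; rewrite gt_eqF.
apply: le_ln1Dx; rewrite ltr_pdivlMr//; lra.
Qed.

Section Renewal.
Context (R : realType) (G : sgraph) (Glf : locally_finite G).
Implicit Types (x y z : G) (p q : seq G) (n m : nat).

(** In probabilistic notation [noret n x] is P^x(T_x > n), [ret n x] is p_n(x,x), and [green n x] is
    the diagonal Green function truncated at time [n]. *)
Definition noret n x : R := walkE n x (fun p => (x \notin p)%:R).
Definition ret n x : R := walkE n x (fun p => (last x p == x)%:R).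
Definition green n x : R := \sum_(i < n.+1) ret i x.

Lemma noret_ge0 n x : 0 <= noret n x.
Proof. by apply: walkE_ge0 => // p; rewrite ler0n. Qed.

Lemma noret_le1 n x : noret n x <= 1.
Proof. by apply: walkE_le => // p _ _; rewrite lern1 leq_b1. Qed.

Lemma ret_ge0 n x : 0 <= ret n x.
Proof. by apply: walkE_ge0 => // p; rewrite ler0n. Qed.

Lemma noret_noninc m n x : (m <= n)%N -> noret n x <= noret m x.
Proof.
move=> mn; rewrite /noret -(subnKC mn) -(walkE_prefix Glf m (n - m)).
apply: (ler_walkE Glf) => p _ _; rewrite ler_nat.
case: (boolP (x \notin p)) => // xp; rewrite lt0b.
by apply: contra xp => /mem_take.
Qed.

(* Splits the event that x is visited according to its last visit. *)
Lemma last_visit_sum x z p :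
  (\sum_(i < (size p).+1)
     (last z (take i p) == x) * (x \notin drop i p) = (x \in z :: p))%N.
Proof.
elim: p z => [|y p IH] z.
  by rewrite big_ord_recl big_ord0 /= muln1 addn0 inE eq_sym.
rewrite big_ord_recl/= IH !inE.
case: (eqVneq x z) => [->|xz]; last by rewrite /= add0n.
by rewrite mul1n; case: (boolP (z == y)); case: (boolP (z \in p)).
Qed.

(** Last-exit decomposition: the walk starts at x, so exactly one time i up to n is its last visit
    to x. By the Markov property, the steps after time i form a walk from x that avoids x. *)
Lemma renewal n x : \sum_(i < n.+1) ret i x * noret (n - i) x = 1.
Proof.
rewrite -[RHS](walkE_cst Glf n x).
transitivity (walkE n x (fun p => \sum_(i < n.+1)
    (last x (take i p) == x)%:R * (x \notin drop i p)%:R : R)).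
  rewrite walkE_sum//; apply: eq_bigr => i _.
  have iln : (i <= n)%N by rewrite -ltnS.
  rewrite -[X in _ = walkE X _ _](subnKC iln) walkE_cat /ret mulrC -walkEZ//.
  apply: (eq_walkE Glf) => p _ sp; rewrite mulrC /noret -walkEZ//.
  case: (eqVneq (last x p) x) => [lp|lp].
    rewrite lp; apply: (eq_walkE Glf) => q _ _.
    by rewrite take_size_cat// drop_size_cat// lp eqxx.
  transitivity (walkE (n - i) x (fun=> 0 : R)).
    by apply: (eq_walkE Glf) => q _ _; rewrite mul0r.
  rewrite walkE_cst// -(walkE_cst Glf (n - i) (last x p) 0).
  by apply: (eq_walkE Glf) => q _ _; rewrite take_size_cat// (negPf lp) mul0r.
apply: (eq_walkE Glf) => p _ sp.
under eq_bigr do rewrite -natrM.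
by rewrite -natr_sum -sp last_visit_sum mem_head.
Qed.

Lemma greenS n x : green n.+1 x = green n x + ret n.+1 x.
Proof. by rewrite /green big_ord_recr. Qed.

Lemma green_ge1 n x : 1 <= green n x.
Proof.
elim: n => [|n IH]; last by rewrite greenS ler_wpDr// ret_ge0.
by rewrite /green big_ord1 /ret/= eqxx.
Qed.

(** Monotonicity replaces each factor [noret (n - i) x] of the renewal identity by the smallest
    one. *)
Lemma noret_green n x : noret n x * green n x <= 1.
Proof.
rewrite -(renewal n x) mulrC big_distrl ler_sum//= => i _.
by rewrite ler_wpM2l ?ret_ge0// noret_noninc// leq_subr.
Qed.

(** In the renewal identity at time [m + n], the terms with i at most m leave at least n steps, so
    their second factor is at most [noret n x]; in the later terms it is bounded by 1. *)
Lemma noret_green_ge m n x :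
  1 <= noret n x * green m x + (green (m + n) x - green m x).
Proof.
have E k : green (m + k) x = green m x + \sum_(i < k) ret (m.+1 + i) x.
  elim: k => [|k IH]; first by rewrite addn0 big_ord0 addr0.
  by rewrite addnS greenS IH big_ord_recr/= addrA addSn.
rewrite -[leLHS](renewal (m + n) x) E [_ + \sum_(_ < _) _ - _]addrC addKr.
rewrite -addSn big_split_ord/= lerD//.
  rewrite mulrC big_distrl ler_sum//= => i _.
  by rewrite ler_wpM2l ?ret_ge0// noret_noninc//; have := ltn_ord i; lia.
by apply: ler_sum => i _; rewrite ler_piMr ?ret_ge0// noret_le1.
Qed.

Section UniformlyRecurrent.
Context (c C : R) (c0 : 0 < c) (C0 : 0 < C).
Hypothesis ret_bounds : forall n x, (1 <= n)%N ->
  c <= n%:R * (ret n x + ret n.+1 x) <= C.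

Lemma ret_le n x : (0 < n)%N -> ret n x <= C / n%:R.
Proof.
move=> n0; have /andP[_ h] := ret_bounds x n0.
rewrite ler_pdivlMr ?ltr0n// mulrC (le_trans _ h)// ler_wpM2l//.
by rewrite lerDl ret_ge0.
Qed.

Lemma green_ge n x : (0 < n)%N -> c / 2 * ln n%:R <= green n x.
Proof.
move=> n0.
(* The hypothesis bounds sums of two consecutive return probabilities. Adding these up counts the
   interior terms twice and the last one once, which the term [ret n x] corrects. *)
suff : c * ln n%:R <= 2 * green n x - ret n x.
  by have := ret_ge0 n x; lra.
elim: n n0 => // -[_ _|n IH _].
  rewrite ln1 mulr0 greenS mulrDr.
  by have := green_ge1 0 x; have := ret_ge0 1 x; lra.
have {}IH := IH isT; rewrite greenS.
have /andP[h _] := ret_bounds x (ltn0Sn n).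
have n0 : 0 < n.+1%:R :> R by rewrite ltr0n.
have h2 : c / n.+1%:R <= ret n.+1 x + ret n.+2 x by rewrite ler_pdivrMr// mulrC.
have h3 : ln n.+2%:R - ln n.+1%:R <= n.+1%:R^-1 :> R.
  have := @lnB_le R n.+1%:R n.+2%:R; rewrite !ltr0n => /(_ isT isT)/le_trans; apply.
  by rewrite -natrB// subSnn mul1r.
have : c * (ln n.+2%:R - ln n.+1%:R) <= c / n.+1%:R by rewrite ler_pM2l.
move: h2; move: (c / _) => r; lra.
Qed.

(** Each new term is at most C / j, and the harmonic sum over m < j <= n is at most ln (n / m). *)
Lemma green_incr m n x : (0 < m)%N -> (m <= n)%N ->
  green n x - green m x <= C * ln (n%:R / m%:R).
Proof.
move=> m0; have m0R : 0 < m%:R :> R by rewrite ltr0n.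
elim: n => [|n IH]; first by lia.
rewrite leq_eqVlt => /orP[/eqP<-|]; first by rewrite subrr divff ?gt_eqF// ln1 mulr0.
rewrite ltnS => mn; have {}IH := IH mn.
have n0 : 0 < n%:R :> R by rewrite ltr0n; lia.
have nn : n.+1%:R = n%:R + 1 :> R by rewrite -natr1.
rewrite greenS; rewrite ln_div ?posrE// in IH; rewrite ln_div ?posrE ?ltr0n//.
have h := ret_le x (ltn0Sn n).
have := @lnB_le R n.+1%:R n%:R; rewrite ltr0Sn n0 => /(_ isT isT).
have -> : (n%:R - n.+1%:R) / n.+1%:R = - n.+1%:R^-1 :> R.
  by rewrite nn opprD addNKr mulN1r.
move=> h2; have : C * (n.+1%:R)^-1 <= C * (ln n.+1%:R - ln n%:R).
  by rewrite ler_pM2l//; move: h2; move: (n.+1%:R^-1) => r; lra.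
move: h; move: (C / _) => r; lra.
Qed.

Lemma noret_le n x : (1 < n)%N -> noret n x <= 2 / (c * ln n%:R).
Proof.
move=> n1; have l0 : 0 < ln n%:R :> R by rewrite ln_gt0// ltr1n.
have := noret_green n x; have := green_ge x (ltnW n1).
move=> h1 h2; rewrite ler_pdivlMr ?mulr_gt0//.
have := ler_wpM2l (noret_ge0 n x) h1; lra.
Qed.

(** Slow variation of the escape probability. Subtract the lower bound [noret_green_ge] with m = q n
    from the upper bound [noret_green] at k, and divide by [green k x], which is at least c ln k /
    2. The parameter q is free: a large q makes the increment of [green] from q n to q n + n at most
    C / q, at the price of a longer logarithm. *)
Lemma noretB_le k n (q : nat) x : (1 < k)%N -> (k <= n)%N -> (0 < q)%N ->
  noret k x - noret n x <=
  2 / (c * ln k%:R) *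
    (C * (2 / (c * ln k%:R)) * ln ((q * n)%:R / k%:R) + C / q%:R).
Proof.
move=> k1 kn q0; set e := 2 / (c * ln k%:R).
have l0 : 0 < ln k%:R :> R by rewrite ln_gt0// ltr1n.
have e0 : 0 < e by rewrite divr_gt0// mulr_gt0.
have aU := noret_green k x.
have n0 : (0 < n)%N by lia.
have kqn : (k <= q * n)%N by rewrite (leq_trans kn)// leq_pmull.
have bU := noret_green_ge (q * n) n x.
have h1 : green (q * n + n) x - green (q * n) x <= C / q%:R.
  apply: le_trans (green_incr x _ _) _; [by lia|by lia|].
  have q0R : 0 < q%:R :> R by rewrite ltr0n.
  have n0R : 0 < n%:R :> R by rewrite ltr0n.
  rewrite ler_pM2l// natrD natrM.
  have -> : (q%:R * n%:R + n%:R) / (q%:R * n%:R) = 1 + q%:R^-1 :> R.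
    by field; rewrite !gt_eqF.
  by apply: le_ln1Dx; rewrite (lt_trans (ltrN10 _))// invr_gt0.
have h2 : green (q * n) x <= green k x + C * ln ((q * n)%:R / k%:R).
  by rewrite -lerBlDl green_incr// ltnW.
have Uk : e^-1 <= green k x.
  rewrite /e invf_div; apply: le_trans _ (green_ge x (ltnW k1)).
  by rewrite mulrAC.
have ae : noret k x <= e by rewrite noret_le.
have ba := noret_noninc x kn.
have b0 := noret_ge0 n x.
set L := ln _ in h2 *.
have L0 : 0 <= L.
  rewrite ln_ge0// ler_pdivlMr ?ltr0n; last exact: ltnW k1.
  by rewrite mul1r ler_nat.
have bCL : noret n x * (C * L) <= C * e * L.
  rewrite mulrCA -mulrA ler_pM2l// ler_wpM2r//; lra.
have h3 : noret n x * green (q * n) x <= noret n x * (green k x + C * L).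
  exact: ler_wpM2l.
have h4 : (noret k x - noret n x) * green k x <= C * e * L + C / q%:R.
  by rewrite mulrBl; rewrite mulrDr in h3; lra.
have h5 : (noret k x - noret n x) * e^-1 <= C * e * L + C / q%:R.
  by apply: le_trans h4; rewrite ler_wpM2l//; lra.
by rewrite ler_pdivrMr// in h5; rewrite mulrC.
Qed.

End UniformlyRecurrent.
End Renewal.

(** * Vertices visited several times *)

Section Visits.
Context (T : choiceType).
Implicit Types (z : T) (p q : seq T) (K : nat).
Local Open Scope fset_scope.

Definition visits K p : {fset T} := [fset z in p | (K <= count_mem z p)%N].
Definition nvisits K p : nat := #|` visits K p|.

Lemma in_visits K p z : (0 < K)%N ->
  (z \in visits K p) = (K <= count_mem z p)%N.
Proof.
move=> K0; rewrite !inE/= andb_idl// => h.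
by rewrite -has_pred1 has_count (leq_trans K0).
Qed.

Lemma in_visits1 p z : (z \in visits 1 p) = (z \in p).
Proof. by rewrite in_visits// -has_pred1 has_count. Qed.

Lemma nvisits_nil K : nvisits K [::] = 0%N.
Proof. by apply/eqP; rewrite cardfs_eq0; apply/eqP/fsetP => z; rewrite !inE. Qed.

(** Each vertex is counted at its unique visit that is followed by exactly k later ones. Expected
    counts thus become sums over times. *)
Lemma nvisits_cons k y p :
  nvisits k.+1 (y :: p) = ((count_mem y p == k) + nvisits k.+1 p)%N.
Proof.
rewrite /nvisits; case: eqVneq => [h|h].
  have -> : visits k.+1 (y :: p) = y |` visits k.+1 p.
    apply/fsetP => z; rewrite in_fset1U !in_visits//=.
    by case: (eqVneq z y) => [->|zy]; rewrite ?h// ?eqxx ?ltnn ?addnn; lia.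
  by rewrite cardfsU1 in_visits// h ltnn.
have -> // : visits k.+1 (y :: p) = visits k.+1 p.
apply/fsetP => z; rewrite !in_visits//=.
case: (eqVneq y z) => [yz|//]; rewrite -yz add1n ltnS leq_eqVlt [k == _]eq_sym (negPf h) //.
Qed.

Lemma nvisits_cat_l K p q : (nvisits K p <= nvisits K (p ++ q))%N.
Proof.
apply/fsubset_leq_card/fsubsetP => z; rewrite !inE/= count_cat mem_cat.
by move=> /andP[-> /=] h; rewrite (leq_trans h)// leq_addr.
Qed.

Lemma nvisits_cat_r K p q : (nvisits K q <= nvisits K (p ++ q))%N.
Proof.
apply/fsubset_leq_card/fsubsetP => z; rewrite !inE/= count_cat mem_cat.
by move=> /andP[-> /=] h; rewrite orbT (leq_trans h)// leq_addl.
Qed.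

Lemma nvisits_le1 K p : (0 < K)%N -> (nvisits K p <= nvisits 1 p)%N.
Proof.
move=> K0; apply/fsubset_leq_card/fsubsetP => z.
by rewrite in_visits1 !inE/= => /andP[].
Qed.

Lemma nvisits1_size p : nvisits 1 p = size (undup p).
Proof.
rewrite /nvisits; have -> : visits 1 p = seq_fset tt p.
  by apply/fsetP => z; rewrite in_visits1 seq_fsetE.
by rewrite size_seq_fset.
Qed.

Lemma nvisits_size K p : (0 < K)%N -> (nvisits K p <= size p)%N.
Proof.
move=> K0; apply: (leq_trans (nvisits_le1 p K0)).
by rewrite nvisits1_size size_undup.
Qed.

(** Inclusion-exclusion: a vertex counted in both parts is visited by both, so the loss at level K
    is at most the loss at level 1. *)
Lemma nvisits_cat_overlap K p q : (0 < K)%N ->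
  (nvisits K p + nvisits K q + nvisits 1 (p ++ q) <=
   nvisits K (p ++ q) + (nvisits 1 p + nvisits 1 q))%N.
Proof.
move=> K0; rewrite /nvisits.
have -> : visits 1 (p ++ q) = visits 1 p `|` visits 1 q.
  by apply/fsetP => z; rewrite inE !in_visits1 mem_cat.
have h1 : (#|` visits K p `|` visits K q| <= #|` visits K (p ++ q)|)%N.
  apply/fsubset_leq_card/fsubsetP => z; rewrite inE !in_visits// count_cat.
  by case/orP => h; rewrite (leq_trans h)// ?leq_addr ?leq_addl.
have h2 : (#|` visits K p `&` visits K q| <= #|` visits 1 p `&` visits 1 q|)%N.
  apply/fsubset_leq_card/fsubsetP => z; rewrite !in_fsetI.
  by rewrite !in_visits1 !inE/= => /andP[/andP[-> _] /andP[-> _]].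
have := cardfsUI (visits K p) (visits K q).
have := cardfsUI (visits 1 p) (visits 1 q).
lia.
Qed.

End Visits.

(** * Expected numbers of visited vertices *)

Section ExpectedVisits.
Context (R : realType) (G : sgraph) (Glf : locally_finite G).
Implicit Types (x y z : G) (p q : seq G) (n m k K j : nat).

Local Notation noret := (@noret R G).

Definition nreturns j n z y : R := walkE n z (fun p => (count_mem y p == j)%:R).

Lemma nreturns0 n y : nreturns 0 n y y = noret n y.
Proof.
by apply: (eq_walkE Glf) => p _ _; rewrite -has_pred1 has_count -eqn0Ngt.
Qed.

Lemma walkE_nvisitsS k m x :
  walkE m.+1 x (fun p => (nvisits k.+1 p)%:R : R) =
  (deg x)%:R^-1 * \sum_(y <- fset_set (neighbors x))
    (nreturns k m y y + walkE m y (fun p => (nvisits k.+1 p)%:R)).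
Proof.
congr (_ * _); apply: eq_bigr => y _; rewrite -walkED//.
by apply: (eq_walkE Glf) => p _ _; rewrite nvisits_cons natrD.
Qed.

(** The position reached when t steps remain is counted if it is never revisited, which has
    probability [noret t]. This is at most u for t >= k; the last k steps are bounded by 1 each. *)
Lemma walkE_nvisits_le k m x (u : R) : 0 <= u ->
  (forall y, noret k y <= u) ->
  walkE m x (fun p => (nvisits 1 p)%:R) <= k%:R + m%:R * u.
Proof.
move=> u0 hu.
suff : walkE m x (fun p => (nvisits 1 p)%:R) <= (minn m k)%:R + (m - k)%:R * u.
  move=> /le_trans; apply; rewrite lerD ?ler_nat ?geq_minr//.
  by rewrite ler_wpM2r// ler_nat leq_subr.
elim: m x => [|m IH] x; first by rewrite /= nvisits_nil min0n sub0n mul0r addr0.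
rewrite walkE_nvisitsS; apply: (nbr_avg_le Glf) => y _; rewrite nreturns0.
apply: le_trans (lerD (lexx _) (IH y)) _.
case: (boolP (m < k)%N) => [mk|]; last rewrite -leqNgt => mk.
  rewrite (minn_idPl (ltnW mk)) (minn_idPl mk).
  rewrite (eqP (ltnW mk : (m - k == 0)%N)) (eqP (mk : (m.+1 - k == 0)%N)) mul0r !addr0.
  by rewrite -natr1 addrC lerD2l noret_le1.
rewrite (minn_idPr mk) (minn_idPr (leqW mk)) subSn// -natr1.
have := le_trans (noret_noninc R Glf y mk) (hu y); rewrite mulrDl mul1r; lra.
Qed.

Definition overlap p q : R :=
  (nvisits 1 p)%:R + (nvisits 1 q)%:R - (nvisits 1 (p ++ q))%:R.

(** A common vertex is counted at its last visit in the first part. With t steps of that part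
    remaining, the probability of returning in the second part but not before is [noret t] -
    [noret (t + n)]; it is at most w for t >= k, and the last k steps are bounded by 1 each. *)
Lemma walkE_overlap_le k m n N x (w : R) : 0 <= w -> (m + n <= N)%N ->
  (forall y, noret k y - noret N y <= w) ->
  walkE m x (fun p => walkE n (last x p) (fun q => overlap p q)) <=
  k%:R + m%:R * w.
Proof.
move=> w0 mnN hw.
suff : forall t, (t <= m)%N ->
    walkE t x (fun p => walkE n (last x p) (fun q => overlap p q)) <=
    (minn t k)%:R + (t - k)%:R * w.
  move=> /(_ m (leqnn _))/le_trans; apply; rewrite lerD ?ler_nat ?geq_minr//.
  by rewrite ler_wpM2r// ler_nat leq_subr.
move=> t; elim: t x => [|t IH] x tm.
  rewrite min0n sub0n mul0r addr0/=.
  apply: (walkE_le Glf) => p _ _.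
  by rewrite /overlap nvisits_nil add0r subrr.
rewrite /=; apply: (nbr_avg_le Glf) => y _.
have -> : walkE t y (fun p => walkE n (last y p) (fun q => overlap (y :: p) q)) =
    noret t y - noret (t + n) y +
    walkE t y (fun p => walkE n (last y p) (fun q => overlap p q)).
  rewrite /noret walkE_cat -walkEB// -walkED//.
  apply: (eq_walkE Glf) => p _ _.
  rewrite -[X in X - _](walkE_cst Glf n (last y p)) -walkEB// -walkED//.
  apply: (eq_walkE Glf) => q _ _; rewrite /overlap/= !nvisits_cons !natrD.
  rewrite !eqn0Ngt -!has_count !has_pred1.
  by rewrite mem_cat; lra.
apply: le_trans (lerD (lexx _) (IH y (ltnW tm))) _.
case: (boolP (t < k)%N) => [tk|]; last rewrite -leqNgt => tk.
  rewrite (minn_idPl (ltnW tk)) (minn_idPl tk).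
  rewrite (eqP (ltnW tk : (t - k == 0)%N)) (eqP (tk : (t.+1 - k == 0)%N)) mul0r !addr0.
  rewrite -natr1 addrC lerD2l.
  by have := noret_le1 R Glf t y; have := noret_ge0 R Glf (t + n) y; lra.
rewrite (minn_idPr tk) (minn_idPr (leqW tk)) subSn// -natr1.
have h1 : noret t y <= noret k y by apply: noret_noninc.
have h2 : noret N y <= noret (t + n) y.
  by apply: noret_noninc => //; rewrite (leq_trans _ mnN)// leq_add2r ltnW.
by have := hw y; rewrite mulrDl mul1r; lra.
Qed.

(* Stop at the first visit to y among the first k steps. *)
Lemma nreturnsS_ge j k m z y (b : R) : (k <= m)%N -> 0 <= b ->
  (forall m', (m - k <= m' <= m)%N -> b <= nreturns j m' y y) ->
  b * (1 - walkE k z (fun p => (y \notin p)%:R)) <= nreturns j.+1 m z y.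
Proof.
elim: k m z => [|k IH] [|m] z //=; rewrite ?in_nil ?subrr ?mulr0.
- by move=> _ b0 _; rewrite ler0n.
- by move=> _ b0 _; apply: (walkE_ge0 Glf) => p; rewrite ler0n.
rewrite ltnS => km b0 h.
rewrite -[X in X - _](nbr_avg_const Glf z) -mulrBr -sumrB mulrCA mulr_sumr.
apply: (ler_nbr_avg Glf) => y' _.
have [->|yy'] := eqVneq y' y.
  rewrite [leRHS](_ : _ = nreturns j m y y); last first.
    by apply: (eq_walkE Glf) => p _ _; rewrite /= eqxx add1n eqSS.
  apply: le_trans (h m _); last by rewrite leqnSn andbT; lia.
  rewrite ler_piMr// lerBlDr lerDl.
  by apply: (walkE_ge0 Glf) => p; rewrite ler0n.
rewrite [leRHS](_ : _ = nreturns j.+1 m y' y); last first.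
  by apply: (eq_walkE Glf) => p _ _; rewrite /= (negPf yy') add0n.
rewrite (_ : walkE k y' _ = walkE k y' (fun p => (y \notin p)%:R)); last first.
  by apply: (eq_walkE Glf) => p _ _; rewrite inE eq_sym (negPf yy').
by apply: IH => // m' /andP[h1 h2]; apply: h; lia.
Qed.

(** Ask for j successive returns within k steps each, every one succeeding with probability at least
    1 - u, and then for no further return. The condition on j k leaves time for all of them. *)
Lemma nreturns_ge j k m m' y (u v : R) : 0 <= u <= 1 -> 0 <= v ->
  noret k y <= u -> v <= noret m y -> (j * k <= m' <= m)%N ->
  (1 - u) ^+ j * v <= nreturns j m' y y.
Proof.
move=> /andP[u0 u1] v0 hu hv; elim: j m' => [|j IH] m' /andP[h1 h2].
  by rewrite expr0 mul1r nreturns0 (le_trans hv)// noret_noninc.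
have km' : (k <= m')%N by rewrite (leq_trans _ h1)// mulSn leq_addr.
have b0 : 0 <= (1 - u) ^+ j * v by rewrite mulr_ge0// exprn_ge0// subr_ge0.
apply: le_trans (nreturnsS_ge y km' b0 _).
  by rewrite exprS -mulrA mulrC ler_wpM2l// lerB.
by move=> m'' /andP[h3 h4]; apply: IH; rewrite mulSn in h1; lia.
Qed.

(** Every step after which at least K k steps remain contributes the bound of [nreturns_ge]; the
    last K k steps are given up. *)
Lemma walkE_nvisits_ge K k m x (u v : R) : 0 <= u <= 1 -> 0 <= v ->
  (forall y, noret k y <= u) -> (forall y, v <= noret m y) ->
  (m - K * k)%:R * ((1 - u) ^+ K * v) <= walkE m x (fun p => (nvisits K.+1 p)%:R).
Proof.
move=> u01 v0 hu hv.
suff : forall t, (t <= m)%N ->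
  (t - K * k)%:R * ((1 - u) ^+ K * v) <= walkE t x (fun p => (nvisits K.+1 p)%:R).
  exact.
have b0 : 0 <= (1 - u) ^+ K * v.
  by rewrite mulr_ge0// exprn_ge0// subr_ge0; case/andP: u01.
move=> t; elim: t x => [|t IH] x tm; first by rewrite sub0n mul0r/= ler0n.
rewrite walkE_nvisitsS; apply: (nbr_avg_ge Glf) => y _.
have {}IH := IH y (ltnW tm).
case: (leqP (K * k) t) => h.
  rewrite subSn// -natr1 mulrDl mul1r addrC lerD//.
  by apply: nreturns_ge (hu y) (hv y) _ => //; rewrite h ltnW.
rewrite (eqP (h : (t.+1 - K * k == 0)%N)) mul0r addr_ge0//.
  by apply: (walkE_ge0 Glf) => p; rewrite ler0n.
by apply: (walkE_ge0 Glf) => p; rewrite ler0n.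
Qed.

End ExpectedVisits.

(** * Exponential moments and concentration over blocks *)

Lemma expR_chord (R : realType) (s b : R) : 0 <= b <= 1 ->
  expR (s * b) <= 1 + (expR s - 1) * b.
Proof.
move=> /andP[b0 b1].
have h1 : expR (s * b) * (1 + (s - s * b)) <= expR s.
  apply: (@le_trans _ _ (expR (s * b) * expR (s - s * b))).
    by rewrite ler_wpM2l ?expR_ge0// expR_ge1Dx.
  by rewrite -expRD addrC subrK.
have h2 : expR (s * b) * (1 + (- (s * b))) <= 1.
  apply: (@le_trans _ _ (expR (s * b) * expR (- (s * b)))).
    by rewrite ler_wpM2l ?expR_ge0// expR_ge1Dx.
  by rewrite -expRD subrr expR0.
move: h1 h2; move: (expR (s * b)) (expR s) => u v h1 h2.
(* Convexity: [h1] and [h2] are the tangent inequality at s b, evaluated at s and at 0; they are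
   combined with weights b and 1 - b. *)
have := ler_wpM2l b0 h1.
have := @ler_wpM2l _ (1 - b) _ _ _ h2; rewrite subr_ge0 => /(_ b1).
nra.
Qed.

Lemma expR_le_quad (R : realType) (s : R) : s <= 1 / 2 ->
  expR s <= 1 + s + 2 * s ^+ 2.
Proof.
move=> s1; have h : 0 < 1 - s by lra.
have h2 : (1 - s) * expR s <= 1.
  apply: (@le_trans _ _ (expR (- s) * expR s)).
    by rewrite ler_wpM2r ?expR_ge0// expR_ge1Dx.
  by rewrite -expRD addNr expR0.
rewrite -(ler_pM2l h) (le_trans h2)// expr2; nra.
Qed.

Section Blocks.
Context (R : realType) (G : sgraph) (Glf : locally_finite G).
Implicit Types (x y z : G) (p q : seq G) (n m k K l : nat) (B : seq G -> R).

Fixpoint blocks m l B p : R :=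
  if l is l'.+1 then B (take m p) + blocks m l' B (drop m p) else 0.

Lemma walkE_blocks m l x (F : seq G -> seq G -> R) :
  walkE (l.+1 * m) x (fun p => F (take m p) (drop m p)) =
  walkE m x (fun p => walkE (l * m) (last x p) (fun q => F p q)).
Proof.
rewrite mulSn walkE_cat; apply: (eq_walkE Glf) => p _ sp.
apply: (eq_walkE Glf) => q _ _.
by rewrite take_size_cat// drop_size_cat.
Qed.

(** The hypothesis on the means carries the factor [expR s - 1], so that it is an upper bound for s
    > 0 and a lower bound for s < 0; both tails follow from this lemma. *)
Lemma walkE_mgf_blocks m l x B (s mu : R) :
  (forall p, size p = m -> 0 <= B p <= 1) ->
  (forall y, (expR s - 1) * walkE m y B <= (expR s - 1) * mu) ->
  walkE (l * m) x (fun p => expR (s * blocks m l B p)) <=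
  expR (l%:R * ((expR s - 1) * mu)).
Proof.
move=> B01 hmu; elim: l x => [|l IH] x; first by rewrite mul0n/= mulr0 mul0r.
rewrite [leLHS](_ : _ = walkE (l.+1 * m) x (fun p => expR (s * B (take m p)) *
    expR (s * blocks m l B (drop m p)))); last first.
  by apply: (eq_walkE Glf) => p _ _; rewrite -expRD -mulrDr.
rewrite (walkE_blocks m l x (fun p q => expR (s * B p) * expR (s * blocks m l B q))).
rewrite -natr1 mulrDl mul1r expRD.
apply: (@le_trans _ _ (walkE m x (fun p =>
    expR (l%:R * ((expR s - 1) * mu)) * expR (s * B p)))).
  apply: (ler_walkE Glf) => p _ _.
  by rewrite walkEZ// mulrC ler_wpM2r ?expR_ge0.
rewrite walkEZ// ler_wpM2l ?expR_ge0//.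
apply: le_trans _ (expR_ge1Dx _).
apply: le_trans _ (lerD (lexx _) (hmu x)).
rewrite -walkEZ// -[X in X + _](walkE_cst Glf m x) -walkED//.
apply: (ler_walkE Glf) => p _ sp.
by rewrite expR_chord// B01.
Qed.

(** Chernoff bound with t = e / 4: since [expR t - 1] is at most t + 2 t^2, the exponent is at most
    (2 t^2 - t e) l mu = - e^2 l mu / 8. The lower tail uses - t in the same way. *)
Lemma blocks_upper_tail m l x B (e mu : R) : 0 < e <= 1 -> 0 <= mu ->
  (forall p, size p = m -> 0 <= B p <= 1) ->
  (forall y, walkE m y B <= mu) ->
  walkE (l * m) x (fun p => ((1 + e) * l%:R * mu <= blocks m l B p)%R%:R) <=
  expR (- (e ^+ 2 / 8 * l%:R * mu)).
Proof.
move=> /andP[e0 e1] mu0 B01 hmu; pose t := e / 4.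
apply: (@le_trans _ _ (walkE (l * m) x (fun p =>
    expR (- (t * ((1 + e) * l%:R * mu))) * expR (t * blocks m l B p)))).
  apply: (ler_walkE Glf) => p _ _; rewrite -expRD.
  case: (boolP (_ <= blocks _ _ _ _)) => h; last by rewrite expR_ge0.
  apply: (@le_trans _ _ (expR 0)); first by rewrite expR0.
  by rewrite ler_expR addrC subr_ge0 ler_pM2l// /t; lra.
have hs y : (expR t - 1) * walkE m y B <= (expR t - 1) * mu.
  by rewrite ler_wpM2l// subr_ge0 -[leLHS]expR0 ler_expR /t; lra.
rewrite walkEZ//.
apply: le_trans (ler_wpM2l (expR_ge0 _) (walkE_mgf_blocks l x B01 hs)) _.
rewrite -expRD ler_expR.
have h := @expR_le_quad R t.
have {}h : expR t - 1 <= t + 2 * t ^+ 2 by rewrite /t in h *; lra.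
have lm : 0 <= l%:R * mu by rewrite mulr_ge0.
have := ler_wpM2l lm h; rewrite /t expr2; nra.
Qed.

Lemma blocks_lower_tail m l x B (e mu : R) : 0 < e <= 1 -> 0 <= mu ->
  (forall p, size p = m -> 0 <= B p <= 1) ->
  (forall y, mu <= walkE m y B) ->
  walkE (l * m) x (fun p => (blocks m l B p <= (1 - e) * l%:R * mu)%R%:R) <=
  expR (- (e ^+ 2 / 8 * l%:R * mu)).
Proof.
move=> /andP[e0 e1] mu0 B01 hmu; pose t := e / 4.
apply: (@le_trans _ _ (walkE (l * m) x (fun p =>
    expR (t * ((1 - e) * l%:R * mu)) * expR (- t * blocks m l B p)))).
  apply: (ler_walkE Glf) => p _ _; rewrite -expRD.
  case: (boolP (blocks _ _ _ _ <= _)) => h; last by rewrite expR_ge0.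
  apply: (@le_trans _ _ (expR 0)); first by rewrite expR0.
  by rewrite ler_expR mulNr subr_ge0 ler_pM2l// /t; lra.
have hs y : (expR (- t) - 1) * walkE m y B <= (expR (- t) - 1) * mu.
  by apply: ler_wnM2l (hmu y); rewrite subr_le0 expR_le1 /t; lra.
rewrite walkEZ//.
apply: le_trans (ler_wpM2l (expR_ge0 _) (walkE_mgf_blocks l x B01 hs)) _.
rewrite -expRD ler_expR.
have h := @expR_le_quad R (- t).
have {}h : expR (- t) - 1 <= - t + 2 * t ^+ 2.
  by rewrite sqrrN in h; rewrite /t in h *; lra.
have lm : 0 <= l%:R * mu by rewrite mulr_ge0.
have := ler_wpM2l lm h; rewrite /t expr2; nra.
Qed.

(* The number of visited vertices is subadditive under concatenation; [excess]
   is its defect over a decomposition into l blocks of length m. *)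
Definition excess m l p : R :=
  blocks m l (fun q => (nvisits 1 q)%:R) p - (nvisits 1 p)%:R.

Lemma blocks_nvisits_excess K m l p : (0 < K)%N -> size p = (l * m)%N ->
  blocks m l (fun q => (nvisits K q)%:R) p <= (nvisits K p)%:R + excess m l p.
Proof.
move=> K0; rewrite /excess; elim: l p => [|l IH] p sp.
  by move/size0nil: sp => ->/=; rewrite !nvisits_nil subrr addr0.
have {}IH : _ <= _ := IH (drop m p) _.
have := nvisits_cat_overlap (take m p) (drop m p) K0.
rewrite cat_take_drop -(ler_nat R) !natrD => h.
have := IH; rewrite size_drop sp mulSn addKn => /(_ erefl) /=; lra.
Qed.

Lemma overlap_ge0 p q : 0 <= overlap R p q.
Proof.
rewrite /overlap subr_ge0 -natrD ler_nat /nvisits.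
have -> : visits 1 (p ++ q) = (visits 1 p `|` visits 1 q)%fset.
  by apply/fsetP => z; rewrite inE !in_visits1 mem_cat.
by rewrite -cardfsUI leq_addr.
Qed.

Lemma excessS m l p :
  excess m l.+1 p = overlap R (take m p) (drop m p) + excess m l (drop m p).
Proof. by rewrite /excess /overlap cat_take_drop /=; lra. Qed.

Lemma excess_ge0 m l p : size p = (l * m)%N -> 0 <= excess m l p.
Proof.
elim: l p => [|l IH] p sp.
  by move/size0nil: sp => ->; rewrite /excess/= nvisits_nil subrr.
rewrite excessS addr_ge0 ?overlap_ge0// IH//.
by rewrite size_drop sp mulSn addKn.
Qed.

(** Blocks are peeled off from the front; each one overlaps with the whole remaining walk by at most
    k + m w on average. *)
Lemma walkE_excess_le k m l L x (w : R) : 0 <= w -> (l <= L)%N ->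
  (forall y, noret R k y - noret R (L * m) y <= w) ->
  walkE (l * m) x (excess m l) <= l%:R * (k%:R + m%:R * w).
Proof.
move=> w0 lL hw; elim: l lL x => [|l IH] lL x.
  by rewrite mul0n/= mul0r /excess/= nvisits_nil subrr.
rewrite [leLHS](_ : _ = walkE (l.+1 * m) x (fun p =>
    overlap R (take m p) (drop m p) + excess m l (drop m p))); last first.
  by apply: (eq_walkE Glf) => p _ _; rewrite excessS.
rewrite (walkE_blocks m l x (fun p q => overlap R p q + excess m l q)).
rewrite -natr1 mulrDl mul1r.
apply: (@le_trans _ _ (walkE m x (fun p =>
   l%:R * (k%:R + m%:R * w) + walkE (l * m) (last x p) (fun q => overlap R p q)))).
  apply: (ler_walkE Glf) => p _ _.
  by rewrite walkED// addrC lerD2r IH// ltnW.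
rewrite walkED// walkE_cst// lerD2l.
apply: (walkE_overlap_le Glf) hw => //.
by rewrite -mulSn leq_mul2r lL orbT.
Qed.

(** If the count is at most b, then either the block counts have a small sum, which the Chernoff
    bound controls, or the excess is at least be, which Markov's inequality controls. *)
Lemma nvisits_half_tail K k m l x (e mu w be b : R) : (0 < m)%N ->
  0 < e <= 1 -> 0 <= mu -> 0 <= w -> 0 < be ->
  (forall y, mu * m%:R <= walkE m y (fun p => (nvisits K.+1 p)%:R)) ->
  (forall y, noret R k y - noret R (l * m) y <= w) ->
  b + be <= (1 - e) * l%:R * mu * m%:R ->
  walkE (l * m) x (fun p => ((nvisits K.+1 p)%:R <= b)%R%:R) <=
  expR (- (e ^+ 2 / 8 * l%:R * mu)) + be^-1 * (l%:R * (k%:R + m%:R * w)).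
Proof.
move=> m0 e01 mu0 w0 be0 hmu hw hb.
have m0R : 0 < m%:R :> R by rewrite ltr0n.
pose B p : R := m%:R^-1 * (nvisits K.+1 p)%:R.
have B01 p : size p = m -> 0 <= B p <= 1.
  move=> sp; rewrite /B mulr_ge0//= ler_pdivrMl// mulr1 ler_nat -sp.
  exact: nvisits_size.
have hB y : mu <= walkE m y B.
  by rewrite walkEZ// ler_pdivlMl// mulrC.
have blocksB p : blocks m l B p = m%:R^-1 * blocks m l (fun q => (nvisits K.+1 q)%:R) p.
  elim: (l) p => [|l' IH] p /=; first by rewrite mulr0.
  by rewrite IH -mulrDr.
apply: (@le_trans _ _ (walkE (l * m) x (fun p =>
    (blocks m l B p <= (1 - e) * l%:R * mu)%R%:R + (be <= excess m l p)%R%:R))).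
  apply: (ler_walkE Glf) => p _ sp.
  case: (boolP (_ <= b)) => hp; last by rewrite addr_ge0.
  case: (leP be (excess m l p)) => h; first by rewrite lerDr.
  suff -> : blocks m l B p <= (1 - e) * l%:R * mu by rewrite addr0.
  rewrite blocksB ler_pdivrMl// [leRHS]mulrC (le_trans _ hb)//.
  by have := blocks_nvisits_excess (ltn0Sn K) sp; lra.
rewrite walkED// lerD//; first exact: blocks_lower_tail.
apply: (le_trans (walkE_markov (f := excess m l) Glf x be0 _ _)).
- by move=> p; exact: excess_ge0.
- by [].
- by rewrite ler_pM2l ?invr_gt0//; apply: (walkE_excess_le x w0 _ hw).
Qed.

(* Both halves of the walk have to fail, hence the square; the level b is that
   of one half. *)
Lemma nvisits_double_tail K H x (b rho : R) :
  (forall y, walkE H y (fun p => ((nvisits K p)%:R <= b)%R%:R) <= rho) ->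
  walkE (H + H) x (fun p => ((nvisits K p)%:R <= b)%R%:R) <= rho ^+ 2.
Proof.
move=> h.
have rho0 : 0 <= rho.
  by apply: le_trans (h x); apply: (walkE_ge0 Glf) => p; rewrite ler0n.
rewrite walkE_cat.
apply: (@le_trans _ _ (walkE H x (fun p =>
    rho * ((nvisits K p)%:R <= b)%R%:R))); last first.
  by rewrite walkEZ// expr2 ler_wpM2l.
apply: (ler_walkE Glf) => p _ _.
apply: (@le_trans _ _ (walkE H (last x p) (fun q =>
   ((nvisits K p)%:R <= b)%R%:R * ((nvisits K q)%:R <= b)%R%:R))).
  apply: (ler_walkE Glf) => q _ _.
  case: (boolP (_%:R <= b)) => pqb; last by rewrite mulr_ge0.
  have -> : (nvisits K p)%:R <= b by rewrite (le_trans _ pqb)// ler_nat nvisits_cat_l.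
  have -> : (nvisits K q)%:R <= b by rewrite (le_trans _ pqb)// ler_nat nvisits_cat_r.
  by rewrite mulr1.
by rewrite walkEZ// mulrC ler_wpM2r.
Qed.

End Blocks.

(** * The walk on the lamplighter graph *)

Notation config G := {fsfun vertex G -> bool with false}.

Section Lamps.
Context (G : sgraph).
Implicit Types (x y z : G) (eta xi : config G).

Definition toggle x eta : config G := [fsfun eta with x |-> ~~ eta x].

Lemma toggleE x eta z : toggle x eta z = if z == x then ~~ eta x else eta z.
Proof. by rewrite fsfun_withE. Qed.

Lemma toggleK x : involutive (toggle x).
Proof.
move=> eta; apply/fsfunP => z; rewrite !toggleE eqxx.
by case: eqP => [->|//]; rewrite negbK.
Qed.

Definition lamp_diff eta xi : {fset G} :=
  [fset z in (finsupp eta `|` finsupp xi)%fset | eta z != xi z]%fset.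

Lemma in_lamp_diff eta xi z : (z \in lamp_diff eta xi) = (eta z != xi z).
Proof.
rewrite !inE/= !mem_finsupp/=.
by case: (eta z); case: (xi z).
Qed.

Lemma lamp_diff_toggle x eta xi :
  (#|` lamp_diff eta xi| <= #|` lamp_diff eta (toggle x xi)|.+1)%N.
Proof.
apply: (@leq_trans #|` x |` lamp_diff eta (toggle x xi)|%fset).
  apply/fsubset_leq_card/fsubsetP => z.
  by rewrite in_fset1U !in_lamp_diff toggleE; case: (z == x).
by rewrite cardfsU1 -add1n leq_add2r leq_b1.
Qed.

Lemma adj_lamp (eta : config G) x (v : lamplighter G) :
  adj ((eta, x) : lamplighter G) v =
  ((v.1 == eta) && adj x v.2) || (v == (toggle x eta, x)).
Proof.
rewrite -[LHS]/(lamp_adj (eta, x) v) /lamp_adj/= eq_sym; congr (_ || _).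
apply/idP/idP => [/andP[/eqP xv /asboolP h]|/eqP ->].
  case: v xv h => xi y /= <- h; rewrite xpair_eqE eqxx andbT.
  apply/eqP/fsfunP => z; rewrite toggleE; have := h z.
  by case: (eqVneq z x) => [->|_]; case: (eta _); case: (xi _).
rewrite eqxx/=; apply/asboolP => z; rewrite toggleE.
by case: (eqVneq z x) => [->|_]; rewrite ?eqxx//; case: (eta _).
Qed.

Definition lamp_nbrs (eta : config G) x : {fset lamplighter G} :=
  ((toggle x eta, x) |` [fset ((eta, y) : lamplighter G) | y in fset_set (neighbors x)])%fset.

Hypothesis Glf : locally_finite G.

Lemma neighbors_lamp (eta : config G) x :
  neighbors ((eta, x) : lamplighter G) = [set` lamp_nbrs eta x].
Proof.
rewrite predeqE => v.
rewrite -[neighbors _ _]/(is_true (adj ((eta, x) : lamplighter G) v)) adj_lamp.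
rewrite -[[set` _] _]/(is_true (v \in lamp_nbrs eta x)) in_fset1U orbC.
case: (boolP (v == _)) => //= _; split.
  case: v => xi y /= /andP[/eqP -> xy].
  by apply/imfsetP; exists y => //=; rewrite mem_nbr.
by move=> /imfsetP[y /=]; rewrite mem_nbr// => xy -> /=; rewrite eqxx.
Qed.

Lemma fset_neighbors_lamp (eta : config G) x :
  fset_set (neighbors ((eta, x) : lamplighter G)) = lamp_nbrs eta x.
Proof. by rewrite neighbors_lamp set_fsetK. Qed.

Lemma toggle_notin_nbrs (eta : config G) x :
  ((toggle x eta, x) : lamplighter G) \notin
  [fset ((eta, y) : lamplighter G) | y in fset_set (neighbors x)]%fset.
Proof.
apply/imfsetP => -[y /=]; rewrite mem_nbr// => xy [_ yx].
by move: xy; rewrite yx adj_irrefl.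
Qed.

Lemma deg_lamp (eta : config G) x : deg ((eta, x) : lamplighter G) = (deg x).+1.
Proof.
rewrite /deg fset_neighbors_lamp cardfsU1 toggle_notin_nbrs add1n; congr _.+1.
by rewrite card_imfset//= => y y' [].
Qed.

Lemma lamplighter_lf : locally_finite (lamplighter G).
Proof.
move=> [eta x]; split; last by rewrite deg_lamp.
by rewrite neighbors_lamp; exact: finite_fset.
Qed.

Lemma walkE_lampS (R : realType) n (eta : config G) x (f : seq (lamplighter G) -> R) :
  walkE n.+1 ((eta, x) : lamplighter G) f =
  (deg x).+1%:R^-1 *
  (walkE n ((toggle x eta, x) : lamplighter G)
     (fun q => f (((toggle x eta, x) : lamplighter G) :: q)) +
   \sum_(y <- fset_set (neighbors x))
     walkE n ((eta, y) : lamplighter G)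
     (fun q => f (((eta, y) : lamplighter G) :: q))).
Proof.
rewrite [LHS]/= deg_lamp fset_neighbors_lamp; congr (_ * _).
rewrite big_fsetU1 ?toggle_notin_nbrs//=; congr (_ + _).
by rewrite big_imfset//= => y y' _ _ [].
Qed.

(** A step that keeps the position is a lamp switch, as G has no loops. Removing these steps leaves
    the base walk without its pauses. *)
Fixpoint jumps x (q : seq (lamplighter G)) : seq G :=
  if q is v :: q' then
    if v.2 == x then jumps x q' else v.2 :: jumps v.2 q'
  else [::].

Lemma jumps_cat (u : lamplighter G) q1 q2 :
  jumps u.2 (q1 ++ q2) = jumps u.2 q1 ++ jumps (last u q1).2 q2.
Proof.
elim: q1 u => [//|v q1 IH] u /=.
by case: eqP => [<-|_]; rewrite IH.
Qed.

Lemma size_jumps x q : (size (jumps x q) <= size q)%N.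
Proof.
elim: q x => [//|v q IH] x /=; case: eqP => _ /=; last by rewrite ltnS IH.
by rewrite (leq_trans (IH x))// leqnSn.
Qed.

Lemma last_jumps (u : lamplighter G) q : last u.2 (jumps u.2 q) = (last u q).2.
Proof.
elim: q u => [//|v q IH] u /=.
by case: eqP => [<-|_] /=; rewrite IH.
Qed.

End Lamps.

(** * Comparison with the walk on G and with independent lamp flips *)

Section Comparison.
Context (R : realType) (G : sgraph) (Glf : locally_finite G).
Implicit Types (x y z : G) (eta xi : config G) (p : seq G).
Implicit Types (q : seq (lamplighter G)) (n N : nat).
Local Notation lv eta x := ((eta, x) : lamplighter G).
Let Hlf : locally_finite (lamplighter G) := lamplighter_lf Glf.

Lemma deg1R_gt0 x : 0 < (deg x).+1%:R :> R. Proof. by rewrite ltr0n. Qed.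

Lemma nbr_sumE x (F : G -> R) :
  \sum_(y <- fset_set (neighbors x)) F y =
  (deg x)%:R * ((deg x)%:R^-1 * \sum_(y <- fset_set (neighbors x)) F y).
Proof. by rewrite mulrA divff ?mul1r// gt_eqF// degR_gt0. Qed.

(** One lazy step: the switch has weight 1 / (deg x + 1), and the remaining weight is spread evenly
    over the neighbours. A bound for both parts bounds the mixture. *)
Lemma lamp_step_le x (A W : R) (F F' : G -> R) :
  A <= W -> (forall y, adj x y -> F y <= F' y) ->
  (deg x)%:R^-1 * \sum_(y <- fset_set (neighbors x)) F' y <= W ->
  (deg x).+1%:R^-1 * (A + \sum_(y <- fset_set (neighbors x)) F y) <= W.
Proof.
move=> AW FF' F'W; rewrite ler_pdivrMl ?deg1R_gt0// -natr1 mulrDl mul1r addrC.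
rewrite lerD// nbr_sumE ler_pM2l ?degR_gt0// (le_trans _ F'W)//.
exact: (ler_nbr_avg Glf).
Qed.

Lemma walkE_mono m n x (f : seq G -> R) : (m <= n)%N ->
  (forall p p', f p <= f (p ++ p')) -> walkE m x f <= walkE n x f.
Proof.
move=> mn hf; rewrite -(walkE_prefix Glf m (n - m)) subnKC//.
by apply: (ler_walkE Glf) => p _ _; rewrite -{2}(cat_take_drop m p).
Qed.

Lemma walkE_jumpsS n eta x (h : config G -> seq G -> R) :
  walkE n.+1 (lv eta x) (fun q => h (last (lv eta x) q).1 (jumps x q)) =
  (deg x).+1%:R^-1 *
  (walkE n (lv (toggle x eta) x)
     (fun q => h (last (lv (toggle x eta) x) q).1 (jumps x q)) +
   \sum_(y <- fset_set (neighbors x))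
     walkE n (lv eta y) (fun q => h (last (lv eta y) q).1 (y :: jumps y q))).
Proof.
rewrite walkE_lampS//; congr (_ * (_ + _)).
  by apply: (eq_walkE Hlf) => q _ _; rewrite /= eqxx.
rewrite !big_seq; apply: eq_bigr => y; rewrite mem_nbr// => xy.
apply: (eq_walkE Hlf) => q _ _ /=; case: (eqVneq y x) => // yx.
by move: xy; rewrite yx adj_irrefl.
Qed.

(** Pauses only shorten the path on G, which lowers a function that grows along extensions. *)
Lemma walkE_jumps_le n eta x (f : seq G -> R) :
  (forall p p', f p <= f (p ++ p')) ->
  walkE n (lv eta x) (fun q => f (jumps x q)) <= walkE n x f.
Proof.
elim: n eta x f => [//|n IH] eta x f hf.
rewrite (walkE_jumpsS n eta x (fun _ => f)).
apply: (@lamp_step_le x _ _ _ (fun y => walkE n y (fun p => f (y :: p)))).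
- apply: (le_trans (IH (toggle x eta) x f hf)).
  exact: (walkE_mono x (leqnSn n) hf).
- move=> y xy; apply: (IH eta y (fun p => f (y :: p))).
  by move=> p p'; rewrite -cat_cons.
- exact: lexx.
Qed.

(** For a function that decreases along extensions, the first N jumps already give an upper
    bound. *)
Lemma walkE_jumps_ge n N eta x (f : seq G -> R) : (forall p, 0 <= f p) ->
  (forall p p', f (p ++ p') <= f p) ->
  walkE n (lv eta x) (fun q => (N <= size (jumps x q))%:R * f (jumps x q)) <=
  walkE N x f.
Proof.
elim: n N eta x f => [|n IH] [|N] eta x f f0 hf.
- by rewrite /= mul1r.
- by rewrite [leLHS]/= mul0r; apply: (walkE_ge0 Glf).
- apply: (walkE_le Hlf) => q _ _; rewrite mul1r.
  by rewrite -[jumps x q]cat0s hf.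
rewrite (walkE_jumpsS n eta x (fun _ p => (N < size p)%:R * f p)).
apply: (@lamp_step_le x _ _ _ (fun y => walkE N y (fun p => f (y :: p)))).
- exact: (IH N.+1 (toggle x eta) x f f0 hf).
- move=> y xy; apply: (IH N eta y (fun p => f (y :: p))) => //.
  by move=> p p'; rewrite -cat_cons.
- exact: lexx.
Qed.

(* During a sojourn at x the lamp is switched a geometric number of times, which
   is odd with probability [flip_prob x]. *)
Definition flip_prob x : R := (deg x).+2%:R^-1.

(** Expectation over the final lamps when every entry of [p] is a completed sojourn, with
    independent parities. *)
Fixpoint lampE p eta (f : config G -> R) : R :=
  if p is x :: p' then
    (1 - flip_prob x) * lampE p' eta f + flip_prob x * lampE p' (toggle x eta) f
  else f eta.

Lemma flip_prob_bounds x : 0 <= flip_prob x <= 1 / 2.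
Proof.
rewrite /flip_prob invr_ge0 ler0n/= div1r lef_pV2 ?posrE ?ltr0n//.
by rewrite ler_nat.
Qed.

Lemma ler_lampE p eta (f g : config G -> R) : (forall xi, f xi <= g xi) ->
  lampE p eta f <= lampE p eta g.
Proof.
move=> fg; elim: p eta => [|x p IH] eta; first exact: fg.
have /andP[h1 h2] := flip_prob_bounds x.
by rewrite /= lerD// ler_wpM2l// subr_ge0; lra.
Qed.

Lemma lampEZ p eta (c : R) (f : config G -> R) :
  lampE p eta (fun xi => c * f xi) = c * lampE p eta f.
Proof. by elim: p eta => [//|x p IH] eta /=; rewrite !IH; ring. Qed.

Lemma lampE_ge0 p eta (f : config G -> R) : (forall xi, 0 <= f xi) ->
  0 <= lampE p eta f.
Proof.
move=> f0; elim: p eta => [|x p IH] eta; first exact: f0.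
have /andP[h1 h2] := flip_prob_bounds x.
by rewrite /= addr_ge0// mulr_ge0// subr_ge0; lra.
Qed.

(* The lamp at the current position belongs to an unfinished sojourn, so that
   its law is not controlled: [g] must not depend on it. *)
Lemma walkE_jumps_lamps n N eta x (f g : config G -> seq G -> R) :
  (forall xi p, 0 <= g xi p) -> (forall xi p, f xi p <= g xi p) ->
  (forall xi p, g (toggle (last x p) xi) p = g xi p) ->
  walkE n (lv eta x) (fun q => (size (jumps x q) == N)%:R *
    f (last (lv eta x) q).1 (jumps x q)) <=
  walkE N x (fun p => lampE (belast x p) eta (g^~ p)).
Proof.
elim: n N eta x f g => [|n IH] [|N] eta x f g g0 fg gt.
- by rewrite /= mul1r.
- rewrite [leLHS]/= mul0r; apply: (walkE_ge0 Glf) => p.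
  exact: lampE_ge0.
- rewrite (walkE_jumpsS n eta x (fun xi p => (size p == 0)%N%:R * f xi p)).
  apply: (@lamp_step_le x _ _ _ (fun y => 0)).
  + apply: le_trans (IH 0%N (toggle x eta) x f g g0 fg gt) _.
    by rewrite /= -[X in toggle X]/(last x [::]) gt.
  + move=> y xy; apply: (walkE_le Hlf) => q _ _.
    by rewrite /= mul0r lexx.
  + by rewrite big1// mulr0; exact: lampE_ge0.
(* [a xi] is the bound that applies once the sojourn at x has ended with the lamps xi. *)
pose a (xi : config G) : R := (deg x)%:R^-1 * \sum_(y <- fset_set (neighbors x))
  walkE N y (fun p => lampE (belast y p) xi (g^~ (y :: p))).
have hE xi : walkE N.+1 x (fun p => lampE (belast x p) xi (g^~ p)) =
    (1 - flip_prob x) * a xi + flip_prob x * a (toggle x xi).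
  pose W xi' y := walkE N y (fun p => lampE (belast y p) xi' (g^~ (y :: p))).
  transitivity ((deg x)%:R^-1 * \sum_(y <- fset_set (neighbors x))
      ((1 - flip_prob x) * W xi y + flip_prob x * W (toggle x xi) y)).
    congr (_ * _); apply: eq_bigr => y _; rewrite /W.
    have E1 := walkEZ N y (1 - flip_prob x)
      (fun p => lampE (belast y p) xi (g^~ (y :: p))).
    have E2 := walkEZ N y (flip_prob x)
      (fun p => lampE (belast y p) (toggle x xi) (g^~ (y :: p))).
    by rewrite -E1 -E2 -walkED.
  rewrite big_split/= -!mulr_sumr /a -/W; ring.
rewrite (walkE_jumpsS n eta x (fun xi p => (size p == N.+1)%N%:R * f xi p)).
have d0 := degR_gt0 R Glf x.
have hA := IH N.+1 (toggle x eta) x f g g0 fg gt.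
rewrite hE toggleK in hA; rewrite hE.
rewrite ler_pdivrMl ?deg1R_gt0//.
apply: (@le_trans _ _ ((1 - flip_prob x) * a (toggle x eta) + flip_prob x * a eta +
    (deg x)%:R * a eta)).
  rewrite lerD// nbr_sumE ler_pM2l//.
  apply: (ler_nbr_avg Glf) => y xy.
  apply: (IH N eta y (fun xi p => f xi (y :: p)) (fun xi p => g xi (y :: p))) => //.
  by move=> xi p; rewrite -[last y p]/(last x (y :: p)) gt.
(* [flip_prob x] solves this fixed-point equation: after a switch the sojourn starts afresh with the
   lamp at x toggled. *)
rewrite le_eqVlt; apply/orP; left; apply/eqP.
rewrite /flip_prob -[(deg x).+2%:R]natr1 -natr1; field.
by rewrite gt_eqF // !addr_gt0.
Qed.

End Comparison.

(** * Generating function of the number of changed lamps *)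

Lemma half_mix_ge0 (R : realFieldType) (t r : R) (b : bool) :
  0 < t -> t < 1 -> 0 <= r -> r <= 1 ->
  0 <= (1 + t) / 2 + r * ((if b then 1 else t) - (1 + t) / 2).
Proof.
move=> t0 t1 r0 r1; have m1 : 0 <= r * (1 - t) by rewrite mulr_ge0//; lra.
have m2 : 0 <= (1 - r) * (1 - t) by rewrite mulr_ge0//; lra.
by case: b; lra.
Qed.

Lemma half_mix_le (R : realFieldType) (t r d : R) (b : bool) :
  0 < t -> t < 1 -> 0 <= r -> r <= d ->
  (1 + t) / 2 + r * ((if b then 1 else t) - (1 + t) / 2) <=
  (1 + t) / 2 + d * ((1 - t) / 2).
Proof.
move=> t0 t1 r0 r1; have m1 : 0 <= r * (1 - t) by rewrite mulr_ge0//; lra.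
have m2 : 0 <= (d - r) * (1 - t) by rewrite mulr_ge0//; lra.
by case: b; lra.
Qed.

Section LampTail.
Context (R : realType) (G : sgraph) (Glf : locally_finite G).
Implicit Types (x y z : G) (eta xi : config G) (p : seq G).
Implicit Types (q : seq (lamplighter G)) (n N K : nat).
Local Notation lv eta x := ((eta, x) : lamplighter G).
Local Notation flip_prob := (@flip_prob R G).
Let Hlf : locally_finite (lamplighter G) := lamplighter_lf Glf.

Section Weight.
Context (t : R) (t0 : 0 < t) (t1 : t < 1) (eta0 : config G).

(* Expectation of t to the power [the lamp at z differs from eta0], after c
   sojourns at z starting from the lamp state b. *)
Definition lamp_pgf z (c : nat) (b : bool) : R :=
  (1 + t) / 2 +
  (1 - 2 * flip_prob z) ^+ c * ((if b == eta0 z then 1 else t) - (1 + t) / 2).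

Lemma lamp_pgfS z c b : lamp_pgf z c.+1 b =
  (1 - flip_prob z) * lamp_pgf z c b + flip_prob z * lamp_pgf z c (~~ b).
Proof.
rewrite /lamp_pgf exprS; move: (_ ^+ c) => r.
by case: b; case: (eta0 z); rewrite /=; field.
Qed.

(** A sojourn at x acts on the factor of x alone, and there by the recursion [lamp_pgfS]. *)
Lemma lampE_prod (U : seq G) p eta : uniq U ->
  lampE p eta (fun xi => \prod_(z <- U) lamp_pgf z 0 (xi z)) =
  \prod_(z <- U) lamp_pgf z (count_mem z p) (eta z).
Proof.
move=> uU; elim: p eta => [//|x p IH] eta /=; rewrite !IH.
case: (boolP (x \in U)) => xU.
  rewrite !(bigD1_seq x xU uU)/= toggleE eqxx add1n lamp_pgfS.
  have -> : \prod_(z <- U | z != x) lamp_pgf z (count_mem z p) (toggle x eta z) =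
      \prod_(z <- U | z != x) lamp_pgf z (count_mem z p) (eta z).
    by apply: eq_bigr => z zx; rewrite toggleE (negPf zx).
  rewrite [in RHS](eq_bigr (fun z => lamp_pgf z (count_mem z p) (eta z))); last first.
    by move=> z zx; rewrite eq_sym (negPf zx).
  by ring.
have zx z : z \in U -> (z == x) = false.
  by move=> zU; apply: contraNF xU => /eqP <-.
have -> : \prod_(z <- U) lamp_pgf z (count_mem z p) (toggle x eta z) =
    \prod_(z <- U) lamp_pgf z (count_mem z p) (eta z).
  by rewrite !big_seq; apply: eq_bigr => z zU; rewrite toggleE zx.
rewrite [RHS](_ : _ = \prod_(z <- U) lamp_pgf z (count_mem z p) (eta z)); last first.
  by rewrite !big_seq; apply: eq_bigr => z zU; rewrite eq_sym zx.
by ring.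
Qed.

Lemma lamp_pgf_ge0 z c b : 0 <= lamp_pgf z c b.
Proof.
have /andP[h1 h2] := flip_prob_bounds R z; rewrite /lamp_pgf.
have r0 : 0 <= (1 - 2 * flip_prob z) ^+ c by rewrite exprn_ge0//; lra.
have r1 : (1 - 2 * flip_prob z) ^+ c <= 1 by rewrite exprn_ile1//; lra.
exact: half_mix_ge0.
Qed.

Lemma lamp_pgf_le (delta : R) K z c b :
  (1 - 2 * flip_prob z) ^+ K <= delta -> (K <= c)%N ->
  lamp_pgf z c b <= (1 + t) / 2 + delta * ((1 - t) / 2).
Proof.
move=> hd Kc; have /andP[h1 h2] := flip_prob_bounds R z; rewrite /lamp_pgf.
have r0 : 0 <= (1 - 2 * flip_prob z) ^+ c by rewrite exprn_ge0//; lra.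
have r1 : (1 - 2 * flip_prob z) ^+ c <= delta.
  by apply: le_trans hd; rewrite ler_wiXn2l//; lra.
exact: half_mix_le.
Qed.

Lemma lampE_prod_le (delta : R) K (U : seq G) p eta : uniq U ->
  (forall z, (1 - 2 * flip_prob z) ^+ K <= delta) ->
  {in U, forall z, (K <= count_mem z p)%N} ->
  lampE p eta (fun xi => \prod_(z <- U) lamp_pgf z 0 (xi z)) <=
  ((1 + t) / 2 + delta * ((1 - t) / 2)) ^+ size U.
Proof.
move=> uU hd hU; rewrite lampE_prod//.
elim: U uU hU => [|z U IH]; first by rewrite big_nil.
rewrite big_cons exprS => /= /andP[_ uU] hU.
rewrite ler_pM ?lamp_pgf_ge0//.
- by rewrite prodr_ge0// => i _; rewrite lamp_pgf_ge0.
- by apply: lamp_pgf_le (hd z) _; rewrite hU ?mem_head.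
- by apply: IH => // i iU; rewrite hU// inE iU orbT.
Qed.

(** Without sojourns each factor is 1 or t, so the product is t to the number of changed lamps in U,
    which is at most the number of all changed lamps. *)
Lemma prod_lamp_pgf0_ge (U : seq G) xi : uniq U ->
  t ^+ #|` lamp_diff eta0 xi| <= \prod_(z <- U) lamp_pgf z 0 (xi z).
Proof.
move=> uU; have -> : \prod_(z <- U) lamp_pgf z 0 (xi z) =
    t ^+ (count (fun z => xi z != eta0 z) U).
  elim: U {uU} => [|z U IH]; first by rewrite big_nil.
  rewrite big_cons IH/= exprD; congr (_ * _).
  by rewrite /lamp_pgf expr0 mul1r addrC subrK; case: eqP.
rewrite ler_wiXn2l// ?ltW// -size_filter.
apply: uniq_leq_size; first exact: filter_uniq.
by move=> z; rewrite mem_filter => /andP[h _]; rewrite in_lamp_diff eq_sym.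
Qed.

(* Union bound over the number N <= n of jumps. *)
Lemma lamp_tail (delta : R) K n (a b : nat) x :
  delta <= 1 -> (forall z, (1 - 2 * flip_prob z) ^+ K <= delta) ->
  walkE n (lv eta0 x) (fun q =>
    ((#|` lamp_diff eta0 (last (lv eta0 x) q).1| <= a) &&
     (b <= nvisits K.+1 (jumps x q)))%N%:R) <=
  n.+1%:R * (t^-1 ^+ a.+1 * ((1 + t) / 2 + delta * ((1 - t) / 2)) ^+ b).
Proof.
move=> d1 hd; have := t0; have := t1 => t1' t0'; set rho := (1 + t) / 2 + _.
have d0 : 0 <= delta.
  apply: le_trans (hd x); have /andP[h1 h2] := flip_prob_bounds R x.
  by rewrite exprn_ge0//; lra.
have rho0 : 0 <= rho by rewrite /rho addr_ge0// ?mulr_ge0//; lra.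
have rho1 : rho <= 1.
  have : 0 <= (1 - delta) * (1 - t) by rewrite mulr_ge0// subr_ge0 // ltW.
  by rewrite /rho; lra.
pose D xi := #|` lamp_diff eta0 xi|.
pose f xi p : R := ((D xi <= a) && (b <= nvisits K.+1 p))%N%:R.
(* Allowing both states of the lamp at the current position makes [g] independent of it. This costs
   one lamp, hence the exponent [a.+1]. *)
pose g xi p : R := (((D xi <= a) || (D (toggle (last x p) xi) <= a)) &&
  (b <= nvisits K.+1 p))%N%:R.
apply: (@le_trans _ _ (walkE n (lv eta0 x) (fun q => \sum_(N < n.+1)
    (size (jumps x q) == N)%:R * f (last (lv eta0 x) q).1 (jumps x q)))).
  apply: (ler_walkE Hlf) => q _ sq.
  have hs : (size (jumps x q) < n.+1)%N by rewrite ltnS -sq size_jumps.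
  rewrite (bigD1 (Ordinal hs))//= eqxx mul1r lerDl.
  by rewrite sumr_ge0// => i _; rewrite mulr_ge0.
rewrite walkE_sum// mulr_natl -[X in _ *+ X]card_ord -sumr_const.
apply: ler_sum => N _.
apply: (le_trans (@walkE_jumps_lamps R G Glf n N eta0 x f g _ _ _)).
- by move=> xi p; rewrite ler0n.
- by move=> xi p; rewrite /f /g ler_nat; case: (D xi <= a)%N.
- by move=> xi p; rewrite /g toggleK orbC.
apply: (walkE_le Glf) => p _ _.
case: (boolP (b <= nvisits K.+1 p)%N) => [hb|/negbTE hb]; last first.
  apply: (@le_trans _ _ (lampE (belast x p) eta0 (fun xi => 0 * g xi p))).
    by apply: ler_lampE => xi; rewrite /g leqNgt hb andbF mul0r.
  by rewrite lampEZ mul0r mulr_ge0// exprn_ge0// invr_ge0 ltW.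
pose U : seq G := visits K.+1 p.
have uU : uniq U by exact: fset_uniq.
apply: (@le_trans _ _ (lampE (belast x p) eta0 (fun xi =>
    t^-1 ^+ a.+1 * \prod_(z <- U) lamp_pgf z 0 (xi z)))).
  apply: ler_lampE => xi.
  have h : g xi p <= (D xi <= a.+1)%N%:R.
    rewrite /g hb andbT ler_nat.
    case: (leqP (D xi) a) => [h|h] /=; first by rewrite (leq_trans h).
    case: (leqP (D _) a) => //= h2.
    by rewrite (leq_trans (lamp_diff_toggle (last x p) eta0 xi)).
  apply: (le_trans h); case: leqP => hD /=; last first.
    rewrite mulr_ge0 ?exprn_ge0 ?invr_ge0 ?(ltW t0)//.
    by rewrite prodr_ge0// => z _; rewrite lamp_pgf_ge0.
  rewrite -(@ler_pM2l _ (t ^+ a.+1)) ?exprn_gt0// mulr1 mulrA -exprMn divff ?gt_eqF//.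
  rewrite expr1n mul1r; apply: le_trans (prod_lamp_pgf0_ge xi uU).
  by rewrite ler_wiXn2l// ltW.
rewrite lampEZ ler_wpM2l ?exprn_ge0 ?invr_ge0 ?(ltW t0)//.
(* Of K + 1 visits in [p], at least K belong to completed sojourns, as [belast] drops only the final
   position. *)
apply: le_trans (lampE_prod_le (K := K) eta0 uU hd _) _.
  move=> z; rewrite -[z \in U]/(z \in visits K.+1 p) in_visits// => hz.
  have : (K.+1 <= count_mem z (x :: p))%N by rewrite /= (leq_trans hz)// leq_addl.
  rewrite lastI -cats1 count_cat/= addn0 => hz2.
  by rewrite -ltnS (leq_trans hz2)// -addn1 leq_add2l leq_b1.
by rewrite ler_wiXn2l.
Qed.

End Weight.
End LampTail.

(** * Number of jumps of the lazy walk *)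

Lemma two_step_le (R : realFieldType) (a p : R) : 0 <= a <= 1 -> 2 / 3 <= p <= 1 ->
  (1 - p) * (1 - p * a) + p * ((1 - a) * (1 - a / 2)) <=
  1 - 13 / 12 * a + a ^+ 2 / 3.
Proof.
move=> /andP[a0 a1] /andP[p0 p1]; rewrite expr2.
have h1 : 0 <= (1 - p - 0) * (p - 2 / 3) by rewrite mulr_ge0//; lra.
have h2 : 0 <= (1 - a) * (p - 2 / 3) by rewrite mulr_ge0//; lra.
have h : 0 <= 5 / 2 * p - p * p - 13 / 12 - a * (p / 2 - 1 / 3) by nra.
have := mulr_ge0 a0 h; nra.
Qed.

Section JumpCount.
Context (R : realType) (G : sgraph) (Glf : locally_finite G).
Implicit Types (x y z : G) (eta xi : config G) (p : seq G).
Implicit Types (q : seq (lamplighter G)) (n N k : nat).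
Local Notation lv eta x := ((eta, x) : lamplighter G).
Let Hlf : locally_finite (lamplighter G) := lamplighter_lf Glf.

Definition move_prob x : R := (deg x)%:R / (deg x).+1%:R.

Lemma move_prob_ge k x : (k <= deg x)%N -> k%:R / k.+1%:R <= move_prob x.
Proof.
move=> kd; rewrite /move_prob ler_pdivrMr ?ltr0n// mulrAC ler_pdivlMr ?ltr0n//.
by rewrite -!natrM ler_nat; lia.
Qed.

Lemma move_prob_le1 x : move_prob x <= 1.
Proof. by rewrite ler_pdivrMr ?ltr0n// mul1r ler_nat. Qed.

Lemma move_probE x : (deg x).+1%:R^-1 = 1 - move_prob x.
Proof.
rewrite /move_prob -[(deg x).+1%:R]natr1; field.
by rewrite natr1 pnatr_eq0.
Qed.

Lemma nbr_sum_cst x (c : R) : (deg x).+1%:R^-1 *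
  \sum_(y <- fset_set (neighbors x)) c = move_prob x * c.
Proof.
by rewrite (nbr_sumE Glf) nbr_avg_const// /move_prob mulrA [_^-1 * _]mulrC.
Qed.

Lemma ler_nbr_sum x (F : G -> R) (c : R) : (forall y, adj x y -> F y <= c) ->
  (deg x).+1%:R^-1 * \sum_(y <- fset_set (neighbors x)) F y <= move_prob x * c.
Proof.
move=> h; rewrite -nbr_sum_cst ler_pM2l ?invr_gt0 ?ltr0n//.
by rewrite !big_seq ler_sum// => y; rewrite mem_nbr//; apply: h.
Qed.

Context (t : R) (t0 : 0 < t) (t1 : t <= 1).

Lemma walkE_jumps1 eta x :
  walkE 1 (lv eta x) (fun q => t ^+ size (jumps x q)) = 1 - move_prob x * (1 - t).
Proof.
rewrite (walkE_jumpsS Glf 0 eta x (fun _ p => t ^+ size p)).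
rewrite mulrDr /= nbr_sum_cst expr1 expr0 mulr1 move_probE; ring.
Qed.

Hypothesis deg1_nbr : forall x y, adj x y -> (deg x <= 1)%N -> (2 <= deg y)%N.

(* 13/12 is a lower bound for the expected number of jumps in two steps, attained
   from a vertex of degree 1 whose neighbour has degree 2. *)
Lemma walkE_jumps2 eta x :
  walkE 2 (lv eta x) (fun q => t ^+ size (jumps x q)) <=
  1 - 13 / 12 * (1 - t) + (1 - t) ^+ 2 / 3.
Proof.
rewrite (walkE_jumpsS Glf 1 eta x (fun _ p => t ^+ size p)) mulrDr.
rewrite walkE_jumps1 move_probE.
have -> : \sum_(y <- fset_set (neighbors x)) walkE 1 (lv eta y)
    (fun q => t ^+ size (y :: jumps y q)) =
  \sum_(y <- fset_set (neighbors x)) t * (1 - move_prob y * (1 - t)).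
  by apply: eq_bigr => y _; rewrite -(walkE_jumps1 eta) -walkEZ;
    apply: (eq_walkE Hlf) => q _ _; rewrite -exprS.
rewrite -move_probE.
have t0' := t0; have t1' := t1.
have a01 : 0 <= 1 - t <= 1 by apply/andP; split; lra.
case: (leqP (deg x) 1) => d.
  have h y : adj x y -> t * (1 - move_prob y * (1 - t)) <= t * (1 - 2 / 3 * (1 - t)).
    move=> xy; rewrite ler_wpM2l ?(ltW t0)// lerD2l lerN2 ler_wpM2r ?subr_ge0//.
    exact: (@move_prob_ge 2 _ (deg1_nbr xy d)).
  apply: (le_trans (lerD (lexx _) (ler_nbr_sum h))).
  rewrite move_probE; have -> : move_prob x = 1 / 2.
    have d1 : deg x = 1%N by apply/eqP; rewrite eqn_leq d; have [] := Glf x.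
    by rewrite /move_prob d1.
  by rewrite expr2; nra.
have h y : adj x y -> t * (1 - move_prob y * (1 - t)) <= t * (1 - (1 - t) / 2).
  move=> xy; rewrite ler_wpM2l ?(ltW t0)// lerD2l lerN2 [leLHS]mulrC ler_wpM2r ?subr_ge0//.
  have [_ dy] := Glf y.
  by have := move_prob_ge dy; rewrite div1r.
apply: (le_trans (lerD (lexx _) (ler_nbr_sum h))).
rewrite move_probE.
(* Here the walk moves with probability at least 2/3; after a move, only probability 1/2 of moving
   again is guaranteed, whence the factor 1 - a / 2. *)
have := @two_step_le R (1 - t) (move_prob x) a01.
rewrite (@move_prob_ge 2)// move_prob_le1 => /(_ isT).
by rewrite [1 - (1 - t)]subKr.
Qed.

Lemma walkE_jumps_iter k (u : lamplighter G) :
  walkE (k * 2) u (fun q => t ^+ size (jumps u.2 q)) <=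
  (1 - 13 / 12 * (1 - t) + (1 - t) ^+ 2 / 3) ^+ k.
Proof.
set gam := 1 - _ + _.
have gam0 : 0 <= gam.
  have t0' := t0; have t1' := t1.
  rewrite /gam; have := sqr_ge0 (1 - t - 1); rewrite !expr2; lra.
elim: k u => [|k IH] u; first by rewrite mul0n/= expr0.
rewrite mulSn walkE_cat exprS; case: u => eta x.
apply: (@le_trans _ _ (walkE 2 (lv eta x) (fun q =>
    gam ^+ k * t ^+ size (jumps x q)))).
  apply: (ler_walkE Hlf) => q _ _.
  apply: (@le_trans _ _ (walkE (k * 2) (last (lv eta x) q) (fun q' =>
     t ^+ size (jumps x q) * t ^+ size (jumps (last (lv eta x) q).2 q')))).
    apply: (ler_walkE Hlf) => q' _ _.
    by rewrite -[X in jumps X]/((lv eta x).2) jumps_cat size_cat exprD.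
  by rewrite walkEZ mulrC ler_wpM2r ?exprn_ge0 ?(ltW t0).
by rewrite walkEZ mulrC ler_wpM2r ?exprn_ge0// walkE_jumps2.
Qed.

End JumpCount.

Lemma jump_count_tail (R : realType) (G : sgraph) (Glf : locally_finite G)
    (deg1_nbr : forall x y : G, adj x y -> (deg x <= 1)%N -> (2 <= deg y)%N)
    (k : nat) (u : lamplighter G) :
  walkE (96 * k) u (fun q => (size (jumps u.2 q) < 50 * k)%N%:R) <=
  expR (- (k%:R / 120)) :> R.
Proof.
have Hlf := lamplighter_lf Glf.
(* With t = exp (- s), the exponent per unit of k is bounded by 50 s - 52 (s - 2 s^2) + 16 s^2 = - 2
   s + 120 s^2. It is minimal at s = 1 / 120, with value - 1 / 120. *)
pose t : R := expR (- (1 / 120)).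
have t0 : 0 < t by exact: expR_gt0.
have t1 : t <= 1 by rewrite expR_le1; lra.
apply: (@le_trans _ _ (walkE (96 * k) u (fun q =>
    t^-1 ^+ (50 * k) * t ^+ size (jumps u.2 q)))).
  apply: (ler_walkE Hlf) => q _ _.
  case: ltnP => h; last by rewrite mulr_ge0 ?exprn_ge0 ?invr_ge0 ?(ltW t0).
  rewrite -(subnKC (ltnW h)) exprD mulrAC -exprMn mulVf ?gt_eqF// expr1n mul1r.
  by rewrite exprn_ege1// invf_ge1.
rewrite walkEZ; have -> : (96 * k = (48 * k) * 2)%N by lia.
apply: (le_trans (ler_wpM2l _ (walkE_jumps_iter Glf t0 t1 deg1_nbr (48 * k) u))).
  by rewrite exprn_ge0// invr_ge0 ltW.
have hg : 1 - 13 / 12 * (1 - t) + (1 - t) ^+ 2 / 3 <=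
    expR (- (13 / 12) * (1 / 120 - 2 / 120 ^+ 2) + 1 / 120 ^+ 2 / 3).
  apply: le_trans (expR_ge1Dx _).
  have h1 : t <= 1 + - (1 / 120) + 2 * (- (1 / 120)) ^+ 2 by apply: expR_le_quad; lra.
  have h2 : 1 + - (1 / 120) <= t by exact: expR_ge1Dx.
  rewrite !expr2 in h1 *.
  have h3 : (1 - t) * (1 - t) <= (1 / 120) * (1 / 120) by apply: ler_pM; lra.
  lra.
have g0 : 0 <= 1 - 13 / 12 * (1 - t) + (1 - t) ^+ 2 / 3.
  by have := sqr_ge0 (1 - t - 1); rewrite !expr2; lra.
apply: (le_trans (ler_wpM2l _ (lerXn2r (48 * k) _ _ hg))).
- by rewrite exprn_ge0// invr_ge0 ltW.
- by rewrite nnegrE.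
- by rewrite nnegrE expR_ge0.
rewrite /t -expRN opprK -!expRM_natl -expRD ler_expR !natrM !expr2.
have : 0 <= k%:R :> R by rewrite ler0n.
lra.
Qed.

(** * Distances in the lamplighter graph *)

Lemma path_cons (T : Type) (e : rel T) x y p :
  path e x (y :: p) = e x y && path e y p.
Proof. by []. Qed.

Section Distance.
Context (G : sgraph).
Implicit Types (x y z : G) (eta xi : config G) (p : seq G).
Implicit Types (u v : lamplighter G) (q : seq (lamplighter G)) (n : nat).
Local Notation lv eta x := ((eta, x) : lamplighter G).
Local Notation lamp_path := (path (@adj (lamplighter G))).

Lemma gdist_le (H : sgraph) (u v : H) n : walk_of_length u v n -> (gdist u v <= n)%N.
Proof.
move=> w; rewrite /gdist; case: pselect => [h|//].
by case: ex_minnP => m _; apply; apply/asboolP.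
Qed.

Lemma gdist_walk (H : sgraph) (u v : H) n : walk_of_length u v n ->
  walk_of_length u v (gdist u v).
Proof.
move=> w; rewrite /gdist; case: pselect => [h|[]]; last by exists n.
by case: ex_minnP => m /asboolP.
Qed.

Lemma lamp_diff_toggle_l x eta xi :
  (#|` lamp_diff eta xi| <= #|` lamp_diff (toggle x eta) xi|.+1)%N.
Proof.
have sym e1 e2 : lamp_diff e1 e2 = lamp_diff e2 e1.
  by apply/fsetP => z; rewrite !in_lamp_diff eq_sym.
by rewrite sym [in leqRHS]sym lamp_diff_toggle.
Qed.

(** Each step either is a jump or switches a single lamp. *)
Lemma lamp_diff_jumps_size u q : lamp_path u q ->
  (#|` lamp_diff u.1 (last u q).1| + size (jumps u.2 q) <= size q)%N.
Proof.
elim: q u => [|v q IH] u.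
  move=> _; rewrite addn0 leqn0 cardfs_eq0; apply/eqP/fsetP => z.
  by rewrite in_lamp_diff eqxx.
case: u => eta x; rewrite path_cons adj_lamp => /andP[/orP[/andP[/eqP ve xv]|/eqP ->]] vq.
  have {IH} := IH _ vq; rewrite ve /=; case: eqP => [vx|_] /= h.
    by move: xv; rewrite vx adj_irrefl.
  by rewrite addnS ltnS.
have {IH} := IH _ vq; rewrite /= eqxx => h.
apply: leq_trans (leq_add (lamp_diff_toggle_l x eta _) (leqnn _)) _.
by rewrite addSn ltnS.
Qed.

Lemma lamp_diff_sub u q : lamp_path u q ->
  {subset lamp_diff u.1 (last u q).1 <= u.2 :: jumps u.2 q}.
Proof.
elim: q u => [|v q IH] u; first by move=> _ z; rewrite in_lamp_diff eqxx.
case: u => eta x; rewrite path_cons adj_lamp => /andP[/orP[/andP[/eqP ve xv]|/eqP ->]] vq z.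
  have := IH _ vq z; rewrite ve /= => h /h; case: eqP => [<-//|_] h2.
  by rewrite inE h2 orbT.
have := IH _ vq z; rewrite /= eqxx !in_lamp_diff toggleE inE.
by case: (eqVneq z x) => [//|_ h /h].
Qed.

Lemma path_jumps u q : lamp_path u q -> path (@adj G) u.2 (jumps u.2 q).
Proof.
elim: q u => [//|v q IH] u.
case: u => eta x; rewrite path_cons adj_lamp => /andP[/orP[/andP[/eqP ve xv]|/eqP ->]] vq.
  have := IH _ vq; rewrite /=; case: eqP => [vx|_] /= h; first by rewrite -vx.
  by rewrite xv.
by have := IH _ vq; rewrite /= eqxx.
Qed.

(** On a geodesic, L changed lamps need L switches. They also need L - 1 jumps, since their
    positions are all visited and only one can be the starting position. *)
Lemma gdist_lamp_ge u q : lamp_path u q ->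
  (2 * #|` lamp_diff u.1 (last u q).1| <= (gdist u (last u q)).+1)%N.
Proof.
move=> uq; have w : walk_of_length u (last u q) (size q) by exists q.
have [q' [uq' lq' <-]] := gdist_walk w; rewrite -lq'.
have h1 := lamp_diff_jumps_size uq'.
have h2 : (#|` lamp_diff u.1 (last u q').1| <= (size (jumps u.2 q')).+1)%N.
  have := uniq_leq_size (fset_uniq _) (lamp_diff_sub uq').
  exact.
lia.
Qed.

(** Induction on the path. If x already lies on the tour of the tail, the tour is rotated to start
    at x; otherwise it is extended by the edge to x, run in both directions, which adds two steps
    for one new vertex. *)
Lemma closed_tour x p : path (@adj G) x p ->
  exists c, [/\ path (@adj G) x c, last x c = x, x :: c =i x :: p &
    (size c <= 2 * (size (undup (x :: p))).-1)%N].
Proof.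
elim: p x => [|y p IH] x; first by exists [::].
rewrite [path _ _ _]/= => /andP[xy /IH[c [yc lc cp sc]]].
case: (boolP (x \in y :: p)) => xyp.
  have : x \in y :: c by rewrite cp.
  move=> xyc; case/splitPl: xyc yc lc cp sc => c1 c2 lc1.
  rewrite cat_path lc1 last_cat lc1 => /andP[yc1 xc2] lc2 cp sc.
  exists (c2 ++ c1); split.
  - by rewrite cat_path xc2 lc2.
  - by rewrite last_cat lc2.
  - have yc2 : y \in x :: c2 by rewrite -lc2 mem_last.
    move=> z; have E : (z \in y :: p) = (z \in y :: (c1 ++ c2)) by rewrite cp.
    rewrite [LHS]in_cons [RHS]in_cons E; case: (eqVneq z x) => [//|zx] /=.
    rewrite in_cons !mem_cat orbC; case: (eqVneq z y) => [zy|//] /=.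
    by move: yc2; rewrite in_cons -zy (negPf zx) /= => ->; rewrite orbT.
  - by rewrite [undup _]/= xyp size_cat addnC -size_cat.
exists (y :: rcons c x); split.
- by rewrite /= xy rcons_path yc lc adj_sym.
- by rewrite /= last_rcons.
- move=> z; have E : (z \in y :: p) = (z \in y :: c) by rewrite cp.
  rewrite [LHS]in_cons [RHS]in_cons E !in_cons mem_rcons in_cons.
  by case: (z == x).
- rewrite [undup _]/= (negPf xyp) /= size_rcons.
  have : (0 < size (undup (y :: p)))%N.
    by rewrite -has_predT; apply/hasP; exists y; rewrite // mem_undup mem_head.
  by rewrite /= in sc *; lia.
Qed.

Lemma covering_walk x p : path (@adj G) x p ->
  exists w, [/\ path (@adj G) x w, last x w = last x p, x :: w =i x :: p &
    (size w <= 3 * (size (undup (x :: p))).-1)%N].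
Proof.
move=> xp; have [c [xc lc cp sc]] := closed_tour xp.
have [p' [xp' up' sp' lp']] : exists p', [/\ path (@adj G) x p', uniq (x :: p'),
    {subset p' <= p} & last x p' = last x p].
  by case/shortenP: xp => p' ? ? ?; exists p'.
exists (c ++ p'); split.
- by rewrite cat_path xc lc.
- by rewrite last_cat lc.
- move=> z; rewrite -[x :: c ++ p']/((x :: c) ++ p') mem_cat cp.
  by apply/orP/idP => [[//|/sp' zp]|]; [rewrite in_cons zp orbT|left].
have h : (size (x :: p') <= size (undup (x :: p)))%N.
  apply: uniq_leq_size => // z; rewrite mem_undup !in_cons.
  by case: (z == x) => //= /sp'.
by rewrite size_cat; move: sc h => /=; lia.
Qed.

(** Follow [w] and correct the lamp of a vertex only at its last visit, so that there is at most one
    switch per distinct vertex. *)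
Lemma lamp_walk x (w : seq G) eta xi : path (@adj G) x w ->
  {subset lamp_diff eta xi <= x :: w} ->
  exists q, [/\ lamp_path (lv eta x) q, last (lv eta x) q = lv xi (last x w) &
    (size q <= size w + size (undup (x :: w)))%N].
Proof.
have agree z e : (z \in lamp_diff e xi) = (e z != xi z) by rewrite in_lamp_diff.
elim: w x eta => [|y w IH] x eta.
  move=> _ hd; case: (eqVneq (eta x) (xi x)) => hx.
    exists [::]; split => //; congr (_, _); apply/fsfunP => z.
    apply/eqP/contraT => zne; have := hd z; rewrite agree zne => /(_ isT).
    by rewrite inE => /eqP zx; rewrite zx hx eqxx in zne.
  have E : toggle x eta = xi.
    apply/fsfunP => z; rewrite toggleE; case: (eqVneq z x) => [->|zx].
      by move: hx; case: (eta x); case: (xi x).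
    apply/eqP/contraT => zne; have := hd z; rewrite agree zne => /(_ isT).
    by rewrite inE (negPf zx).
  exists [:: lv xi x]; split => //.
  by rewrite path_cons adj_lamp E eqxx orbT.
rewrite path_cons => /andP[xy yw] hd.
case: (boolP ((x \in y :: w) || (eta x == xi x))) => hx.
  have hd' : {subset lamp_diff eta xi <= y :: w}.
    move=> z zD; have := hd z zD; rewrite in_cons => /orP[/eqP zx|//].
    case/orP: hx; first by rewrite zx.
    by move: zD; rewrite agree zx => /negPf ->.
  have [q [qp ql qs]] := IH y eta yw hd'.
  exists (lv eta y :: q); split => //.
    by rewrite path_cons adj_lamp eqxx xy.
  rewrite [size (_ :: _)]/= [undup _]/= -/(undup (y :: w)).
  apply: (@leq_trans (size w + size (undup (y :: w))).+1%N) => //.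
  by rewrite [size (_ :: _)]/= addSn ltnS leq_add2l; case: ifP.
move: hx; rewrite negb_or => /andP[xyw hx].
have hd' : {subset lamp_diff (toggle x eta) xi <= y :: w}.
  move=> z; rewrite agree toggleE; case: (eqVneq z x) => [->|zx].
    by move: hx; case: (eta x); case: (xi x).
  by rewrite -agree => /hd; rewrite in_cons (negPf zx).
have [q [qp ql qs]] := IH y (toggle x eta) yw hd'.
exists (lv (toggle x eta) x :: lv (toggle x eta) y :: q); split => //.
  by rewrite !path_cons !adj_lamp !eqxx xy orbT.
rewrite [undup _]/= -/(undup (y :: w)) (negPf xyw) /=.
by move: qs => /=; lia.
Qed.

(** A covering walk and one switch per vertex give 3 (V - 1) + V steps. Here V is at most [nvisits]
    plus one, as [jumps] omits the starting position. *)
Lemma gdist_lamp_le u q : lamp_path u q ->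
  (gdist u (last u q) <= 4 * (nvisits 1 (jumps u.2 q)).+1)%N.
Proof.
move=> uq; have [w [xw lw ws sw]] := covering_walk (path_jumps uq).
case: u => eta x in uq xw lw ws sw *.
have hd : {subset lamp_diff eta (last (lv eta x) q).1 <= x :: w}.
  by move=> z /(lamp_diff_sub uq); rewrite /= ws.
have [q' [qp ql qs]] := lamp_walk xw hd.
have wl : walk_of_length (lv eta x) (last (lv eta x) q) (size q').
  exists q'; split => //; rewrite ql lw last_jumps.
  by case: (last _ q).
apply: (leq_trans (gdist_le wl)); apply: (leq_trans qs).
have -> : size (undup (x :: w)) = size (undup (x :: jumps x q)).
  by apply/eqP; rewrite eqn_leq !uniq_leq_size ?undup_uniq// => z; rewrite !mem_undup ws.
have : (size (undup (x :: jumps x q)) <= (nvisits 1 (jumps x q)).+1)%N.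
  by rewrite nvisits1_size /=; case: ifP => _ //=; rewrite leqnSn.
by move: sw => /=; lia.
Qed.

End Distance.

(** * The law of finite trajectories *)

Lemma bigcup_countable_measurable (d : measure_display) (T : measurableType d)
    (I : choiceType) (F : I -> set T) :
  countable [set: I] -> (forall i, measurable (F i)) -> measurable (\bigcup_i F i).
Proof.
move=> /countable_injP[f finj] mF.
have -> : \bigcup_i F i = \bigcup_k \bigcup_(i in [set i | f i = k]) F i.
  apply/seteqP; split => w [i _ Fi]; first by exists (f i) => //; exists i.
  by case: Fi => j _ Fj; exists j.
apply: bigcup_measurable => k _.
case: (pselect (exists i, f i = k)) => [[i fik]|h].
  have -> // : \bigcup_(i in [set i | f i = k]) F i = F i.
  apply/seteqP; split => w; last by move=> Fi; exists i.
  move=> [j /= fjk Fj]; have <- // : j = i.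
  by apply: finj; rewrite ?inE// fik.
rewrite (_ : \bigcup_(i in _) _ = set0)//.
by apply/seteqP; split => w // [j /= fjk _]; apply: h; exists j.
Qed.

Lemma countable_connected (H : sgraph) : locally_finite H -> connected_graph H ->
  H -> countable [set: H].
Proof.
move=> Hlf Hc x0.
pose sph n := iter n (fun A => \bigcup_(x in A) neighbors x) [set x0].
have csph n : countable (sph n).
  elim: n => [|n IH]; first exact: countable1.
  apply: bigcup_countable => // x _; apply: finite_set_countable.
  by have [] := Hlf x.
have sphP p x n : sph n x -> path (@adj H) x p -> sph (size p + n)%N (last x p).
  elim: p x n => [//|y p IH] x n snx; rewrite path_cons => /andP[xy yp].
  have -> : (size (y :: p) + n = size p + n.+1)%N by rewrite addnS.
  by apply: IH => //; exists x.
apply: (@sub_countable _ _ _ (\bigcup_n sph n)); last exact: bigcup_countable.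
apply: subset_card_le => y _; have [n [p [xp <- _]]] := Hc x0 y.
by exists (size p + 0)%N => //; apply: sphP.
Qed.

Section Law.
Context (R : realType) (H : sgraph) (Hlf : locally_finite H).
Hypothesis Hcount : countable [set: H].
Context (d : measure_display) (T : measurableType d) (P : probability T R).
Context (x : H) (S : nat -> T -> H) (hS : is_srw P x S).

(** The starting point is left out, in accordance with the lists in [walkE]. *)
Definition trajectory n (w : T) : seq H := mkseq (fun i => S i.+1 w) n.

Lemma take_trajectory k n w : (k <= n)%N ->
  take k (trajectory n w) = trajectory k w.
Proof. by move=> kn; rewrite /trajectory /mkseq -map_take take_iota (minn_idPl kn). Qed.

Lemma measurable_history n (B : set (seq H)) :
  measurable [set w | B (mkseq (fun i => S i w) n)].
Proof.
elim: n B => [|n IH] B.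
  rewrite /mkseq /=; case: (pselect (B [::])) => h.
    by rewrite (_ : [set _ | _] = setT)//; apply/seteqP; split.
  by rewrite (_ : [set _ | _] = set0)//; apply/seteqP; split.
have -> : [set w | B (mkseq (fun i => S i w) n.+1)] = \bigcup_y
    (S n @^-1` [set y] `&` [set w | B (rcons (mkseq (fun i => S i w) n) y)]).
  apply/seteqP; split => w /=; first by rewrite mkseqS => h; exists (S n w).
  by move=> [y _ /= [<-]]; rewrite mkseqS.
apply: bigcup_countable_measurable => // y; apply: measurableI.
  exact: srw_measurable hS n y.
exact: (IH (fun s => B (rcons s y))).
Qed.

Lemma measurable_trajectory n (B : set (seq H)) :
  measurable [set w | B (trajectory n w)].
Proof.
rewrite (_ : [set w | _] =
  [set w | (B \o behead) (mkseq (fun i => S i w) n.+1)]).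
  exact: measurable_history.
apply/seteqP; split => w /=; rewrite /trajectory /mkseq /=;
  by rewrite (iotaDl 1 0) -map_comp.
Qed.

Lemma measurable_start_trajectory n (B : H -> set (seq H)) :
  measurable [set w | B (S 0%N w) (trajectory n w)].
Proof.
rewrite (_ : [set w | _] =
  [set w | B (head x (mkseq (fun i => S i w) n.+1))
             (behead (mkseq (fun i => S i w) n.+1))]).
  exact: (measurable_history n.+1 (fun s => B (head x s) (behead s))).
apply/seteqP; split => w /=; rewrite /trajectory /mkseq /=;
  by rewrite (iotaDl 1 0) -map_comp.
Qed.

Definition cylinder (p : seq H) := [set w | S 0%N w = x /\ trajectory (size p) w = p].

Lemma cylinderE p :
  cylinder p = [set w | forall i, (i <= size p)%N -> S i w = nth x (x :: p) i].
Proof.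
apply/seteqP; split => w /=.
  move=> [S0 tp] [|i] //= ip; rewrite -[in RHS]tp nth_mkseq//.
move=> h; split; first exact: (h 0%N).
apply: (@eq_from_nth _ x); rewrite size_mkseq// => i ip.
by rewrite nth_mkseq//; apply: (h i.+1).
Qed.

Lemma measurable_cylinder p : measurable (cylinder p).
Proof.
exact: (measurable_start_trajectory (size p) (fun a s => a = x /\ s = p)).
Qed.

Lemma cylinder_rcons p y :
  (P (cylinder (rcons p y)) = P (cylinder p) * (srw_step R (last x p) y)%:E)%E.
Proof.
rewrite !cylinderE size_rcons.
have := srw_markov hS (size p) (nth x (x :: rcons p y)).
rewrite /= nth_rcons ltnn eqxx.
have -> : nth x (x :: rcons p y) (size p) = last x p.
  by rewrite -rcons_cons nth_rcons/= ltnSn -[in RHS]nth_last; case: (p).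
move=> ->; congr (P _ * _)%E; apply/seteqP; split => w /= h i ip;
  rewrite h//; case: i ip => //= i ip; by rewrite nth_rcons ip.
Qed.

Lemma probability_disjoint_sum (r : seq H) (D : H -> set T) (E : set T) :
  uniq r -> measurable E -> (forall y, measurable (D y)) ->
  (forall y, D y `<=` E) -> (forall y z, y != z -> D y `&` D z = set0) ->
  (\sum_(y <- r) P (D y) <= P E)%E.
Proof.
move=> ur mE mD DE dD.
suff [F [mF FE -> _]] : exists F : set T, [/\ measurable F, F `<=` E,
    (\sum_(y <- r) P (D y) = P F)%E & forall w, F w -> exists2 y, y \in r & D y w].
  by apply: le_measure; rewrite ?inE.
elim: r ur => [|y r IH] /=.
  by move=> _; exists set0; split => //; rewrite big_nil measure0.
move=> /andP[yr /IH[F [mF FE sF hF]]].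
exists (D y `|` F); split.
- exact: measurableU.
- by rewrite subUset.
- rewrite big_cons sF measureU//; apply/seteqP; split => w //= [Dyw /hF[z zr Dzw]].
  have yz : y != z by apply: contraNneq yr => ->.
  by rewrite -[False]/(set0 w) -(dD _ _ yz).
- move=> w [Dyw|/hF[z zr Dzw]]; first by exists y; rewrite // mem_head.
  by exists z; rewrite // in_cons zr orbT.
Qed.

(* Only an inequality is proved; applied to an event and to its complement, it
   forces equality in [srw_law]. *)
Lemma walkE_cylinder_le n p (A : pred (seq H)) :
  (P (cylinder p) * (walkE n (last x p) (fun q => (A q)%:R))%:E <=
   P [set w | cylinder p w /\ A (drop (size p) (trajectory (size p + n) w))])%E.
Proof.
elim: n p A => [|n IH] p A.
  rewrite /= addn0; case: (boolP (A [::])) => hA /=; last by rewrite mule0.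
  rewrite mule1 le_eqVlt; apply/orP; left; apply/eqP; congr (P _).
  apply/seteqP; split => w /=; last by case.
  by move=> h; split => //; rewrite drop_oversize ?hA// size_mkseq.
have Pfin B : measurable B -> P B = (fine (P B))%:E.
  by move=> mB; rewrite fineK// fin_num_measure.
set z := last x p.
pose E y := [set w | cylinder (rcons p y) w /\
  A (y :: drop (size (rcons p y)) (trajectory (size (rcons p y) + n) w))].
apply: (@le_trans _ _ (\sum_(y <- fset_set (neighbors z)) P (E y))%E).
  rewrite [walkE _ _ _]/= (Pfin _ (measurable_cylinder p)) -EFinM mulr_sumr mulr_sumr.
  rewrite -sumEFin big_seq [leRHS]big_seq; apply: lee_sum => y.
  rewrite mem_nbr// => zy.
  apply: le_trans (IH (rcons p y) (fun q => A (y :: q))).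
  rewrite last_rcons cylinder_rcons (Pfin _ (measurable_cylinder p)) -!EFinM.
  by rewrite lee_fin /srw_step -/z zy mulrA.
have mE (B : set (seq H)) q m :
    measurable [set w | cylinder q w /\ B (trajectory m w)].
  by apply: measurableI; [exact: measurable_cylinder|exact: measurable_trajectory].
apply: probability_disjoint_sum => //.
- exact: (mE (fun s => A (drop (size p) s))).
- by move=> y; exact: (mE (fun s => A (y :: drop (size (rcons p y)) s))).
- move=> y w [[S0 hp] hA]; rewrite size_rcons in hp hA.
  have ht : take (size p).+1 (trajectory (size p + n.+1) w) = rcons p y.
    by rewrite take_trajectory// addnS ltnS leq_addr.
  have ht2 : take (size p) (trajectory (size p + n.+1) w) = p.
    have := congr1 (take (size p)) ht; rewrite take_takel// => ->.
    by rewrite -cats1 take_size_cat.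
  split; first by split => //; rewrite -[RHS]ht2 take_trajectory// leq_addr.
  rewrite -(cat_take_drop (size p).+1 (trajectory (size p + n.+1) w)) ht.
  by rewrite -cats1 -catA drop_size_cat// addnS -addSn.
- move=> y y' yy'; apply/seteqP; split => w //= [[[_ h1] _] [[_ h2] _]].
  rewrite size_rcons in h1; rewrite size_rcons h1 in h2.
  have /(congr1 (last x)) := h2.
  by rewrite !last_rcons => e; rewrite e eqxx in yy'.
Qed.

Lemma srw_law n (A : pred (seq H)) :
  P [set w | A (trajectory n w)] = (walkE n x (fun q => (A q)%:R))%:E.
Proof.
have mA (B : set (seq H)) : measurable [set w | B (trajectory n w)].
  exact: measurable_trajectory.
have Pfin B : measurable B -> P B = (fine (P B))%:E.
  by move=> mB; rewrite fineK// fin_num_measure.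
have lb (B : pred (seq H)) :
    ((walkE n x (fun q => (B q)%:R))%:E <= P [set w | B (trajectory n w)])%E.
  have := walkE_cylinder_le n [::] B.
  have -> : P (cylinder [::]) = 1%E.
    rewrite -(srw_start hS); congr (P _).
    by apply/seteqP; split => w //= [].
  rewrite mul1e => /le_trans; apply; apply: le_measure.
  - rewrite inE; apply: measurableI; first exact: measurable_cylinder.
    exact: (measurable_trajectory (0 + n) (fun s => B (drop 0 s))).
  - by rewrite inE; exact: (mA (fun s => B s)).
  - by move=> w [_]; rewrite /= drop0.
have h1 := lb A; have h2 := lb (predC A).
have E : P [set w | predC A (trajectory n w)] = (1 - P [set w | A (trajectory n w)])%E.
  rewrite -probability_setC; last exact: (mA (fun s => A s)).
  by congr (P _); apply/seteqP; split => w /= /negP.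
rewrite E in h2.
have W : walkE n x (fun q => (predC A q)%:R) = 1 - walkE n x (fun q => (A q)%:R) :> R.
  have := walkEB Hlf n x (fun=> 1 : R) (fun q => (A q)%:R); rewrite walkE_cst// => <-.
  apply: (eq_walkE Hlf) => q _ _ /=.
  by case: (A q); rewrite ?subrr ?subr0.
rewrite W in h2; move: h1 h2; rewrite (Pfin _ (mA A)) -EFinB !lee_fin => h1 h2.
by congr (_%:E); apply/le_anti; rewrite h1 andbT; lra.
Qed.

Lemma srw_start_ae : {ae P, forall w, S 0%N w = x}.
Proof.
have m0 : measurable [set w | S 0%N w = x] by exact: srw_measurable hS 0%N x.
exists (~` [set w | S 0%N w = x]); split => //; first exact: measurableC.
by rewrite probability_setC// (srw_start hS) subee.
Qed.

Lemma srw_ae_of_walkE n (A : pred (seq H)) :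
  walkE n x (fun q => (A q)%:R) = 0 :> R -> {ae P, forall w, ~~ A (trajectory n w)}.
Proof.
move=> h; exists [set w | A (trajectory n w)]; split.
- exact: (measurable_trajectory n (fun s => A s)).
- by rewrite srw_law h.
- by move=> w /= /negP; rewrite negbK.
Qed.

Lemma srw_path_ae : {ae P, forall w, S 0%N w = x /\
  forall n, path (@adj H) x (trajectory n w)}.
Proof.
have h : {ae P, forall w, forall n, path (@adj H) x (trajectory n w)}.
  apply: ae_foralln => n.
  have [|B [mB B0 hB]] := @srw_ae_of_walkE n (predC (path (@adj H) x)).
    rewrite -[RHS](walkE_cst Hlf n x); apply: (eq_walkE Hlf) => q xq _.
    by rewrite /= xq.
  by exists B; split => // w hw; apply: hB => /=; rewrite negbK.
have := srw_start_ae; apply: filterS2 h => w h1 h2; split => //.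
Qed.

Lemma srw_borel_cantelli (A : nat -> pred (seq H)) (len : nat -> nat)
    (e : nat -> R) (M : R) :
  (forall i, walkE (len i) x (fun q => (A i q)%:R) <= e i) ->
  (forall n, \sum_(i < n) e i <= M) ->
  {ae P, forall w, exists N, forall i, (N <= i)%N -> ~~ A i (trajectory (len i) w)}.
Proof.
move=> hA hM; pose F i := [set w | A i (trajectory (len i) w)].
have mF i : measurable (F i) by exact: (measurable_trajectory (len i) (fun s => A i s)).
exists (lim_sup_set F); split.
- by apply: bigcap_measurable => // k _; exact: bigcup_measurable.
- apply: lim_sup_set_cvg0 => //; apply: (@le_lt_trans _ _ M%:E); last exact: ltry.
  apply: lime_le; first by apply: is_cvg_nneseries.
  apply: nearW => n; rewrite big_mkord.
  apply: (@le_trans _ _ (\sum_(i < n) (e i)%:E)%E); last by rewrite sumEFin lee_fin.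
  by apply: lee_sum => i _; rewrite [leLHS](srw_law (len i) (A i)) lee_fin.
- move=> w /= h k _; apply: contrapT => hk; apply: h; exists k => i ki.
  by apply/negP => hi; apply: hk; exists i.
Qed.

End Law.

(** * The time scales *)

Section Scales.
Context (R : realType).
Implicit Types (i n : nat) (x : R).

Lemma ln_le_sqrt4 x : 0 < x -> ln x <= 4 * Num.sqrt (Num.sqrt x).
Proof.
move=> x0; set s := Num.sqrt (Num.sqrt x).
have s0 : 0 < s by rewrite !sqrtr_gt0.
have xs : x = s ^+ 4.
  by rewrite -[4%N]/(2 * 2)%N exprM !sqr_sqrtr// ?sqrtr_ge0// ltW.
rewrite xs lnXn// -[leLHS]mulr_natl ler_pM2l//.
exact: ltW (ln_sublinear s0).
Qed.

Lemma ln_le_sqrt x : 0 < x -> ln x <= 2 * Num.sqrt x.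
Proof.
move=> x0; have s0 : 0 < Num.sqrt x by rewrite sqrtr_gt0.
rewrite -{1}(sqr_sqrtr (ltW x0)) lnXn// -[leLHS]mulr_natl ler_pM2l//.
exact: ltW (ln_sublinear s0).
Qed.

Lemma expRN_le x : 0 < x -> expR (- x) <= x^-1.
Proof.
move=> x0; rewrite expRN lef_pV2 ?posrE ?expR_gt0//.
by apply: le_trans (expR_ge1Dx x); rewrite lerDr.
Qed.

(** The terms are i^(-3/2), and 0 for i = 0. From i = 2 on they are compared with the telescoping
    differences of 2 / sqrt i. *)
Lemma sum_inv_pow32_le n :
  \sum_(i < n) Num.sqrt i%:R / i%:R ^+ 2 <= 3 :> R.
Proof.
case: n => [|[|n]]; rewrite ?big_ord0// ?big_ord_recl ?big_ord0.
  by rewrite sqrtr0 mul0r addr0.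
suff h : \sum_(i < n) Num.sqrt (bump 0 (bump 0 i))%:R / (bump 0 (bump 0 i))%:R ^+ 2 <=
    2 - 2 / Num.sqrt n.+1%:R :> R.
  rewrite /= sqrtr0 mul0r add0r sqrtr1 expr1n divr1.
  have : 0 <= 2 / Num.sqrt n.+1%:R :> R by rewrite divr_ge0// sqrtr_ge0.
  by move: h; move: (2 / _) => r; lra.
elim: n => [|n IH]; first by rewrite big_ord0 sqrtr1 divr1 subrr.
rewrite big_ord_recr/=; apply: (le_trans (lerD IH (lexx _))).
rewrite /bump/= !add1n.
pose y : R := Num.sqrt n.+2%:R; pose z : R := Num.sqrt n.+1%:R.
have y0 : 0 < y by rewrite sqrtr_gt0 ltr0n.
have z0 : 0 < z by rewrite sqrtr_gt0 ltr0n.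
have y2 : y * y = n.+2%:R by rewrite -expr2 sqr_sqrtr.
have z2 : z * z = n.+1%:R by rewrite -expr2 sqr_sqrtr.
have yz : y * y = z * z + 1 by rewrite y2 z2 natr1.
have zy : z <= y by rewrite ler_sqrt ?ler_nat.
rewrite -/y -/z -y2.
have -> : y / (y * y) ^+ 2 = y^-1 ^+ 3 by field; rewrite gt_eqF.
have h : y^-1 ^+ 3 <= 2 * (z^-1 - y^-1).
  have -> : z^-1 - y^-1 = (y * y - z * z) / (z * y * (y + z)).
    by field; rewrite !gt_eqF// addr_gt0.
  rewrite yz [z * z + 1]addrC addrK div1r exprVn.
  rewrite ler_pdivlMr ?mulr_gt0 ?addr_gt0// ler_pdivrMl ?exprn_gt0//.
  rewrite !exprS expr0 mulr1.
  have h1 : z * y <= y * y by rewrite ler_pM2r.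
  have h2 : z * y * (y + z) <= y * y * (y + y).
    by apply: ler_pM; rewrite ?mulr_ge0 ?addr_ge0 ?(ltW y0) ?(ltW z0)// lerD2l.
  by lra.
by rewrite -/y; move: h; move: (y^-1 ^+ 3) (z^-1) (y^-1) => a b c; lra.
Qed.

(* The observation times are [96 * base i], the lamplighter walk then makes at
   least [50 * base i] jumps, and each half of them consists of [25 * i ^ 3]
   blocks of length [i ^ 3 * scale i]. *)
Definition scale i : nat := Num.truncn (expR (i%:R / 1000) : R).
Definition base i : nat := (i ^ 3 * (i ^ 3 * scale i))%N.

Lemma baseE i : (base i)%:R = i%:R ^+ 6 * (scale i)%:R :> R.
Proof. by rewrite /base [LHS]natrM [X in _ * X]natrM natrX mulrA -exprD. Qed.

Lemma scale_le i : (scale i)%:R <= expR (i%:R / 1000) :> R.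
Proof. by rewrite truncn_le expR_ge0. Qed.

Lemma scale_gt i : expR (i%:R / 1000) < (scale i)%:R + 1 :> R.
Proof. by rewrite natr1 truncnS_gt. Qed.

Lemma near_scale (M : R) : \forall i \near \oo, M <= (scale i)%:R.
Proof.
near=> i; have h : 1000 * (`|M| + 1) <= i%:R by near: i; exact: nbhs_infty_ger.
have := scale_gt i; have := expR_ge1Dx (i%:R / 1000 : R); have := ler_norm M.
by move: h; move: (i%:R : R) (expR _) => I e; lra.
Unshelve. all: by end_near. Qed.

Lemma near_ln_scale :
  \forall i \near \oo, 999 / 1000 * (i%:R / 1000) <= ln (scale i)%:R :> R.
Proof.
near=> i; have h1 : 2 <= (scale i)%:R :> R by near: i; exact: near_scale.
have h2 : 1000 * 1000 <= i%:R :> R by near: i; exact: nbhs_infty_ger.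
have s0 : 0 < (scale i)%:R :> R by rewrite (lt_le_trans _ h1).
have h3 : expR (i%:R / 1000 - 1) <= (scale i)%:R :> R.
  rewrite expRB ler_pdivrMr ?expR_gt0//.
  have h4 : 2 <= expR 1 :> R by have := expR_ge1Dx (1 : R); lra.
  have h5 : (scale i)%:R * 2 <= (scale i)%:R * expR 1 :> R by rewrite ler_pM2l.
  by apply: le_trans h5; have := scale_gt i; lra.
rewrite -ler_ln ?posrE ?expR_gt0// expRK in h3.
by move: h2 h3; move: (i%:R : R) (ln _) => I l; lra.
Unshelve. all: by end_near. Qed.

Lemma near_ln_time :
  \forall i \near \oo, ln (96 * base i)%:R <= 1001 / 1000 * (i%:R / 1000) :> R.
Proof.
(* Once sqrt i >= M, the errors 6 ln i <= 12 sqrt i and ln 96 <= sqrt i add up to at most 13 sqrt i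
   <= i / 10^6. *)
have [M hM M0] : exists2 M : R, 13 * (1000 * 1000) <= M & 0 < M.
  by exists (13 * (1000 * 1000)); lra.
near=> i; have h1 : 2 <= (scale i)%:R :> R by near: i; exact: near_scale.
have h2 : M ^+ 2 <= i%:R :> R by near: i; exact: nbhs_infty_ger.
have s0 : 0 < (scale i)%:R :> R by rewrite (lt_le_trans _ h1).
have i0 : 0 < i%:R :> R by apply: lt_le_trans h2; rewrite exprn_gt0.
have -> : (96 * base i)%:R = 96 * (i%:R ^+ 6 * (scale i)%:R) :> R.
  by rewrite natrM baseE.
rewrite lnM ?posrE ?mulr_gt0 ?exprn_gt0//.
rewrite [X in _ + X]lnM ?posrE ?exprn_gt0// lnXn//.
have h3 : ln (scale i)%:R <= i%:R / 1000 :> R.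
  by rewrite -[leRHS]expRK ler_ln ?posrE ?expR_gt0// scale_le.
have h4 := ln_le_sqrt i0.
have h5 : ln 96 <= 96 :> R by rewrite ltW// ln_sublinear.
pose y : R := Num.sqrt i%:R.
have y2 : i%:R = y * y by rewrite -expr2 sqr_sqrtr// ltW.
have yM : M <= y.
  by rewrite -[leLHS](ger0_norm (ltW M0)) -sqrtr_sqr; exact: ler_wsqrtr.
rewrite -/y in h4; rewrite -[ln _ *+ 6]mulr_natr.
have h6 : 13 * (1000 * 1000) * y <= y * y.
  by rewrite ler_wpM2r ?sqrtr_ge0// (le_trans hM).
have {}yM := le_trans hM yM.
rewrite -y2 in h6; clearbody y.
by move: h3 h4 h5 yM h6; move: (i%:R : R) (ln _) (ln _) (ln _) => I a b c; lra.
Unshelve. all: by end_near. Qed.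

Lemma succ_pow6_le x : 1000 <= x -> (x + 1) ^+ 6 <= 101 / 100 * x ^+ 6.
Proof.
move=> hx; pose y := x * x; pose z := (x + 1) * (x + 1).
have h0 : 1000 * x <= y by rewrite ler_wpM2r//; lra.
have y0 : 0 <= y by lra.
have h1 : z <= 1003 / 1000 * y by rewrite /z; move: h0; rewrite /y; lra.
have z0 : 0 <= z by rewrite mulr_ge0//; lra.
have h2 : z * z <= (1003 / 1000 * y) * (1003 / 1000 * y) by exact: ler_pM.
have h3 : z * z * z <= (1003 / 1000 * y) * (1003 / 1000 * y) * (1003 / 1000 * y).
  by apply: ler_pM => //; exact: mulr_ge0.
have -> : (x + 1) ^+ 6 = z * z * z by rewrite /z; ring.
have -> : x ^+ 6 = y * y * y by rewrite /y; ring.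
have y3 : 0 <= y * y * y by exact: (mulr_ge0 (mulr_ge0 y0 y0) y0).
clearbody y z; lra.
Qed.

(** The power contributes at most 101/100, and the exponential, with its rounding, at most
    1003/1000. This ratio is the price of interpolating between observation times. *)
Lemma near_base_ratio :
  \forall i \near \oo, (base i.+1)%:R <= 102 / 100 * (base i)%:R :> R.
Proof.
near=> i.
have h1 : 1000 <= (scale i)%:R :> R by near: i; exact: near_scale.
have h2 : 1000 <= i%:R :> R by near: i; exact: nbhs_infty_ger.
have h4 := succ_pow6_le h2; rewrite natr1 in h4.
have i6 : 0 <= i%:R ^+ 6 :> R by rewrite exprn_ge0 ?ler0n.
have hJ : i.+1%:R / 1000 = i%:R / 1000 + 1 / 1000 :> R by rewrite -mulrDl natr1.
have h7 : expR (1 / 1000) <= 1 + 1 / 1000 + 2 * (1 / 1000) ^+ 2 :> R.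
  by apply: expR_le_quad; lra.
have h8 := scale_gt i; have h9 := scale_le i.+1; rewrite hJ expRD in h9.
have e0 : 0 <= expR (1 / 1000) :> R by exact: expR_ge0.
have e1 : 0 <= expR (i%:R / 1000) :> R by exact: expR_ge0.
have j6 : 0 <= i.+1%:R ^+ 6 :> R by rewrite exprn_ge0 ?ler0n.
have s1 : 0 <= (scale i.+1)%:R :> R by rewrite ler0n.
rewrite !baseE.
move: (i%:R ^+ 6) (i.+1%:R ^+ 6) (expR (1 / 1000)) (expR (i%:R / 1000)) (scale i)%:R
  (scale i.+1)%:R i6 h4 h7 h8 h9 e0 e1 h1 j6 s1 => a b c e u v.
move=> a0 ba hc eu ve c0 e0 hu b0 v0; clear -a0 ba hc eu ve c0 e0 hu b0 v0.
have h10 : e * c <= (u + 1) * (1 + 1 / 1000 + 2 * (1 / 1000) ^+ 2).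
  by apply: ler_pM => //; exact: ltW.
have h11 : v <= 1003 / 1000 * u by move: h10; rewrite expr2; lra.
apply: (@le_trans _ _ ((101 / 100 * a) * (1003 / 1000 * u))).
  exact: ler_pM.
have au : 0 <= a * u by rewrite mulr_ge0//; lra.
by lra.
Unshelve. all: by end_near. Qed.

End Scales.

(** * Visit counts of the walk on G at the time scales *)

Lemma leq_mulll a b m : (0 < a)%N -> (0 < b)%N -> (m <= a * (b * m))%N.
Proof. by move=> a0 b0; rewrite mulnA leq_pmull// muln_gt0 a0. Qed.

Lemma bernoulli_le (R : realDomainType) (u : R) (K : nat) : 0 <= u <= 1 ->
  1 - K%:R * u <= (1 - u) ^+ K.
Proof.
move=> /andP[u0 u1]; elim: K => [|K IH]; first by rewrite mul0r subr0 expr0.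
have h : (1 - u) * (1 - K%:R * u) <= (1 - u) ^+ K.+1.
  by rewrite exprS ler_wpM2l// subr_ge0.
apply: le_trans h; rewrite -natr1.
have : 0 <= K%:R * u * u by rewrite !mulr_ge0.
by move: (K%:R) => k; lra.
Qed.

(* The logarithm of [base i] is asymptotic to i / 1000. *)
Definition visits_level (R : realType) (rho : R) (i : nat) : R :=
  995 / 1000 * (25 * (base R i)%:R) * (rho / (i%:R / 1000)).

Lemma near_noret_scale (R : realType) (G : sgraph) (Glf : locally_finite G)
    (c C : R) (c0 : 0 < c) (C0 : 0 < C)
    (ret_bounds : forall n (x : G), (1 <= n)%N ->
      c <= n%:R * (ret R n x + ret R n.+1 x) <= C) : \forall i \near \oo, forall y : G,
  noret R (scale R i) y <= 3000 / (c * i%:R).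
Proof.
near=> i => y.
have h1 : 2 <= (scale R i)%:R :> R by near: i; exact: near_scale.
have h2 : 999 / 1000 * (i%:R / 1000) <= ln (scale R i)%:R :> R.
  by near: i; exact: near_ln_scale.
have i0 : 1 <= i%:R :> R by near: i; exact: nbhs_infty_ger.
have k1 : (1 < scale R i)%N by rewrite -(ltr_nat R); lra.
apply: (le_trans (noret_le Glf c0 ret_bounds y k1)).
have hI : 0 < i%:R :> R by rewrite (lt_le_trans _ i0).
have l0 : 0 < ln (scale R i)%:R :> R by rewrite ln_gt0// ltr1n.
rewrite ler_pdivrMr ?mulr_gt0// mulrAC ler_pdivlMr ?mulr_gt0//.
have : 2 * i%:R <= 3000 * ln (scale R i)%:R :> R.
  by move: h2 hI; move: (i%:R : R) (ln _) => I l; lra.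
by move/(ler_wpM2l (ltW c0)); move: (i%:R : R) (ln _) => I l; lra.
Unshelve. all: by end_near. Qed.

Lemma near_ln_block (R : realType) : \forall i \near \oo,
  (i <= i ^ 3 * scale R i)%N /\
  0 < ln ((i ^ 3 * scale R i)%:R : R) <= 1001 / 1000 * (i%:R / 1000 : R).
Proof.
near=> i.
have h1 : 2 <= (scale R i)%:R :> R by near: i; exact: near_scale.
have h2 : ln (96 * base R i)%:R <= 1001 / 1000 * (i%:R / 1000 : R).
  by near: i; exact: near_ln_time.
have i0n : (0 < i)%N by near: i; exact: nbhs_infty_gt.
have k1 : (1 < scale R i)%N by rewrite -(ltr_nat R); apply: lt_le_trans h1; rewrite ltr_nat.
have im : (i <= i ^ 3 * scale R i)%N.
  by rewrite expnS -mulnA leq_pmulr// muln_gt0 expn_gt0 i0n/= ltnW.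
split => //; apply/andP; split.
  by rewrite ln_gt0// ltr1n (leq_trans k1)// leq_pmull// expn_gt0 i0n.
apply: le_trans h2; rewrite ler_ln ?posrE ?ltr0n ?ler_nat.
- by apply: leq_mulll; rewrite // expn_gt0 i0n.
- by rewrite (leq_trans _ im).
- by rewrite !(expn_gt0, muln_gt0) i0n/= ltnW.
Unshelve. all: by end_near. Qed.

(** Three losses cost a factor 999/1000 each: the K [scale i] final steps given up, the probability
    of K quick returns, and the logarithm of the block length exceeding i / 1000. Their product is
    above 997/1000. *)
Lemma near_mean_visits (R : realType) (G : sgraph) (Glf : locally_finite G)
    (c C : R) (c0 : 0 < c) (C0 : 0 < C)
    (ret_bounds : forall n (x : G), (1 <= n)%N ->
      c <= n%:R * (ret R n x + ret R n.+1 x) <= C)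
    (rho : R) (rho0 : 0 < rho)
    (noret_ge : exists N, forall t (x : G), (N <= t)%N ->
      rho / ln t%:R <= noret R t x) K : \forall i \near \oo, forall y : G,
  997 / 1000 * (rho / (i%:R / 1000)) * (i ^ 3 * scale R i)%:R <=
  walkE (i ^ 3 * scale R i) y (fun p => (nvisits K.+1 p)%:R).
Proof.
have [N hN] := noret_ge.
near=> i => y.
have h1 : 2 <= (scale R i)%:R :> R by near: i; exact: near_scale.
have [im /andP[lm0 lm]] : (i <= i ^ 3 * scale R i)%N /\
  0 < ln ((i ^ 3 * scale R i)%:R : R) <= 1001 / 1000 * (i%:R / 1000 : R).
  by near: i; exact: near_ln_block.
have i0 : 1 <= i%:R :> R by near: i; exact: nbhs_infty_ger.
have iN : (N <= i)%N by near: i; exact: nbhs_infty_ge.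
have iK : 1000 * K%:R <= i%:R :> R by near: i; exact: nbhs_infty_ger.
have hIu : 1000 * (K.+1%:R * 3000) / c <= i%:R by near: i; exact: nbhs_infty_ger.
have hu : forall y : G, noret R (scale R i) y <= 3000 / (c * i%:R).
  by near: i; exact: near_noret_scale ret_bounds.
have hI : 0 < i%:R :> R by rewrite (lt_le_trans _ i0).
have i0n : (0 < i)%N by rewrite -(ltr_nat R).
have k1 : (1 < scale R i)%N.
  by rewrite -(ltr_nat R); apply: lt_le_trans h1; rewrite ltr_nat.
set m := (i ^ 3 * scale R i)%N in im lm0 lm *; set u := 3000 / (c * i%:R) in hu.
have u0 : 0 <= u by rewrite /u divr_ge0 ?mulr_ge0 ?ler0n ?(ltW c0).
have Ku : K.+1%:R * u <= 1 / 1000.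
  rewrite ler_pdivrMr// in hIu.
  rewrite /u mulrA ler_pdivrMr ?mulr_gt0//.
  by clear -hIu; lra.
have u1 : u <= 1 / 1000.
  apply: le_trans Ku; rewrite -natr1 mulrDl mul1r lerDr mulr_ge0//.
have g0 : 0 < i%:R / 1000 :> R by clear -hI; lra.
set g := i%:R / 1000 in g0 lm *.
have gp : 0 < 1001 / 1000 * g by clear -g0; lra.
have hv (z : G) : rho / (1001 / 1000 * g) <= noret R m z.
  apply: le_trans; last exact: (hN m z (leq_trans iN im)).
  rewrite (ler_pM2l rho0) lef_pV2; first exact: lm.
    by rewrite posrE; exact: gp.
  by rewrite posrE.
have v0 : 0 <= rho / (1001 / 1000 * g) by exact: divr_ge0 (ltW rho0) (ltW gp).
have u01 : 0 <= u <= 1 by apply/andP; split => //; clear -u1; lra.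
apply: le_trans (walkE_nvisits_ge Glf K y u01 v0 hu hv).
have m0 : 0 <= m%:R :> R by rewrite ler0n.
have hm : (999 / 1000) * m%:R <= (m - K * scale R i)%:R :> R.
  have hK : 1000 * (K * scale R i)%:R <= m%:R :> R.
    rewrite /m [X in _ * X]natrM [leRHS]natrM natrX mulrA ler_wpM2r ?ler0n//.
    by apply: (le_trans iK); rewrite -[leLHS]expr1; apply: ler_weXn2l.
  have K0 : 0 <= (K * scale R i)%:R :> R by rewrite ler0n.
  rewrite natrB; first by clear -hK K0; lra.
  by rewrite -(ler_nat R); clear -hK K0; lra.
have hp : 999 / 1000 <= (1 - u) ^+ K.
  apply: le_trans (bernoulli_le K u01).
  have h : K%:R * u <= K.+1%:R * u by rewrite ler_wpM2r// ler_nat.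
  by clear -Ku h; lra.
have r0 : 0 <= rho / g by exact: divr_ge0 (ltW rho0) (ltW g0).
have hr : 999 / 1000 * (rho / g) <= rho / (1001 / 1000 * g).
  rewrite ler_pdivlMr//; have -> : 999 / 1000 * (rho / g) * (1001 / 1000 * g) =
    (999 / 1000) * (1001 / 1000) * rho by clear -g0; field; rewrite gt_eqF.
  by clear -rho0; lra.
apply: (@le_trans _ _ ((999 / 1000 * m%:R) * (999 / 1000 * (999 / 1000 * (rho / g))))).
  have h := mulr_ge0 m0 r0; clear -h; lra.
apply: ler_pM; [by clear -m0; lra|by clear -r0; lra|exact: hm|].
by apply: ler_pM; [clear; lra|clear -r0; lra|exact: hp|exact: hr].
Unshelve. all: by end_near. Qed.

Lemma near_ln_scale_inv (R : realType) (c : R) : 0 < c ->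
  \forall i \near \oo, (1 < scale R i)%N /\
    2 / (c * ln (scale R i)%:R) <= 3000 / (c * i%:R).
Proof.
move=> c0; near=> i.
have h1 : 2 <= (scale R i)%:R :> R by near: i; exact: near_scale.
have h2 : 999 / 1000 * (i%:R / 1000) <= ln (scale R i)%:R :> R.
  by near: i; exact: near_ln_scale.
have i0 : 1 <= i%:R :> R by near: i; exact: nbhs_infty_ger.
have k1 : (1 < scale R i)%N.
  by rewrite -(ltr_nat R); apply: lt_le_trans h1; rewrite ltr_nat.
have hI : 0 < i%:R :> R by rewrite (lt_le_trans _ i0).
have l0 : 0 < ln (scale R i)%:R :> R by rewrite ln_gt0// ltr1n.
split => //; rewrite ler_pdivrMr ?mulr_gt0// mulrAC ler_pdivlMr ?mulr_gt0//.
have h : 2 * i%:R <= 3000 * ln (scale R i)%:R :> R by clear -h2 hI; lra.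
have := ler_wpM2l (ltW c0) h; clear; lra.
Unshelve. all: by end_near. Qed.

Lemma tail_exponentE (R : realType) (h f rho I : R) : h != 0 -> 0 < I ->
  (1 / h) ^+ 2 / 8 * (25 * I ^+ 3) * (f * (rho / (I / h))) =
  1 / h * (25 / 8) * f * (rho * I ^+ 2).
Proof. by move=> h0 I0; field; rewrite h0 gt_eqF. Qed.

Lemma natr_mulX (R : realType) (a n i : nat) :
  (a * i ^ n)%:R = a%:R * i%:R ^+ n :> R.
Proof. by rewrite natrM natrX. Qed.

(** The bound of [nvisits_half_tail] for 25 i^3 blocks of length i^3 k, with I = i and s = i^(1/4);
    h, f, U, V stand for 1000, 997/1000, 3000 / c and 53. The dominant term comes from w and has
    order s / I. *)
Lemma half_tail_arith (R : realType) (h f U V C rho I s k w be : R) :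
  0 < h -> 0 < f -> 0 < U -> 0 < V -> 0 < C -> 0 < rho ->
  1 <= I -> 1 <= s -> 0 < k ->
  w = U / I * (C * (U / I) * (V * s) + C / I) ->
  be = 1 / h * (25 * (I ^+ 6 * k)) * (rho / (I / h)) ->
  expR (- ((1 / h) ^+ 2 / 8 * (25 * I ^+ 3) * (f * (rho / (I / h))))) +
    be^-1 * (25 * I ^+ 3 * (k + I ^+ 3 * k * w)) <=
  (h / (25 / 8 * f * rho) + 1 / rho + U * C / rho * (U * V + 1)) * (s / I).
Proof.
move=> h0 f0 U0 V0 C0 rho0 I1 s1 k0 -> ->.
have I0 : 0 < I by rewrite (lt_le_trans _ I1).
have s0 : 0 < s by rewrite (lt_le_trans _ s1).
have e1 : (1 / h * (25 * (I ^+ 6 * k)) * (rho / (I / h)))^-1 *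
     (25 * I ^+ 3 * (k + I ^+ 3 * k * (U / I *
       (C * (U / I) * (V * s) + C / I)))) =
    1 / (rho * I ^+ 2) + U * C / rho * (U * V * (s / I) + 1 / I).
  by field; rewrite !gt_eqF.
have h2 : 1 / I <= s / I by rewrite ler_pM2r ?invr_gt0.
have h1 : 1 / (rho * I ^+ 2) <= 1 / rho * (s / I).
  have -> : 1 / (rho * I ^+ 2) = 1 / rho * (1 / I * (1 / I)).
    by field; rewrite !gt_eqF.
  rewrite ler_wpM2l ?divr_ge0 ?ler01 ?(ltW rho0)//.
  apply: le_trans h2; rewrite ler_piMr ?divr_ge0 ?ler01 ?(ltW I0)//.
  by rewrite ler_pdivrMr// mul1r.
have p0 : 0 < 1 / h * (25 / 8) * f * (rho * I ^+ 2).
  apply: mulr_gt0; last by rewrite mulr_gt0 ?exprn_gt0.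
  by apply: mulr_gt0 => //; rewrite mulr_gt0 ?divr_gt0 ?ltr0n ?ltr01.
have h3 : expR (- ((1 / h) ^+ 2 / 8 * (25 * I ^+ 3) * (f * (rho / (I / h)))))
    <= h / (25 / 8 * f) * (1 / rho * (s / I)).
  rewrite (tail_exponentE _ _ (lt0r_neq0 h0) I0).
  apply: (le_trans (expRN_le p0)).
  have -> : (1 / h * (25 / 8) * f * (rho * I ^+ 2))^-1 =
      h / (25 / 8 * f) * (1 / (rho * I ^+ 2)).
    by field; rewrite !gt_eqF.
  by rewrite ler_wpM2l// divr_ge0 ?mulr_ge0 ?ltW.
rewrite e1.
have q0 : 0 <= U * C / rho by rewrite divr_ge0 ?mulr_ge0 ?ltW.
have h4 : U * C / rho * (U * V * (s / I) + 1 / I) <=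
    U * C / rho * ((U * V + 1) * (s / I)).
  by rewrite ler_wpM2l// [leRHS]mulrDl [X in _ <= _ + X]mul1r lerD2l.
have -> : (h / (25 / 8 * f * rho) + 1 / rho + U * C / rho * (U * V + 1)) * (s / I) =
  h / (25 / 8 * f) * (1 / rho * (s / I)) +
  (1 / rho * (s / I) + U * C / rho * ((U * V + 1) * (s / I))).
  by field; rewrite !gt_eqF.
by rewrite !lerD.
Qed.

Lemma visits_tail (R : realType) (G : sgraph) (Glf : locally_finite G)
    (c C : R) (c0 : 0 < c) (C0 : 0 < C)
    (ret_bounds : forall n (x : G), (1 <= n)%N ->
      c <= n%:R * (ret R n x + ret R n.+1 x) <= C)
    (rho : R) (rho0 : 0 < rho)
    (noret_ge : exists N, forall t (x : G), (N <= t)%N ->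
      rho / ln t%:R <= noret R t x) (K : nat) :
  exists C' : R, \forall i \near \oo, forall x : G,
    walkE (50 * base R i) x
      (fun p => ((nvisits K.+1 p)%:R <= visits_level rho i)%R%:R) <=
    C' * (Num.sqrt i%:R / i%:R ^+ 2).
Proof.
have [h hE h0] : exists2 h : R, h = 1000 & 0 < h by exists 1000; rewrite ?ltr0n.
have [f fE f0] : exists2 f : R, f = 997 / 1000 & 0 < f.
  by exists (997 / 1000); rewrite ?divr_gt0 ?ltr0n.
have [U UE U0] : exists2 U : R, U = 3000 / c & 0 < U.
  by exists (3000 / c); rewrite ?divr_gt0 ?ltr0n.
pose C2 := h / (25 / 8 * f * rho) + 1 / rho + U * C / rho * (U * 53 + 1).
exists (C2 ^+ 2); near=> i => x.
have [k1 hlk] : (1 < scale R i)%N /\ 2 / (c * ln (scale R i)%:R) <= 3000 / (c * i%:R).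
  by near: i; exact: near_ln_scale_inv.
have i1 : 1 <= i%:R :> R by near: i; exact: nbhs_infty_ger.
have hmean : forall y : G,
    f * (rho / (i%:R / h)) * (i ^ 3 * scale R i)%:R <=
    walkE (i ^ 3 * scale R i) y (fun p => (nvisits K.+1 p)%:R).
  by rewrite hE fE; near: i; exact: (near_mean_visits Glf c0 C0 ret_bounds rho0 noret_ge K).
set I : R := i%:R in i1 hlk hmean *; set k := scale R i in k1 hlk hmean *.
have I0 : 0 < I by rewrite (lt_le_trans _ i1).
have i0 : (0 < i)%N by rewrite -(ltr_nat R).
have k0 : 0 < k%:R :> R by rewrite ltr0n ltnW.
pose s : R := Num.sqrt (Num.sqrt I).
have s1 : 1 <= s.
  by rewrite -[leLHS](sqrtr1 R) ler_wsqrtr// -[leLHS](sqrtr1 R) ler_wsqrtr.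
pose w := U / I * (C * (U / I) * (53 * s) + C / I).
(* [be] is the allowance for the excess. The levels fit together because 995/1000 + 1/1000 <= (1 -
   1/1000) * 997/1000. *)
pose be := 1 / h * (25 * (I ^+ 6 * k%:R)) * (rho / (I / h)).
have UI : 3000 / (c * I) = U / I by rewrite UE invfM mulrA.
have w0 : 0 <= w.
  have UI0 : 0 <= U / I by rewrite divr_ge0 ?ltW.
  have s0 : 0 <= 53 * s by rewrite mulr_ge0 ?ler0n ?sqrtr_ge0.
  apply: mulr_ge0 => //; apply: addr_ge0; last by rewrite divr_ge0 ?ltW.
  by apply: mulr_ge0 => //; apply: mulr_ge0 => //; exact: ltW.
pose l := (25 * i ^ 3)%N; pose m := (i ^ 3 * k)%N.
have lE : l%:R = 25 * I ^+ 3 :> R by exact: (natr_mulX R 25 3 i).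
have mE : m%:R = I ^+ 3 * k%:R :> R by rewrite /m mulnC natr_mulX mulrC.
have m0 : (0 < m)%N by rewrite muln_gt0 expn_gt0 i0/= ltnW.
have hw (y : G) : noret R k y - noret R (l * m) y <= w.
  have klm : (k <= l * m)%N.
    apply: leq_trans (_ : k <= m)%N _; first by rewrite leq_pmull// expn_gt0 i0.
    by rewrite leq_pmull// muln_gt0 expn_gt0 i0.
  (* The free parameter q is taken to be i: the term C / q becomes C / i, and the logarithm is that
     of 25 i^7. *)
  apply: (le_trans (noretB_le Glf c0 C0 ret_bounds y k1 klm i0)).
  set e := 2 / _ in hlk *; rewrite UI in hlk.
  have e0 : 0 <= e.
    by rewrite /e divr_ge0 ?mulr_ge0 ?ler0n ?(ltW c0) ?ln_ge0 ?ler1n ?(ltW k1)// ltnW.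
  (* 53 = 25 + 7 * 4, from ln 25 <= 25 and ln i <= 4 s. *)
  have hL : ln ((i * (l * m))%:R / k%:R) <= 53 * s.
    have -> : (i * (l * m))%:R / k%:R = 25 * I ^+ 7 :> R.
      rewrite [X in X / _]natrM [X in _ * X / _]natrM lE mE -/I.
      by field; rewrite gt_eqF.
    rewrite lnM ?posrE ?exprn_gt0 ?ltr0n// lnXn// -[X in _ + X]mulr_natr.
    have h1 : ln I <= 4 * s by exact: ln_le_sqrt4.
    have h2 : ln 25 <= 25 :> R by rewrite ltW// ln_sublinear// ltr0n.
    by clear -h1 h2 s1; lra.
  have L0 : 0 <= ln ((i * (l * m))%:R / k%:R) :> R.
    rewrite ln_ge0// ler_pdivlMr// mul1r ler_nat.
    by rewrite (leq_trans klm)// leq_pmull.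
  have CI : 0 <= C / I by rewrite divr_ge0 ?ltW.
  apply: ler_pM => //.
    apply: addr_ge0 => //; apply: mulr_ge0 => //.
    by apply: mulr_ge0 => //; exact: ltW.
  rewrite lerD2r; apply: ler_pM => //; first by apply: mulr_ge0 => //; exact: ltW.
  by apply: ler_wpM2l => //; exact: ltW.
pose mu := f * (rho / (I / h)).
have r0 : 0 < rho / (I / h) by rewrite !divr_gt0.
have b0 : 0 < 25 * (I ^+ 6 * k%:R).
  by apply: mulr_gt0; [rewrite ltr0n|apply: mulr_gt0 => //; exact: exprn_gt0].
have mu0 : 0 <= mu by rewrite /mu mulr_ge0 ?ltW.
have be0 : 0 < be.
  by rewrite /be; apply: mulr_gt0 => //; apply: mulr_gt0 => //; exact: divr_gt0.
have e01 : 0 < 1 / h <= 1.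
  apply/andP; split; first exact: divr_gt0.
  by rewrite ler_pdivrMr// mul1r hE; clear; lra.
have bE : visits_level rho i = 995 / 1000 * (25 * (I ^+ 6 * k%:R)) * (rho / (I / h)).
  by rewrite /visits_level baseE hE.
have hb : visits_level rho i + be <= (1 - 1 / h) * l%:R * mu * m%:R.
  rewrite bE /be /mu lE mE.
  have -> : (1 - 1 / h) * (25 * I ^+ 3) * (f * (rho / (I / h))) * (I ^+ 3 * k%:R) =
    (1 - 1 / h) * f * (25 * (I ^+ 6 * k%:R) * (rho / (I / h))).
    by ring.
  have q0 : 0 <= 25 * (I ^+ 6 * k%:R) * (rho / (I / h)).
    by apply: ltW; apply: mulr_gt0.
  rewrite -[995 / 1000 * _ * _]mulrA -[1 / h * _ * _]mulrA -mulrDl ler_wpM2r//.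
  by rewrite hE fE; clear; lra.
have half (y : G) : walkE (l * m) y
    (fun p => ((nvisits K.+1 p)%:R <= visits_level rho i)%R%:R) <= C2 * (s / I).
  apply: (le_trans (nvisits_half_tail Glf y m0 e01 mu0 w0 be0 hmean hw hb)).
  rewrite lE mE /mu.
  by apply: (half_tail_arith h0 f0 U0 _ C0 rho0 i1 s1 k0); rewrite ?ltr0n.
have -> : (50 * base R i = l * m + l * m)%N.
  by rewrite /base -/k /l /m -mulnA -mulnDl.
apply: (le_trans (nvisits_double_tail Glf x half)).
rewrite exprMn ler_wpM2l ?sqr_ge0// expr_div_n -/I.
by rewrite sqr_sqrtr ?sqrtr_ge0.
Unshelve. all: by end_near. Qed.

(** * Failure events for the lower bound *)

Lemma flip_parity_mixing (R : realType) (G : sgraph) (D : nat) (delta : R) :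
  (forall x : G, (deg x <= D)%N) -> 0 < delta ->
  exists K, forall z : G, (1 - 2 * flip_prob R z) ^+ K <= delta.
Proof.
move=> hD d0; pose a : R := 2 / D.+2%:R.
have a0 : 0 < a by rewrite divr_gt0 ?ltr0n.
pose K := Num.bound (1 / (delta * a)); exists K.+1 => z.
have ha : a <= 2 * flip_prob R z.
  by rewrite /a ler_pM2l ?ltr0n// lef_pV2 ?posrE ?ltr0n// ler_nat !ltnS.
have /andP[f0 f1] := flip_prob_bounds R z.
have h0 : 0 <= 1 - 2 * flip_prob R z by clear -f1; lra.
have h1 : 1 - 2 * flip_prob R z <= expR (- a).
  by apply: le_trans (expR_ge1Dx _); clear -ha; lra.
apply: (@le_trans _ _ (expR (- a) ^+ K.+1)).
  by apply: lerXn2r => //; rewrite nnegrE ?expR_ge0.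
rewrite -expRM_natl mulrN.
have p0 : 0 < K.+1%:R * a by rewrite mulr_gt0 ?ltr0n.
apply: (le_trans (expRN_le p0)).
rewrite invf_ple ?posrE//.
have hK : 1 / (delta * a) < K.+1%:R.
  have h := archi_boundP (ltW (divr_gt0 ltr01 (mulr_gt0 d0 a0))).
  by apply: (lt_trans h); rewrite ltr_nat.
move: hK; rewrite ltr_pdivrMr ?mulr_gt0// => hK.
rewrite -[leLHS]div1r ler_pdivrMr//; apply/ltW; apply: (lt_le_trans hK).
by rewrite mulrA [_ * delta * a]mulrAC.
Qed.

Lemma expRN_le4 (R : realType) (x : R) : 0 < x -> expR (- x) <= 24 / x ^+ 4.
Proof.
move=> x0; rewrite expRN -[leLHS]div1r ler_pdivrMr ?expR_gt0//.
have h := @expR_ge1Dxn R x 3 (ltW x0).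
rewrite mulrAC ler_pdivlMr ?exprn_gt0// mul1r.
have -> : 24 = (4`!)%:R :> R by [].
rewrite mulrC -ler_pdivrMr ?ltr0n//.
by apply: le_trans h; rewrite lerDr.
Qed.

Lemma interpolate (f : nat -> nat) (N n : nat) : (forall i, (i <= f i)%N) ->
  (f N <= n)%N -> exists i, [/\ (N <= i)%N, (f i <= n)%N & (n <= f i.+1)%N].
Proof.
move=> hf fNn; pose P i := (N <= i)%N && (f i <= n)%N.
have exP : exists i, P i by exists N; rewrite /P leqnn.
have bP i : P i -> (i <= n)%N by move=> /andP[_ h]; rewrite (leq_trans (hf i)).
case: (ex_maxnP exP bP) => i /andP[Ni fi] imax; exists i; split => //.
rewrite leqNgt; apply/negP => h.
have := imax i.+1; rewrite /P (leq_trans Ni)// ltnW// => /(_ isT).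
by rewrite ltnn.
Qed.

Lemma scale_gt0 (R : realType) i : (0 < scale R i)%N.
Proof.
rewrite /scale truncn_gt0; apply: le_trans (expR_ge1Dx _).
by rewrite lerDl divr_ge0 ?ler0n.
Qed.

Lemma base_ge (R : realType) i : (i <= base R i)%N.
Proof.
have hs := scale_gt0 R i; rewrite /base; case: i hs => [//|i] hs.
by rewrite expnS -mulnA leq_pmulr// !(expn_gt0, muln_gt0).
Qed.

Lemma time_ge (R : realType) i : (i <= 96 * base R i)%N.
Proof. by apply: (leq_trans (base_ge R i)); rewrite leq_pmull. Qed.

Section LowerEvents.
Context (R : realType) (G : sgraph).
Implicit Types (x : lamplighter G) (q : seq (lamplighter G)) (i n K : nat) (rho : R).

Definition few_visits rho K x i q : bool :=
  (nvisits K.+1 (jumps x.2 q))%:R <= visits_level rho i.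

(** The number of changed lamps is not monotone in time, so this event runs over all times up to the
    next observation time. The visit count is monotone, and for it the observation times suffice. *)
Definition few_lamps rho K x i q : bool :=
  has (fun n =>
    (#|` lamp_diff x.1 (last x (take n q)).1|
       <= Num.truncn (499 / 1000 * visits_level rho i)%R)%N &&
    (Num.truncn (visits_level rho i) <= nvisits K.+1 (jumps x.2 (take n q)))%N)
  (iota 0 (96 * base R i.+1).+1).

End LowerEvents.

(** Either there are fewer than 50 [base i] jumps, which is exponentially unlikely, or the first 50
    [base i] jumps are compared with the walk on G. *)
Lemma few_visits_prob (R : realType) (G : sgraph) (Glf : locally_finite G)
    (deg1_nbr : forall x y : G, adj x y -> (deg x <= 1)%N -> (2 <= deg y)%N)
    (rho : R) (K : nat) (C' : R)
    (htail : \forall i \near \oo, forall x : G,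
      walkE (50 * base R i) x
        (fun p => ((nvisits K.+1 p)%:R <= visits_level rho i)%R%:R) <=
      C' * (Num.sqrt i%:R / i%:R ^+ 2)) (x : lamplighter G) :
  \forall i \near \oo,
    walkE (96 * base R i) x (fun q => (few_visits rho K x i q)%:R) <=
    (C' + 120) * (Num.sqrt i%:R / i%:R ^+ 2).
Proof.
have Hlf := lamplighter_lf Glf; case: x => eta x.
near=> i.
have i1 : 1 <= i%:R :> R by near: i; exact: nbhs_infty_ger.
have ht : forall x : G, walkE (50 * base R i) x
        (fun p => ((nvisits K.+1 p)%:R <= visits_level rho i)%R%:R) <=
      C' * (Num.sqrt i%:R / i%:R ^+ 2) by near: i.
pose f (p : seq G) : R := ((nvisits K.+1 p)%:R <= visits_level rho i)%R%:R.
apply: (@le_trans _ _ (walkE (96 * base R i) ((eta, x) : lamplighter G) (fun q =>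
    (size (jumps x q) < 50 * base R i)%N%:R +
    (50 * base R i <= size (jumps x q))%N%:R * f (jumps x q)))).
  apply: (ler_walkE Hlf) => q _ _; rewrite /few_visits -/(f (jumps x q)).
  have f1 : f (jumps x q) <= 1 by rewrite /f lern1 leq_b1.
  have f0 : 0 <= f (jumps x q) by rewrite /f ler0n.
  by case: ltnP => _; rewrite ?mul0r ?addr0 ?mul1r ?add0r.
rewrite walkED// [leRHS]mulrDl addrC lerD//.
  apply: (le_trans (walkE_jumps_ge Glf _ _ _ _ _ _)).
  - by move=> p; rewrite /f ler0n.
  - move=> p p'; rewrite /f ler_nat; case: (boolP (_ <= visits_level _ _)) => // h.
    by rewrite (le_trans _ h)// ler_nat nvisits_cat_l.
  - exact: ht.
apply: (le_trans (@jump_count_tail R G Glf deg1_nbr (base R i) (eta, x))).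
have I0 : 0 < i%:R :> R by rewrite (lt_le_trans _ i1).
have b0 : 0 < (base R i)%:R :> R.
  by rewrite (lt_le_trans I0)// ler_nat base_ge.
have p0 : 0 < (base R i)%:R / 120 :> R.
  by apply: divr_gt0; [exact: b0|rewrite ltr0n].
apply: (le_trans (expRN_le p0)); rewrite invf_div ler_pM2l ?ltr0n//.
apply: (@le_trans _ _ (i%:R ^+ 2)^-1).
  rewrite lef_pV2 ?posrE ?exprn_gt0// baseE -[leLHS]mulr1.
  apply: ler_pM; rewrite ?exprn_ge0 ?ler01 ?(ltW I0)//.
    exact: ler_weXn2l.
  by rewrite ler1n scale_gt0.
rewrite -[leLHS]mul1r ler_wpM2r ?invr_ge0 ?exprn_ge0 ?(ltW I0)//.
by rewrite -[leLHS](sqrtr1 R) ler_wsqrtr.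
Unshelve. all: by end_near. Qed.

(** The factor n1 occurs twice, from the union over the times and from the union over the number of
    jumps. The fourth power in [expRN_le4] turns I^12 k^2 into I^(-8) k^(-2). *)
Lemma lamp_tail_arith (R : realType) (c k I v n1 : R) : 0 < c -> 1 <= I -> 1 <= k ->
  c * (I ^+ 5 * k) <= v -> 0 <= n1 -> n1 <= 100 * (I ^+ 6 * k) ->
  n1 * (n1 * expR (1 - v)) <= (100 ^+ 2 * expR 1 * 24 / c ^+ 4) * (I ^+ 2)^-1.
Proof.
move=> c0 I1 k1 hv n0 hn.
have I0 : 0 < I by rewrite (lt_le_trans _ I1).
have k0 : 0 < k by rewrite (lt_le_trans _ k1).
have p0 : 0 < c * (I ^+ 5 * k) by rewrite !mulr_gt0 ?exprn_gt0.
have v0 : 0 < v by rewrite (lt_le_trans p0).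
have h1 : expR (1 - v) <= expR 1 * (24 / (c * (I ^+ 5 * k)) ^+ 4).
  rewrite expRD ler_pM2l ?expR_gt0//.
  apply: (@le_trans _ _ (expR (- (c * (I ^+ 5 * k))))).
    by rewrite ler_expR lerN2.
  exact: expRN_le4.
have h2 : n1 * n1 <= (100 * (I ^+ 6 * k)) * (100 * (I ^+ 6 * k)) by apply: ler_pM.
rewrite mulrA; apply: (le_trans (ler_pM _ _ h2 h1)).
- exact: mulr_ge0.
- exact: expR_ge0.
have -> : 100 * (I ^+ 6 * k) * (100 * (I ^+ 6 * k)) *
   (expR 1 * (24 / (c * (I ^+ 5 * k)) ^+ 4)) =
   (100 ^+ 2 * expR 1 * 24 / c ^+ 4) * ((I ^+ 8 * k ^+ 2)^-1).
  by field; rewrite !gt_eqF.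
rewrite ler_wpM2l ?divr_ge0 ?mulr_ge0 ?exprn_ge0 ?expR_ge0 ?ler0n ?(ltW c0)//.
rewrite lef_pV2 ?posrE ?mulr_gt0 ?exprn_gt0// -[leLHS]mulr1.
apply: ler_pM; rewrite ?exprn_ge0 ?ler01 ?(ltW I0)//.
  exact: ler_weXn2l.
by rewrite -(expr1n R 2) lerXn2r ?nnegrE ?ler01 ?(ltW k0).
Qed.

(** Half of (1 - 1/2000) (1 - 1/1000) exceeds 499/1000 by more than 1/4000. This margin times s
    gives the decay; the rounding of a and b' is absorbed by the summand 1. *)
Lemma lamp_exponent (R : realType) (s b t delta a b' : R) :
  s = 1 / 4000 -> t = expR (- s) -> delta = 1 / 1000 ->
  a <= 499 / 1000 * b -> b <= b' + 1 -> 0 <= b' ->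
  s * (a + 1) - (1 - t) * (1 - delta) / 2 * b' <= 1 - b / 4000 / 4000.
Proof.
move=> sE tE dE ha hb b'0.
have h1 : t <= 1 + - s + 2 * (- s) ^+ 2.
  by rewrite tE; apply: expR_le_quad; clear -sE; lra.
have h2 : 1 / 4000 * (1 - 1 / 2000) <= 1 - t.
  by move: h1; rewrite expr2 sE; clear; lra.
have h3 : (1 / 4000 * (1 - 1 / 2000)) * b' <= (1 - t) * b' by exact: ler_wpM2r.
rewrite sE dE; move: h3; move: ((1 - t)) => z h3; clear -ha hb b'0 h3; lra.
Qed.

Lemma lamp_weight_le (R : realType) (s b t delta : R) (a b' : nat) :
  s = 1 / 4000 -> t = expR (- s) -> delta = 1 / 1000 ->
  a%:R <= 499 / 1000 * b -> b <= b'%:R + 1 ->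
  t^-1 ^+ a.+1 * ((1 + t) / 2 + delta * ((1 - t) / 2)) ^+ b' <=
  expR (1 - b / 4000 / 4000).
Proof.
move=> sE tE dE ha hb.
have t0 : 0 < t by rewrite tE expR_gt0.
have t1 : t <= 1 by rewrite tE expR_le1 sE; clear; lra.
have -> : t^-1 ^+ a.+1 = expR (s * (a%:R + 1)).
  by rewrite tE -expRN opprK -expRM_natl natr1 mulrC.
have hr : (1 + t) / 2 + delta * ((1 - t) / 2) <= expR (- ((1 - t) * (1 - delta) / 2)).
  by apply: le_trans (expR_ge1Dx _); clear; lra.
have r0 : 0 <= (1 + t) / 2 + delta * ((1 - t) / 2).
  by rewrite dE; clear -t0 t1; lra.
apply: (@le_trans _ _ (expR (s * (a%:R + 1)) * expR (- ((1 - t) * (1 - delta) / 2)) ^+ b')).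
  by rewrite ler_wpM2l ?expR_ge0// lerXn2r ?nnegrE ?expR_ge0.
rewrite -expRM_natl -expRD ler_expR mulrN [b'%:R * _]mulrC.
by apply: lamp_exponent => //; rewrite ler0n.
Qed.

Lemma few_lamps_prob (R : realType) (G : sgraph) (Glf : locally_finite G)
    (rho : R) (rho0 : 0 < rho) (K : nat)
    (hK : forall z : G, (1 - 2 * flip_prob R z) ^+ K <= 1 / 1000)
    (x : lamplighter G) :
  exists C : R, \forall i \near \oo,
    walkE (96 * base R i.+1) x (fun q => (few_lamps rho K x i q)%:R) <=
    C * (Num.sqrt i%:R / i%:R ^+ 2).
Proof.
have Hlf := lamplighter_lf Glf; case: x => eta x.
have [h hE h0] : exists2 h : R, h = 1000 & 0 < h by exists 1000; rewrite ?ltr0n.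
have [g gE g0] : exists2 g : R, g = 4000 & 0 < g by exists 4000; rewrite ?ltr0n.
have [f fE f0] : exists2 f : R, f = 995 / 1000 & 0 < f.
  by exists (995 / 1000); rewrite ?divr_gt0 ?ltr0n.
pose c := f * 25 * rho * h / g / g.
have c0 : 0 < c by rewrite !divr_gt0// !mulr_gt0// ltr0n.
exists (100 ^+ 2 * expR 1 * 24 / c ^+ 4); near=> i.
have i1 : 1 <= i%:R :> R by near: i; exact: nbhs_infty_ger.
have hbase : (base R i.+1)%:R <= 102 / 100 * (base R i)%:R :> R.
  by near: i; exact: near_base_ratio.
have I0 : 0 < i%:R :> R by rewrite (lt_le_trans _ i1).
set I : R := i%:R in i1 I0 *; set b := visits_level rho i.
have k1 : 1 <= (scale R i)%:R :> R by rewrite ler1n scale_gt0.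
have bE : b / g / g = c * (I ^+ 5 * (scale R i)%:R).
  rewrite /b /visits_level baseE -/I -fE -hE /c.
  by field; rewrite !gt_eqF.
have b0 : 0 <= b.
  have -> : b = b / g / g * g * g by field; rewrite gt_eqF.
  have k0 : 0 < (scale R i)%:R :> R by rewrite (lt_le_trans _ k1).
  rewrite bE; apply/ltW/mulr_gt0 => //; apply: mulr_gt0 => //.
  by apply: mulr_gt0 => //; apply: mulr_gt0 => //; exact: exprn_gt0.
set N := (96 * base R i.+1)%N; pose n1 : R := N.+1%:R.
have hn1 : n1 <= 100 * (I ^+ 6 * (scale R i)%:R).
  rewrite /n1 -natr1 /N natrM -baseE.
  have : 1 <= (base R i)%:R :> R by rewrite (le_trans i1)// ler_nat base_ge.
  by move: hbase; clear; lra.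
have n1E : n1 = N.+1%:R by [].
clearbody n1; pose a := Num.truncn (499 / 1000 * b); pose b' := Num.truncn b.
have ha : a%:R <= 499 / 1000 * b.
  by rewrite truncn_le; apply: mulr_ge0; [clear; lra|exact: b0].
have hb : b <= b'%:R + 1 by rewrite natr1 ltW// truncnS_gt.
have [s sE] : exists s : R, s = 1 / 4000 by exists (1 / 4000).
have [delta dE] : exists delta : R, delta = 1 / 1000 by exists (1 / 1000).
pose t := expR (- s).
have t0 : 0 < t by exact: expR_gt0.
have t1 : t < 1 by rewrite expR_lt1 sE; clear; lra.
have d1 : delta <= 1 by rewrite dE; clear; lra.
have r0 : 0 <= (1 + t) / 2 + delta * ((1 - t) / 2) by rewrite dE; clear -t0 t1; lra.
rewrite -dE in hK.
have hw := @lamp_weight_le R s b t delta a b' sE erefl dE ha hb.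
pose A (q : seq (lamplighter G)) : bool := (#|` lamp_diff eta (last ((eta, x) : lamplighter G) q).1| <= a)%N &&
    (b' <= nvisits K.+1 (jumps x q))%N.
apply: (@le_trans _ _ (walkE N ((eta, x) : lamplighter G) (fun q =>
    \sum_(n < N.+1) ((A (take n q))%:R : R)))).
  apply: (ler_walkE Hlf) => q _ _; rewrite /few_lamps.
  case: hasP => [[n]|_]; last by rewrite sumr_ge0// => n _; rewrite ler0n.
  rewrite mem_iota add0n => /= nN hA.
  rewrite (bigD1 (Ordinal nN))//= /A /a /b' hA lerDl.
  by rewrite sumr_ge0// => j _; rewrite ler0n.
rewrite walkE_sum//; clearbody N.
apply: (@le_trans _ _ (\sum_(n < N.+1) n1 * expR (1 - b / 4000 / 4000))).
  apply: ler_sum => n _.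
  have nN : (n <= N)%N by rewrite -ltnS.
  rewrite -[X in walkE X _ _](subnKC nN).
  rewrite (walkE_prefix Hlf n (N - n) _ (fun q => (A q)%:R)).
  apply: (le_trans (lamp_tail Glf t0 t1 eta n a b' x d1 hK)).
  apply: ler_pM; [exact: ler0n| | |exact: hw].
    by apply: mulr_ge0; rewrite exprn_ge0// invr_ge0 ltW.
  by rewrite n1E ler_nat.
rewrite sumr_const card_ord -[_ *+ N.+1]mulr_natl -n1E.
rewrite -gE bE.
apply: (le_trans (lamp_tail_arith c0 i1 k1 (lexx _) _ hn1)); first by rewrite n1E ler0n.
rewrite ler_wpM2l//.
  apply: divr_ge0; last by rewrite exprn_ge0// ltW.
  apply: mulr_ge0; last by rewrite ler0n.
  by apply: mulr_ge0; [rewrite exprn_ge0 ?ler0n|exact: expR_ge0].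
rewrite -[leLHS]mul1r ler_wpM2r ?invr_ge0 ?exprn_ge0 ?(ltW I0)//.
by rewrite -[leLHS](sqrtr1 R) ler_wsqrtr.
Unshelve. all: by end_near. Qed.

(** * Failure events for the upper bound *)

Definition range_level (R : realType) (rho : R) (i : nat) : R :=
  1010 / 1000 * (96 * (base R i)%:R) * (rho / (i%:R / 1000)).

Definition many_visits (R : realType) (G : sgraph) (rho : R)
    (x : lamplighter G) (i : nat) (q : seq (lamplighter G)) : bool :=
  range_level rho i <= (nvisits 1 (jumps x.2 q))%:R.

(** The range is subadditive, so the block sum dominates it and no overlap has to be estimated.
    Every step is counted as a jump, and the Chernoff bound alone is of order 1 / i^2. *)
Lemma many_visits_prob (R : realType) (G : sgraph) (Glf : locally_finite G)
    (rho : R) (rho0 : 0 < rho)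
    (noret_le : exists N, forall t (x : G), (N <= t)%N ->
      noret R t x <= rho / ln t%:R) (x : lamplighter G) :
  exists C : R, \forall i \near \oo,
    walkE (96 * base R i) x (fun q => (many_visits rho x i q)%:R) <=
    C * (Num.sqrt i%:R / i%:R ^+ 2).
Proof.
case: x => eta x; have [N hN] := noret_le.
have [h hE h0] : exists2 h : R, h = 1000 & 0 < h by exists 1000; rewrite ?ltr0n.
have [f fE f0] : exists2 f : R, f = 1003 / 1000 & 0 < f.
  by exists (1003 / 1000); rewrite ?divr_gt0 ?ltr0n.
pose c := (1 / h) ^+ 2 / 8 * 96 * f * h * rho.
have c0 : 0 < c.
  apply: mulr_gt0 => //; apply: mulr_gt0 => //; apply: mulr_gt0 => //.
  apply: mulr_gt0; last by rewrite ltr0n.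
  by apply: divr_gt0; [apply: exprn_gt0; exact: divr_gt0|rewrite ltr0n].
exists (c^-1); near=> i.
have i1 : 1 <= i%:R :> R by near: i; exact: nbhs_infty_ger.
have irho : 1 / rho <= i%:R by near: i; exact: nbhs_infty_ger.
have hk : 999 / 1000 * (i%:R / 1000) <= ln (scale R i)%:R :> R.
  by near: i; exact: near_ln_scale.
have hNk : N%:R <= (scale R i)%:R :> R by near: i; exact: near_scale.
set I : R := i%:R in i1 irho hk *; set k := scale R i in hk hNk *.
have I0 : 0 < I by rewrite (lt_le_trans _ i1).
have i0 : (0 < i)%N by rewrite -(ltr_nat R).
have kn0 : (0 < k)%N by exact: scale_gt0.
have k0 : 0 < k%:R :> R by rewrite ltr0n.
pose l := (96 * i ^ 3)%N; pose m := (i ^ 3 * k)%N.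
have lE : l%:R = 96 * I ^+ 3 :> R by exact: (natr_mulX R 96 3 i).
have mE : m%:R = I ^+ 3 * k%:R :> R by rewrite /m mulnC natr_mulX mulrC.
have m0 : (0 < m)%N by rewrite muln_gt0 expn_gt0 i0/=.
have mR0 : 0 < m%:R :> R by rewrite ltr0n.
have lm : (96 * base R i = l * m)%N by rewrite /base -/k /l /m -mulnA.
pose u := rho / (999 / 1000 * (I / 1000)).
have gp : 0 < 999 / 1000 * (I / 1000) by clear -I0; lra.
have hu (y : G) : noret R k y <= u.
  apply: (le_trans (hN k y _)); first by rewrite -(ler_nat R).
  rewrite (ler_pM2l rho0) lef_pV2; first exact: hk.
    by rewrite posrE (lt_le_trans gp).
  by rewrite posrE; exact: gp.
have u0 : 0 <= u by exact: divr_ge0 (ltW rho0) (ltW gp).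
pose mu := f * (rho / (I / h)).
have r0 : 0 < rho / (I / h) by rewrite !divr_gt0.
have mu0 : 0 <= mu by rewrite /mu mulr_ge0 ?ltW.
pose B (p : seq G) : R := m%:R^-1 * (nvisits 1 p)%:R.
have B01 p : size p = m -> 0 <= B p <= 1.
  move=> sp; rewrite /B mulr_ge0 ?invr_ge0 ?ler0n//= ler_pdivrMl// mulr1 ler_nat -sp.
  exact: nvisits_size.
have hB (y : G) : walkE m y B <= mu.
  rewrite walkEZ ler_pdivrMl//.
  apply: (le_trans (walkE_nvisits_le Glf m y u0 hu)).
  have hI3 : k%:R <= m%:R * (1 / h * (rho / (I / h))).
    have -> : m%:R * (1 / h * (rho / (I / h))) = k%:R * (I * (rho * I)).
      by rewrite mE; field; rewrite !gt_eqF.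
    rewrite -[leLHS]mulr1 ler_wpM2l ?ler0n// -[leLHS]mulr1.
    apply: ler_pM; rewrite ?ler01//.
    by rewrite mulrC; move: irho; rewrite ler_pdivrMr.
  apply: (le_trans (lerD hI3 (lexx _))); rewrite -mulrDr ler_wpM2l ?ler0n//.
  have -> : u = (999 / 1000)^-1 * (rho / (I / h)).
    by rewrite /u hE invfM mulrCA.
  rewrite /mu -mulrDl ler_wpM2r ?(ltW r0)// hE fE.
  by rewrite -lerBrDl -[leLHS]mul1r ler_pdivrMr; clear; lra.
have e01 : 0 < 1 / h <= 1.
  apply/andP; split; first exact: divr_gt0.
  by rewrite ler_pdivrMr// mul1r hE; clear; lra.
(* (1 + 1/1000) * 1003/1000 lies below 1010/1000. *)
have hlev : (1 + 1 / h) * l%:R * mu * m%:R <= range_level rho i.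
  rewrite /range_level baseE -/I -/k /mu lE mE -hE.
  have -> : (1 + 1 / h) * (96 * I ^+ 3) * (f * (rho / (I / h))) * (I ^+ 3 * k%:R) =
    (1 + 1 / h) * f * (96 * (I ^+ 6 * k%:R) * (rho / (I / h))).
    by ring.
  have q0 : 0 <= 96 * (I ^+ 6 * k%:R) * (rho / (I / h)).
    apply: ltW; apply: mulr_gt0 => //; apply: mulr_gt0; first by rewrite ltr0n.
    by apply: mulr_gt0 => //; exact: exprn_gt0.
  rewrite -[1010 / _ * _ * _]mulrA ler_wpM2r//.
  by rewrite hE fE; clear; lra.
have hmono (p p' : seq G) : ((range_level rho i <= (nvisits 1 p)%:R)%R%:R : R) <=
    (range_level rho i <= (nvisits 1 (p ++ p'))%:R)%R%:R.
  rewrite ler_nat; case: (boolP (range_level _ _ <= (nvisits 1 p)%:R)) => // hp.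
  by rewrite (le_trans hp)// ler_nat nvisits_cat_l.
apply: (le_trans (walkE_jumps_le Glf (96 * base R i) eta x hmono)).
rewrite lm.
apply: (@le_trans _ _ (walkE (l * m) x (fun p =>
    ((1 + 1 / h) * l%:R * mu <= blocks m l B p)%R%:R))).
  apply: (ler_walkE Glf) => p _ sp; rewrite ler_nat.
  case: (boolP (range_level _ _ <= _)) => // hp.
  have -> // : (1 + 1 / h) * l%:R * mu <= blocks m l B p.
  have blocksB q : blocks m l B q = m%:R^-1 * blocks m l (fun q => (nvisits 1 q)%:R) q.
    elim: (l) q => [|l' IH] q /=; first by rewrite mulr0.
    by rewrite IH -mulrDr.
  rewrite blocksB ler_pdivlMl// mulrC; apply: (le_trans hlev); apply: (le_trans hp).
  by have := excess_ge0 R sp; rewrite /excess subr_ge0.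
apply: (le_trans (blocks_upper_tail Glf l x e01 mu0 B01 hB)).
have -> : (1 / h) ^+ 2 / 8 * l%:R * mu = c * I ^+ 2.
  by rewrite lE /mu /c; field; rewrite !gt_eqF.
have p0 : 0 < c * I ^+ 2 by apply: mulr_gt0 => //; exact: exprn_gt0.
apply: (le_trans (expRN_le p0)); rewrite invfM ler_wpM2l ?invr_ge0 ?(ltW c0)//.
rewrite -[leLHS]mul1r ler_wpM2r ?invr_ge0 ?exprn_ge0 ?(ltW I0)//.
by rewrite -[leLHS](sqrtr1 R) ler_wsqrtr.
Unshelve. all: by end_near. Qed.

(** * Almost sure bounds for the distance *)

Section GraphFacts.
Context (G : sgraph) (Ginf : infinite_set [set: G]) (Gconn : connected_graph G)
  (Gdeg : bounded_degree G).
Implicit Types (x y z : G).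

Lemma exists_neighbor x : exists y, adj x y.
Proof.
apply: contrapT => h; apply: Ginf.
apply: (@sub_finite_set _ _ [set x]); last exact: finite_set1.
move=> z _ /=; have [n [[|y p] [xp <- _]]] := Gconn x z => //.
by move: xp => /= /andP[xy _]; exfalso; apply: h; exists y.
Qed.

Lemma connected_locally_finite : locally_finite G.
Proof.
have [D hD] := Gdeg; move=> x; have [fx _] := hD x; split => //.
have [y xy] := exists_neighbor x.
rewrite /deg cardfs_gt0; apply/fset0Pn; exists y.
by rewrite in_fset_set// inE.
Qed.

Lemma deg_le1_nbr x y : adj x y -> (deg x <= 1)%N -> forall z, adj x z -> z = y.
Proof.
move=> xy dx z xz; have Glf := connected_locally_finite.
apply/eqP/contraT => zy.
have : (#|` [fset y; z]%fset| <= deg x)%N.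
  apply: fsubset_leq_card; apply/fsubsetP => v; rewrite !inE => /orP[]/eqP ->;
  by rewrite mem_nbr.
by rewrite cardfs2 eq_sym zy => /leq_trans/(_ dx).
Qed.

(** Otherwise x and y alone form the component, and G would be finite. *)
Lemma deg1_nbr x y : adj x y -> (deg x <= 1)%N -> (2 <= deg y)%N.
Proof.
move=> xy dx; rewrite ltnNge; apply/negP => dy; apply: Ginf.
apply: (@sub_finite_set _ _ [set x; y]); last exact: finite_set2.
have stay p v : v = x \/ v = y -> path (@adj G) v p -> last v p = x \/ last v p = y.
  elim: p v => [//|u p IH] v hv; rewrite path_cons => /andP[vu up].
  apply: (IH u _ up); case: hv vu => -> vu; last first.
    have yx : adj y x by rewrite adj_sym.
    by left; rewrite (deg_le1_nbr yx dy vu).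
  by right; rewrite (deg_le1_nbr xy dx vu).
move=> z _; have [n [p [xp <- _]]] := Gconn x z.
by apply: stay xp; left.
Qed.

Lemma exists_deg2 : exists x : G, (2 <= deg x)%N.
Proof.
have [x _] : [set: G] !=set0.
  by apply: contrapT => /nonemptyPn h; apply: Ginf; rewrite h.
have [y xy] := exists_neighbor x.
case: (leqP (deg x) 1) => dx; last by exists x.
by exists y; apply: deg1_nbr xy dx.
Qed.

Lemma max_deg_ge2 (R : realType) : 2 <= max_deg G R.
Proof.
have [x dx] := exists_deg2; apply: (@le_trans _ _ (deg x)%:R); first by rewrite ler_nat.
apply: sup_ubound; last by exists x.
have [D hD] := Gdeg; exists D%:R => _ [z _ <-].
by rewrite ler_nat; have [] := hD z.
Qed.

Lemma covering_path x (s : seq G) y :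
  exists w, [/\ path (@adj G) x w, last x w = y & {subset s <= x :: w}].
Proof.
elim: s x => [|v s IH] x.
  by have [n [w [xw lw _]]] := Gconn x y; exists w.
have [n [w [xw lw _]]] := Gconn x v; have [w' [vw' lw' sw']] := IH v.
exists (w ++ w'); split.
- by rewrite cat_path xw lw.
- by rewrite last_cat lw.
- move=> z; rewrite -cat_cons mem_cat inE => /orP[/eqP ->|/sw'].
    by rewrite -lw mem_last.
  by rewrite inE => /orP[/eqP ->|->]; rewrite ?orbT// -lw mem_last.
Qed.

Lemma lamplighter_connected : connected_graph (lamplighter G).
Proof.
move=> [eta x] [xi y].
have [w [xw lw sw]] := covering_path x (lamp_diff eta xi) y.
have [q [qp ql _]] := lamp_walk xw sw.
by exists (size q), q; split; rewrite // ql lw.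
Qed.

Lemma lamplighter_countable : countable [set: lamplighter G].
Proof.
have [x _] := exists_deg2.
apply: countable_connected (lamplighter_lf connected_locally_finite) _ _.
  exact: lamplighter_connected.
exact: ([fsfun], x).
Qed.

End GraphFacts.

(** * From the observation times to all times *)

Lemma srw_bc_near (R : realType) (H : sgraph) (Hlf : locally_finite H)
    (Hcount : countable [set: H]) (d : measure_display) (T : measurableType d)
    (P : probability T R) (x : H) (S : nat -> T -> H) (hS : is_srw P x S)
    (A : nat -> pred (seq H)) (len : nat -> nat) (C : R) :
  (\forall i \near \oo, walkE (len i) x (fun q => (A i q)%:R) <=
    C * (Num.sqrt i%:R / i%:R ^+ 2)) ->
  {ae P, forall w, exists N, forall i, (N <= i)%N ->
    ~~ A i (trajectory S (len i) w)}.
Proof.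
move=> [N _ hN].
pose e i : R := `|C| * (Num.sqrt i%:R / i%:R ^+ 2).
have e0 i : 0 <= e i.
  by rewrite /e mulr_ge0 ?normr_ge0 ?divr_ge0 ?sqrtr_ge0 ?exprn_ge0 ?ler0n.
have hA i : walkE (len i) x (fun q => ((N <= i)%N && A i q)%:R) <= e i.
  case: (leqP N i) => Ni.
    apply: (le_trans (hN i Ni)); apply: ler_wpM2r; last exact: ler_norm.
    by rewrite divr_ge0 ?sqrtr_ge0 ?exprn_ge0 ?ler0n.
  by apply: (walkE_le Hlf) => q _ _; exact: e0.
have hM n : \sum_(i < n) e i <= `|C| * 3.
  rewrite -mulr_sumr ler_wpM2l ?normr_ge0//; exact: sum_inv_pow32_le.
have := srw_borel_cantelli Hlf Hcount hS (A := fun i q => (N <= i)%N && A i q) hA hM.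
apply: filterS => w [N' hN']; exists (maxn N N') => i; rewrite geq_max => /andP[Ni N'i].
by have := hN' i N'i; rewrite Ni.
Qed.

Lemma last_trajectory (H : sgraph) (d : measure_display) (T : measurableType d) (S : nat -> T -> H) (x : H) n w :
  S 0%N w = x -> last x (trajectory S n w) = S n w.
Proof.
by move=> <-; case: n => [//|n]; rewrite /trajectory mkseqS last_rcons.
Qed.

(** The constants just fit: 997/1000 * 995/1000 * 25 * 999/1000 > 24.77, while 101/400 * 96 *
    102/100 < 24.73. *)
Lemma rescaled_lower (R : realType) (B L rho b D n l : R) :
  0 < L -> 0 < rho -> 0 < B -> 0 < n -> 1000 <= b ->
  b = 995 / 1000 * (25 * B) * (rho / L) -> 998 / 1000 * b <= D + 1 ->
  n <= 96 * (102 / 100 * B) -> 999 / 1000 * L <= l ->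
  101 / 100 * (rho / 4) <= D / (n / l).
Proof.
move=> L0 r0 B0 n0 b1 bE hD hn hl.
have l0 : 0 < l by clear -hl L0; lra.
rewrite invf_div [leRHS]mulrA ler_pdivlMr; last exact: n0.
have h1 : 997 / 1000 * b <= D by clear -hD b1; lra.
have bp : 0 <= 997 / 1000 * b by clear -b1; lra.
have Lp : 0 <= 999 / 1000 * L by clear -L0; lra.
apply: le_trans (ler_pM bp Lp h1 hl).
have -> : 997 / 1000 * b * (999 / 1000 * L) =
    997 / 1000 * (995 / 1000 * 25) * (999 / 1000) * (rho * B).
  rewrite bE -mulrA; set u := 997 / 1000; set v := 995 / 1000; set z := 999 / 1000.
  by field; rewrite gt_eqF.
have h2 : rho * n <= rho * (96 * (102 / 100 * B)) by rewrite ler_pM2l.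
have p0 : 0 < rho * B by exact: mulr_gt0.
have -> : 101 / 100 * (rho / 4) * n = 101 / 100 / 4 * (rho * n) by ring.
rewrite [rho * (96 * _)]mulrCA [rho * (_ / _ * _)]mulrCA in h2.
by move: (rho * n) (rho * B) h2 p0; clear=> u v h2 p0; lra.
Qed.

(** The constant 4 * 1.001 * (1.01 * 96 * 1.02 + 1) is below 400, against 5 * 96 = 480. The summand
    1 comes from L <= rho B. *)
Lemma rescaled_upper (R : realType) (B B' L rho D m n l : R) :
  0 < L -> 0 < rho -> 0 < B -> 0 < n -> 0 <= l -> L <= rho * B ->
  m <= 1010 / 1000 * (96 * B') * (rho / L) -> D <= 4 * (m + 1) -> 0 <= D ->
  B' <= 102 / 100 * B -> 96 * B <= n -> l <= 1001 / 1000 * L ->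
  D / (n / l) <= 5 * rho.
Proof.
move=> L0 r0 B0 n0 l0 LB hm hD D0 hB hn hl.
rewrite invf_div mulrA ler_pdivrMr; last exact: n0.
apply: (@le_trans _ _ (4 * (m + 1) * (1001 / 1000 * L))); first exact: ler_pM.
have h1 : m * L <= 1010 / 1000 * 96 * (rho * B').
  have -> : 1010 / 1000 * 96 * (rho * B') = 1010 / 1000 * (96 * B') * (rho / L) * L.
    by set u := 1010 / 1000; field; rewrite gt_eqF.
  by rewrite (ler_pM2r L0).
have h2 : rho * B' <= rho * (102 / 100 * B) by rewrite (ler_pM2l r0).
have h3 : rho * (96 * B) <= rho * n by rewrite (ler_pM2l r0).
rewrite [rho * (_ / _ * _)]mulrCA in h2; rewrite [rho * (96 * _)]mulrCA in h3.
have -> : 4 * (m + 1) * (1001 / 1000 * L) = 4 * (1001 / 1000) * (m * L + L) by ring.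
rewrite -[leRHS]mulrA; move: (m * L) (rho * B') (rho * B) (rho * n) LB h1 h2 h3 L0.
by clear=> a b c e ? ? ? ? ?; lra.
Qed.

(** The visit count at time n is inherited from the previous observation time; [few_lamps] covers n
    itself. *)
Lemma lower_along (R : realType) (G : sgraph) (Glf : locally_finite G) (rho : R)
    (rho0 : 0 < rho) (K i n : nat) (x : lamplighter G) (q : seq (lamplighter G)) :
  1 <= i%:R :> R -> 1 / rho <= i%:R ->
  999 / 1000 * (i%:R / 1000) <= ln (scale R i)%:R :> R ->
  (base R i.+1)%:R <= 102 / 100 * (base R i)%:R :> R ->
  path (@adj (lamplighter G)) x q -> size q = (96 * base R i.+1)%N ->
  (96 * base R i <= n)%N -> (n <= 96 * base R i.+1)%N ->
  ~~ few_visits rho K x i (take (96 * base R i) q) -> ~~ few_lamps rho K x i q ->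
  101 / 100 * (rho / 4) <= (gdist x (last x (take n q)))%:R / (n%:R / ln n%:R).
Proof.
move=> i1 irho hk hbase xq sq hn1 hn2 hv hl.
have I0 : 0 < i%:R :> R by rewrite (lt_le_trans _ i1).
have B0 : 0 < (base R i)%:R :> R by rewrite (lt_le_trans I0)// ler_nat base_ge.
have n0 : 0 < n%:R :> R.
  have b1 : (0 < base R i)%N by rewrite -(ltr0n R).
  by rewrite ltr0n; apply: leq_trans hn1; rewrite muln_gt0.
have [h hE h0] : exists2 h : R, h = 1000 & 0 < h by exists 1000; rewrite ?ltr0n.
have bB : visits_level rho i = 995 / 1000 * (25 * (base R i)%:R) * (rho / (i%:R / 1000)) by [].
have hvis : (Num.truncn (visits_level rho i) <= nvisits K.+1 (jumps x.2 (take n q)))%N.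
  have : visits_level rho i < (nvisits K.+1 (jumps x.2 (take n q)))%:R.
    move: hv; rewrite /few_visits -ltNge => /lt_le_trans; apply.
    rewrite ler_nat -[X in (_ <= nvisits _ (jumps _ X))%N](cat_take_drop (96 * base R i)) take_takel//.
    by rewrite jumps_cat nvisits_cat_l.
  by move=> /ltW/(@le_truncn R); rewrite natrK.
have hlamp : 499 / 1000 * visits_level rho i <=
    (#|` lamp_diff x.1 (last x (take n q)).1|)%:R.
  move/hasPn: hl => /(_ n); rewrite mem_iota add0n ltnS hn2 => /(_ isT).
  rewrite hvis andbT -ltnNge => hlt; apply: (@le_trans _ _ (Num.truncn (499 / 1000 * visits_level rho i)).+1%:R).
    by apply/ltW; exact: truncnS_gt.
  by rewrite ler_nat.
have lk : ln (scale R i)%:R <= ln n%:R :> R.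
  rewrite ler_ln ?posrE ?ltr0n ?scale_gt0//; last by rewrite -(ltr0n R).
  rewrite ler_nat; apply: leq_trans hn1; apply: leq_trans (leq_pmull _ _) => //.
  by rewrite /base mulnA leq_pmull// muln_gt0 !expn_gt0 -(ltr0n R) I0.
have hd : 998 / 1000 * visits_level rho i <= (gdist x (last x (take n q)))%:R + 1.
  have tq : path (@adj (lamplighter G)) x (take n q).
    by move: xq; rewrite -{1}(cat_take_drop n q) cat_path => /andP[].
  have := gdist_lamp_ge tq; rewrite -(ler_nat R) natrM -[_.+1%:R]natr1.
  by move: hlamp; clear; lra.
have hb : h <= visits_level rho i.
  rewrite bB baseE -hE.
  have k1 : 1 <= (scale R i)%:R :> R by rewrite ler1n scale_gt0.
  have -> : 995 / h * (25 * (i%:R ^+ 6 * (scale R i)%:R)) * (rho / (i%:R / h)) =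
      995 * 25 * (i%:R ^+ 5 * (rho * (scale R i)%:R)) by field; rewrite !gt_eqF.
  have r1 : 1 <= rho * i%:R by move: irho; rewrite ler_pdivrMr// mulrC.
  have -> : i%:R ^+ 5 * (rho * (scale R i)%:R) =
      rho * i%:R * (i%:R ^+ 4 * (scale R i)%:R) by ring.
  have z1 : 1 <= rho * i%:R * (i%:R ^+ 4 * (scale R i)%:R).
    by rewrite mulr_ege1// mulr_ege1// exprn_ege1.
  by rewrite hE; move: (_ * (_ * _)) z1; clear=> z z1; lra.
have hn : n%:R <= 96 * (102 / 100 * (base R i)%:R) :> R.
  by move: hn2; rewrite -(ler_nat R) natrM; move: hbase; clear; lra.
have L0 : 0 < i%:R / 1000 :> R by rewrite -hE divr_gt0.
rewrite hE in hb.
exact: (rescaled_lower L0 rho0 B0 n0 hb bB hd hn (le_trans hk lk)).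
Qed.

(** The range at time n is at most the range at the next observation time. *)
Lemma upper_along (R : realType) (G : sgraph) (Glf : locally_finite G) (rho : R)
    (rho0 : 0 < rho) (i n : nat) (x : lamplighter G) (q : seq (lamplighter G)) :
  1 <= i%:R :> R -> 1 / rho <= i%:R ->
  ln (96 * base R i.+1)%:R <= 1001 / 1000 * (i.+1%:R / 1000) :> R ->
  (base R i.+1)%:R <= 102 / 100 * (base R i)%:R :> R ->
  path (@adj (lamplighter G)) x q -> size q = (96 * base R i.+1)%N ->
  (96 * base R i <= n)%N -> (n <= 96 * base R i.+1)%N ->
  ~~ many_visits rho x i.+1 q ->
  (gdist x (last x (take n q)))%:R / (n%:R / ln n%:R) <= 5 * rho.
Proof.
move=> i1 irho hk hbase xq sq hn1 hn2 hv.
have I0 : 0 < i%:R :> R by rewrite (lt_le_trans _ i1).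
have B0 : 0 < (base R i)%:R :> R by rewrite (lt_le_trans I0)// ler_nat base_ge.
have n0 : (0 < n)%N.
  have b1 : (0 < base R i)%N by rewrite -(ltr0n R).
  by apply: leq_trans hn1; rewrite muln_gt0.
have [h hE h0] : exists2 h : R, h = 1000 & 0 < h by exists 1000; rewrite ?ltr0n.
have L0 : 0 < i.+1%:R / 1000 :> R by rewrite -hE divr_gt0.
have LB : i.+1%:R / 1000 <= rho * (base R i)%:R :> R.
  have k1 : 1 <= (scale R i)%:R :> R by rewrite ler1n scale_gt0.
  apply: (@le_trans _ _ i%:R).
    by rewrite -natr1; move: i1; clear; lra.
  have r1 : 1 <= rho * i%:R by move: irho; rewrite ler_pdivrMr// mulrC.
  have -> : rho * (base R i)%:R = i%:R * (rho * i%:R * (i%:R ^+ 4 * (scale R i)%:R)).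
    by rewrite baseE; ring.
  by rewrite -[leLHS]mulr1 ler_pM2l// mulr_ege1// mulr_ege1// exprn_ege1.
have ln0 : 0 <= ln n%:R :> R by rewrite ln_ge0// ler1n.
have lk : ln n%:R <= 1001 / 1000 * (i.+1%:R / 1000) :> R.
  apply: le_trans hk; rewrite ler_ln ?posrE ?ltr0n ?ler_nat//.
  exact: leq_trans n0 hn2.
have tq : path (@adj (lamplighter G)) x (take n q).
  by move: xq; rewrite -{1}(cat_take_drop n q) cat_path => /andP[].
have hm : (nvisits 1 (jumps x.2 q))%:R <= range_level rho i.+1.
  by move: hv; rewrite /many_visits -ltNge => /ltW.
have hd : (gdist x (last x (take n q)))%:R <= 4 * ((nvisits 1 (jumps x.2 q))%:R + 1) :> R.
  rewrite natr1 -natrM ler_nat; apply: (leq_trans (gdist_lamp_le tq)).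
  rewrite leq_mul2l ltnS /= -[X in (_ <= nvisits _ (jumps _ X))%N](cat_take_drop n q).
  by rewrite jumps_cat nvisits_cat_l.
have hn : 96 * (base R i)%:R <= n%:R :> R by rewrite -natrM ler_nat.
have n0R : 0 < n%:R :> R by rewrite ltr0n.
exact: (rescaled_upper L0 rho0 B0 n0R ln0 LB hm hd (ler0n _ _) hbase hn lk).
Qed.

Section AlmostSure.
Context (R : realType) (G : sgraph) (Ginf : infinite_set [set: G])
  (Gconn : connected_graph G) (Gdeg : bounded_degree G).
Context (x : lamplighter G) (d : measure_display) (T : measurableType d)
  (P : probability T R) (Y : nat -> T -> lamplighter G) (hY : is_srw P x Y).

Lemma dist_lower_ae (c C : R) (c0 : 0 < c) (C0 : 0 < C)
    (ret_bounds : forall n (z : G), (1 <= n)%N ->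
      c <= n%:R * (ret R n z + ret R n.+1 z) <= C)
    (rho : R) (rho0 : 0 < rho)
    (noret_ge : exists N, forall t (z : G), (N <= t)%N ->
      rho / ln t%:R <= noret R t z) :
  {ae P, forall w, \forall n \near \oo,
    101 / 100 * (rho / 4) <= rescaled_dist R Y n w}.
Proof.
have Glf := connected_locally_finite Ginf Gconn Gdeg.
have Hlf := lamplighter_lf Glf.
have Hc := lamplighter_countable Ginf Gconn Gdeg.
have deg1 := deg1_nbr Ginf Gconn Gdeg.
have [D hD] := Gdeg.
have d0 : 0 < 1 / 1000 :> R by rewrite divr_gt0 ?ltr0n.
have [K hK] := flip_parity_mixing (fun z : G => proj2 (hD z)) d0.
have [C1 h1] := visits_tail Glf c0 C0 ret_bounds rho0 noret_ge K.
have h2 := few_visits_prob Glf deg1 h1 x.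
have [C3 h3] := few_lamps_prob Glf rho0 hK x.
have [N3 _ hN3] : \forall i \near \oo, [/\ 1 <= i%:R :> R, 1 / rho <= i%:R,
    999 / 1000 * (i%:R / 1000) <= ln (scale R i)%:R :> R &
    (base R i.+1)%:R <= 102 / 100 * (base R i)%:R :> R].
  near=> i; split; near: i.
  - exact: nbhs_infty_ger.
  - exact: nbhs_infty_ger.
  - exact: near_ln_scale.
  - exact: near_base_ratio.
have := srw_path_ae Hlf Hc hY; apply: filterS3 (srw_bc_near Hlf Hc hY h2) (srw_bc_near Hlf Hc hY h3).
move=> w [N1 hN1] [N2 hN2] [Y0 hp].
exists (96 * base R (maxn N1 (maxn N2 N3)))%N => // n /= hn.
have [i [Ni hi1 hi2]] := interpolate (fun i => time_ge R i) hn.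
move: Ni; rewrite !geq_max => /and3P[N1i N2i N3i].
have [i1 irho hk hb] := hN3 i N3i.
have hv := hN1 i N1i.
rewrite -(take_trajectory Y w (leq_trans hi1 hi2)) in hv.
have := lower_along Glf rho0 i1 irho hk hb (hp _) (size_mkseq _ _) hi1 hi2 hv (hN2 i N2i).
by rewrite take_trajectory// (last_trajectory _ Y0) /rescaled_dist Y0.
Unshelve. all: by end_near. Qed.

Lemma dist_upper_ae (rho : R) (rho0 : 0 < rho)
    (noret_le : exists N, forall t (z : G), (N <= t)%N ->
      noret R t z <= rho / ln t%:R) :
  {ae P, forall w, \forall n \near \oo, rescaled_dist R Y n w <= 5 * rho}.
Proof.
have Glf := connected_locally_finite Ginf Gconn Gdeg.
have Hlf := lamplighter_lf Glf.
have Hc := lamplighter_countable Ginf Gconn Gdeg.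
have [C h] := many_visits_prob Glf rho0 noret_le x.
have [N3 _ hN3] : \forall i \near \oo, [/\ 1 <= i%:R :> R, 1 / rho <= i%:R,
    ln (96 * base R i)%:R <= 1001 / 1000 * (i%:R / 1000) :> R &
    (base R i.+1)%:R <= 102 / 100 * (base R i)%:R :> R].
  near=> i; split; near: i.
  - exact: nbhs_infty_ger.
  - exact: nbhs_infty_ger.
  - exact: near_ln_time.
  - exact: near_base_ratio.
have := srw_path_ae Hlf Hc hY; apply: filterS2 (srw_bc_near Hlf Hc hY h).
move=> w [N1 hN1] [Y0 hp].
exists (96 * base R (maxn N1 N3))%N => // n /= hn.
have [i [Ni hi1 hi2]] := interpolate (fun i => time_ge R i) hn.
move: Ni; rewrite !geq_max => /andP[N1i N3i].
have [i1 irho _ hb] := hN3 i N3i.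
have [_ _ hk _] := hN3 i.+1 (leqW N3i).
have := upper_along Glf rho0 i1 irho hk hb (hp _) (size_mkseq _ _) hi1 hi2
  (hN1 i.+1 (leqW N1i)).
by rewrite take_trajectory// (last_trajectory _ Y0) /rescaled_dist Y0.
Unshelve. all: by end_near. Qed.

End AlmostSure.

(** * From escape probabilities to [r_inf] and [r_sup] *)

Section ErealLimits.
Context (R : realType).
Implicit Types (u : (\bar R)^nat) (l : \bar R).
Local Open Scope ereal_scope.

Lemma limn_esup_lt u l : limn_esup u < l -> \forall n \near \oo, u n < l.
Proof.
rewrite /limn_esup limf_esupE => /ereal_inf_lt[_ [V hV <-] hl].
apply: filterS hV => n Vn; apply: le_lt_trans hl.
by apply: ereal_sup_ubound; exists n.
Qed.

Lemma limn_esup_le u l : (\forall n \near \oo, u n <= l) -> limn_esup u <= l.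
Proof.
move=> h; rewrite /limn_esup limf_esupE.
apply: (@le_trans _ _ (ereal_sup (u @` [set n | u n <= l]))).
  by apply: ereal_inf_lbound; exists [set n | u n <= l].
by apply: ge_ereal_sup => _ [n hn <-].
Qed.

Lemma limn_einf_gt u l : l < limn_einf u -> \forall n \near \oo, l < u n.
Proof.
rewrite /limn_einf lteNr => /limn_esup_lt; apply: filterS => n.
by rewrite lteN2.
Qed.

Lemma limn_einf_ge u l : (\forall n \near \oo, l <= u n) -> l <= limn_einf u.
Proof.
move=> h; rewrite /limn_einf leeNr; apply: limn_esup_le.
by apply: filterS h => n; rewrite leeN2.
Qed.

End ErealLimits.

(** [E n] lies in the union of the events from n on; these unions decrease to the limit superior,
    which is null. *)
Lemma cvg_prob_ae_near (R : realType) (d : measure_display) (T : measurableType d)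
    (P : probability T R) (E : nat -> set T) : (forall n, measurable (E n)) ->
  {ae P, forall w, \forall n \near \oo, ~ E n w} -> P (E n) @[n --> \oo] --> 0%E.
Proof.
move=> mE [N [mN N0 hN]].
have e : P (lim_sup_set E) = 0%E.
  apply/eqP; rewrite eq_le measure_ge0 andbT -N0; apply: le_measure.
  - by rewrite inE; apply: bigcap_measurable => // k _; exact: bigcup_measurable.
  - by rewrite inE.
  - move=> w hw; apply: hN => -[k _ hk]; have [n /= kn] := hw k I.
    exact: hk.
have mU n : measurable (\bigcup_(k in [set k | (n <= k)%N]) E k).
  exact: bigcup_measurable.
apply: (@squeeze_cvge _ _ _ _ (fun=> 0%E) _
  (fun n => P (\bigcup_(k in [set k | (n <= k)%N]) E k))).
- apply: nearW => n; rewrite measure_ge0/=; apply: le_measure; rewrite ?inE//.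
  by move=> w En; exists n => /=.
- exact: cvg_cst.
- rewrite -e; apply: lim_sup_set_cvg => //; apply: le_lt_trans (ltry 1).
  exact: probability_le1.
Qed.

Section ReturnTimes.
Context (R : realType) (G : sgraph) (Ginf : infinite_set [set: G])
  (Gconn : connected_graph G) (Gdeg : bounded_degree G).
Context (d : measure_display) (T : measurableType d)
  (P : G -> probability T R) (S : nat -> T -> G) (hS : forall x, is_srw (P x) x S).

Let Glf := connected_locally_finite Ginf Gconn Gdeg.

Lemma graph_countable : countable [set: G].
Proof.
have [x _] := exists_deg2 Ginf Gconn Gdeg.
exact: (countable_connected Glf Gconn x).
Qed.

Lemma lt_return_time n x w :
  (n%:R%:E < return_time R S x w)%E = (x \notin trajectory S n w).
Proof.
apply/idP/idP => [h|h].
  apply/negP => /mapP[i]; rewrite mem_iota add0n => /= ni xE.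
  move: h; rewrite ltNge => /negP; apply.
  apply: (@le_trans _ _ i.+1%:R%:E); last by rewrite lee_fin ler_nat.
  by apply: ereal_inf_lbound; exists i.+1.
apply: (@lt_le_trans _ _ n.+1%:R%:E); first by rewrite lte_fin ltr_nat.
apply: le_ereal_inf_tmp => _ [k [k1 Sk] <-]; rewrite lee_fin ler_nat ltnNge.
apply/negP => kn; move/negP: h; apply.
rewrite -Sk /trajectory; apply/mapP; exists k.-1; last by rewrite prednK.
by rewrite mem_iota add0n /= prednK.
Qed.

Lemma no_return_probE n x : no_return_prob P S n x = (noret R n x)%:E.
Proof.
rewrite -(srw_law Glf graph_countable (hS x) n (fun p => x \notin p)).
by rewrite /no_return_prob; congr (P x _); apply/seteqP; split => w /=;
  rewrite lt_return_time.
Qed.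

Lemma trans_probE n x : trans_prob P S n.+1 x x = (ret R n.+1 x)%:E.
Proof.
rewrite -(srw_law Glf graph_countable (hS x) n.+1 (fun p => last x p == x)).
have lS w : last x (trajectory S n.+1 w) = S n.+1 w.
  by rewrite /trajectory mkseqS last_rcons.
by rewrite /trans_prob; congr (P x _); apply/seteqP; split => w; rewrite !mksetE lS => /eqP.
Qed.

Lemma uwr_ret_bounds : uniformly_weakly_recurrent P S ->
  exists c C : R, [/\ 0 < c, 0 < C & forall n (x : G), (1 <= n)%N ->
    c <= n%:R * (ret R n x + ret R n.+1 x) <= C].
Proof.
move=> [c [C [c0 C0 h]]]; exists c, C; split => // -[//|n] x n1.
by have := h n.+1 x n1; rewrite !trans_probE -EFinD -EFinM !lee_fin.
Qed.

Lemma r_inf_noret (rho : R) : (rho%:E < r_inf P S)%E ->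
  exists N, forall t (x : G), (N <= t)%N -> rho / ln t%:R <= noret R t x.
Proof.
move=> /limn_einf_gt [N _ hN]; exists (maxn N 2) => t x; rewrite geq_max => /andP[Nt t2].
have l0 : 0 < ln t%:R :> R by rewrite ln_gt0// ltr1n.
rewrite ler_pdivrMr// mulrC -lee_fin EFinM; apply: (le_trans (ltW (hN t Nt))).
rewrite lee_pmul2l// -no_return_probE.
by apply: ereal_inf_lbound; exists x.
Qed.

Lemma r_sup_noret (rho : R) : (r_sup P S < rho%:E)%E ->
  exists N, forall t (x : G), (N <= t)%N -> noret R t x <= rho / ln t%:R.
Proof.
move=> /limn_esup_lt [N _ hN]; exists (maxn N 2) => t x; rewrite geq_max => /andP[Nt t2].
have l0 : 0 < ln t%:R :> R by rewrite ln_gt0// ltr1n.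
rewrite ler_pdivlMr// mulrC -lee_fin EFinM; apply: le_trans (ltW (hN t Nt)).
rewrite lee_pmul2l// -no_return_probE.
by apply: ereal_sup_ubound; exists x.
Qed.

(** [noret_le] bounds ln n times the escape probability by 2 / c. *)
Lemma r_inf_ltry : uniformly_weakly_recurrent P S -> (r_inf P S < +oo)%E.
Proof.
move=> /uwr_ret_bounds[c [C [c0 C0 hret]]]; rewrite ltey; apply/eqP => e.
have [x _] := exists_deg2 Ginf Gconn Gdeg.
have [|N hN] := @r_inf_noret (2 / c + 1); first by rewrite e ltry.
have t2 : (1 < maxn N 2)%N by rewrite leq_max orbT.
have := hN (maxn N 2) x (leq_maxl _ _).
have := noret_le Glf c0 hret x t2.
have l0 : 0 < ln (maxn N 2)%:R :> R by rewrite ln_gt0// ltr1n.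
move=> h1 /le_trans/(_ h1); rewrite invfM mulrA ler_pM2r ?invr_gt0//.
by rewrite gerDl ler10.
Qed.

Lemma r_sup_ge0 : (0 <= r_sup P S)%E.
Proof.
rewrite leNgt; apply/negP => h.
have [rho [hrho rho0]] : exists rho : R, (r_sup P S < rho%:E)%E /\ rho < 0.
  case: (r_sup P S) h => [r| |]//=.
    by rewrite lte_fin => r0; exists (r / 2); rewrite lte_fin; split; lra.
  by exists (-1); rewrite ltNyr ltrN10.
have [N hN] := r_sup_noret hrho; have [x _] := exists_deg2 Ginf Gconn Gdeg.
have l0 : 0 < ln (maxn N 2)%:R :> R by rewrite ln_gt0// ltr1n leq_max orbT.
have := le_trans (noret_ge0 R Glf (maxn N 2) x) (hN (maxn N 2) x (leq_maxl _ _)).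
by rewrite pmulr_lge0 ?invr_gt0// leNgt rho0.
Qed.

End ReturnTimes.

(** * Limits of the rescaled distance *)

Lemma rescaled_dist_ge0 (R : realType) (H : sgraph) (T : Type) (Y : nat -> T -> H) n w :
  0 <= rescaled_dist R Y n w.
Proof.
rewrite /rescaled_dist; case: n => [|n]; first by rewrite mul0r invr0 mulr0.
by rewrite mulr_ge0 ?invr_ge0 ?divr_ge0 ?ln_ge0 ?ler1n.
Qed.

Theorem proposition7p11 (R : realType) (G : sgraph)
    (dS : measure_display) (TS : measurableType dS)
    (P : G -> probability TS R) (S : nat -> TS -> G)
    (hS : forall x : G, is_srw (P x) x S)
    (Ginf : infinite_set [set: G])
    (Gconn : connected_graph G)
    (Gdeg : bounded_degree G)
    (Gwr : uniformly_weakly_recurrent P S)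
    (x : lamplighter G)
    (dY : measure_display) (TY : measurableType dY)
    (PY : probability TY R) (Y : nat -> TY -> lamplighter G)
    (hY : is_srw PY x Y)
    (eps : R) (heps : 0 < eps) :
  [/\ {ae PY, forall w,
        (limn_esup (fun n => (rescaled_dist R Y n w)%:E)
         <= (2 * max_deg G R + 1)%:E * r_sup P S)%E},
      PY [set w | ((rescaled_dist R Y n w)%:E
                   <= r_inf P S * (4^-1)%:E - eps%:E)%E] @[n --> \oo] --> 0%E
    & forall alpha : R, 0 < alpha -> ahlfors_regular G alpha ->
      {ae PY, forall w,
        (r_inf P S * (4^-1)%:E
         <= limn_einf (fun n => (rescaled_dist R Y n w)%:E))%E}].
Proof.
have Glf := connected_locally_finite Ginf Gconn Gdeg.
have Hlf := lamplighter_lf Glf.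
have Hc := lamplighter_countable Ginf Gconn Gdeg.
have [c [C [c0 C0 hret]]] := uwr_ret_bounds Ginf Gconn Gdeg hS Gwr.
have lower : {ae PY, forall w, \forall n \near \oo,
    (r_inf P S * (4^-1)%:E <= (rescaled_dist R Y n w)%:E)%E}.
  case rE : (r_inf P S) => [r| |].
  - have [r0|r0] := ltP 0 r; last first.
      apply: aeW => w; apply: nearW => n; rewrite -EFinM lee_fin.
      apply: le_trans (rescaled_dist_ge0 R Y n w).
      by rewrite mulr_le0_ge0 ?invr_ge0 ?ler0n.
    (* The factor 101/100 in [dist_lower_ae] compensates for taking rho strictly below [r_inf], so
       the bound by a quarter of [r_inf] holds eventually. *)
    pose rho := 100 / 101 * r.
    have rho0 : 0 < rho by rewrite /rho mulr_gt0 ?divr_gt0 ?ltr0n.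
    have rhor : (rho%:E < r_inf P S)%E.
      by rewrite rE lte_fin /rho; move: r0; clear; lra.
    have := dist_lower_ae Ginf Gconn Gdeg hY c0 C0 hret rho0
      (r_inf_noret Ginf Gconn Gdeg hS rhor).
    apply: filterS => w; apply: filterS => n; rewrite -EFinM lee_fin; apply: le_trans.
    by rewrite /rho; clear; lra.
  - by have := r_inf_ltry Ginf Gconn Gdeg hS Gwr; rewrite rE.
  - apply: aeW => w; apply: nearW => n.
    by rewrite mulNyr gtr0_sg ?invr_gt0 ?ltr0n// mul1e leNye.
split.
- have D2 := max_deg_ge2 Ginf Gconn Gdeg R.
  have := r_sup_ge0 Ginf Gconn Gdeg hS; case rE : (r_sup P S) => [r| |]// r0; last first.
    apply: aeW => w; rewrite mulry gtr0_sg ?mul1e ?leey//.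
    by move: D2; clear; lra.
  rewrite lee_fin in r0.
  (* Countably many levels decreasing to r keep the exceptional set null. *)
  have h : {ae PY, forall w, forall k : nat, \forall n \near \oo,
      rescaled_dist R Y n w <= 5 * (r + k.+1%:R^-1)}.
    apply: ae_foralln => k.
    have rho0 : 0 < r + k.+1%:R^-1 by rewrite ltr_wpDl// invr_gt0.
    apply: (dist_upper_ae Ginf Gconn Gdeg hY rho0).
    by apply: (r_sup_noret Ginf Gconn Gdeg hS); rewrite rE lte_fin ltrDl invr_gt0.
  (* As [max_deg] is at least 2 and r is nonnegative, 5 r is at most the required bound. *)
  apply: filterS h => w hw; apply: (@le_trans _ _ (5 * r)%:E); last first.
    by rewrite -EFinM lee_fin ler_wpM2r//; move: D2; clear; lra.
  apply/lee_addgt0Pr => e e0; pose k := Num.truncn (5 / e).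
  have hk : 5 * k.+1%:R^-1 <= e.
    rewrite ler_pdivrMr// mulrC -ler_pdivrMr//.
    by apply/ltW; exact: truncnS_gt.
  apply: limn_esup_le; apply: filterS (hw k) => n hn.
  by rewrite -EFinD lee_fin (le_trans hn)// mulrDr lerD2l.
- apply: cvg_prob_ae_near => [n|].
    (* Written through the start and the trajectory, the event is seen to be measurable. *)
    rewrite (_ : [set _ | _] = [set w | ((gdist (Y 0%N w)
        (last (Y 0%N w) (trajectory Y n w)))%:R / (n%:R / ln n%:R))%:E
          <= r_inf P S * (4^-1)%:E - eps%:E]%E); last first.
      by apply/seteqP; split => w; rewrite !mksetE (last_trajectory n erefl).
    exact: (measurable_start_trajectory Hc hY n (fun a q => (((gdist a
      (last a q))%:R / (n%:R / ln n%:R))%:E <= r_inf P S * (4^-1)%:E - eps%:E)%E)).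
  apply: filterS lower => w; apply: filterS => n /= h1 h2.
  have := le_trans h1 h2; have := r_inf_ltry Ginf Gconn Gdeg hS Gwr.
  move: h1 h2; case: (r_inf P S) => [r| |]// _ h2 _.
    by rewrite -EFinM -EFinB lee_fin leNgt ltrBlDr ltrDl heps.
  by move: h2; rewrite mulNyr gtr0_sg ?invr_gt0 ?ltr0n// mul1e.
- move=> _ _ _; apply: filterS lower => w h.
  exact: limn_einf_ge.
Qed.
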